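(* Let $d\ge1$, $L>0$, and let $\sigma_1,\sigma_2,\dots$ be i.i.d. random reflections of $\mathbb{R}^d$ with law $\mathbb{P}(\sigma_i(0)\in B)=(2L\omega_d)^{-1}\int_{B\cap B_{2L}}|x|^{-(d-1)}\,dx$. Let $A$ be a ball of radius $r>0$ contained in $B_L$, $A_n=A^{\sigma_1\cdots\sigma_n}$ (which is again a ball of radius $r$), and let $X_n$ be the distance from the origin of the centre of $A_n$, with $X_0>0$. Let $u$ be any unit vector, and put $$c_\alpha=(2L\omega_d)^{-1}\int_{|y|<1}(1-|y|^\alpha)|u-y|^{-(d-1)}\,dy\quad(\alpha>0),\qquad c_0=1 .$$ The following hold. (i) The moments of $X_n$ can be computed exactly: for integers $j\ge1$, $$\mathbb{E}[X_n^j]=\sum_{k=0}^n\binom nk(-1)^kX_0^{k+j}\prod_{i=0}^{k}c_{i+j-1}.$$ (ii) The moment $\mathbb{E}[X_n^k]$ is increasing in $X_0$ for all $k$ and all $n$. (iii) If $d=1$, then $\mathbb{E}[X_n]=2L\int_0^{X_0/2L}(1-t)^n\,dt$, and $nX_n$ converges in distribution to an exponential distribution with scale parameter $2L$. (iv) If $\alpha\ge1$, then $\mathbb{E}[X_n^\alpha]\le(X_0^{-1}+c_\alpha\alpha^{-1}n)^{-\alpha}$. (v) If $d>1$, then $\mathbb{E}[X_n]\ge(X_0^{-1}+\ell_d n)^{-1}$, where $$\ell_d=(2L\omega_d)^{-1}\int_{|y|<1}(1-|y|)|y|^{-1}|u-y|^{-(d-1)}\,dy .$$ (vi) $nX_n$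 converges in distribution to a random variable $Y$ with moments $$\mathbb{E}[Y^k]=\frac{\alpha_d(2L)^k(k-1)!}{\prod_{i=1}^{k-1}\overline c_i},\qquad \alpha_d=\lim_{n\to\infty}n\sum_{k=0}^n\binom nk(-1)^k2^{-(k+1)}\prod_{i=0}^k\overline c_i,$$ where $\overline c_k=\omega_d^{-1}\int_{|y|<1}(1-|y|^k)|u-y|^{-(d-1)}\,dy$ for $k\ge1$ and $\overline c_0$ is set to $1$. (vii) $n\cdot m(A_n\triangle A^* )$ converges in distribution to $4\kappa_{d-1}r^{d}\,Y$, with $Y$ as in (vi).
   Context: $m$ is Lebesgue measure on $\mathbb{R}^d$; $B_r$ is the ball of radius $r$ centered at the origin; $\kappa_d$ is the volume of the unit ball in $\mathbb{R}^d$ ($\kappa_0=1$); $\omega_d$ is the surface area of the unit ball of $\mathbb{R}^d$. $A^*$ is the open ball centered at the origin with $m(A^* )=m(A)$. Polarization: let $\Omega$ be the set of reflections of $\mathbb{R}^d$ across affine hyperplanes that do not map the origin to itself (a reflection $\sigma\in\Omega$ is determined by the point $\sigma(0)\ne 0$). For $\sigma\in\Omega$, let $X_0^\sigma$ be the hyperplane fixed by $\sigma$, $X_+^\sigma$ the open half-space of its complement containing $0$ and $X_-^\sigma$ the other one. The polarization of $f$ is $f^\sigma(x)=\max(f(x),f(\sigma(x)))$ for $x\in X_+^\sigma$, $f^\sigma(x)=\min(f(x),f(\sigma(x)))$ for $x\in X_-^\sigma$, and $f^\sigma(x)=f(x)$ for $x\in X_0^\sigma$. For a set $A$, $A^\sigma$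 is the set with $\mathbf{1}_{A^\sigma}=(\mathbf{1}_A)^\sigma$. $A^{\sigma_1\cdots\sigma_n}$ denotes the result of polarizing successively with respect to $\sigma_1$, then $\sigma_2$, ..., then $\sigma_n$.
   Formalization: In (i) the product is taken over i=1,…,k instead of i=0,…,k (the printed formula fails for j≥2, e.g. n=0); in (vii) the limit is 2κ_{d-1}r^{d-1}Y instead of 4κ_{d-1}r^dY (the printed one fails for d=1, r≠1/2). *)

(* Defs.v *)
From HB Require Import structures.
From mathcomp Require Import all_boot all_order all_algebra.
From mathcomp Require Import all_classical all_reals all_analysis.
Set Implicit Arguments.
Unset Strict Implicit.
Unset Printing Implicit Defensive.
Import Order.TTheory GRing.Theory Num.Theory.
Import numFieldNormedType.Exports.
Local Open Scope classical_set_scope.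
Local Open Scope ring_scope.

(* The Borel sigma-algebra of R^n, generated by the coordinates (as the library
   does for [n.-tuple T]). *)
Definition rV_display : measure_display -> measure_display.
Proof. exact. Qed.

Section measurable_rV.
Context {d} {T : measurableType d} (n : nat).

Let coord (i : 'I_n) (v : 'rV[T]_n) : T := v ord0 i.

Let rV_set0 : g_sigma_preimage coord set0.
Proof. exact: sigma_algebra0. Qed.

Let rV_setC A : g_sigma_preimage coord A -> g_sigma_preimage coord (~` A).
Proof. exact: sigma_algebraC. Qed.

Let rV_bigcup (F : _^nat) : (forall i, g_sigma_preimage coord (F i)) ->
  g_sigma_preimage coord (\bigcup_i (F i)).
Proof. exact: sigma_algebra_bigcup. Qed.

HB.instance Definition _ := @isMeasurable.Build (rV_display d)
  'rV[T]_n (g_sigma_preimage coord) rV_set0 rV_setC rV_bigcup.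

End measurable_rV.

Section measurable_fun_rV.
Context {d1} {T1 : measurableType d1} {d} {T : measurableType d} (n : nat).

Lemma measurable_rV_coord (i : 'I_n) :
  measurable_fun [set: 'rV[T]_n] (fun v => v ord0 i).
Proof.
move=> _ Y mY; rewrite setTI; apply: sub_sigma_algebra => /=.
rewrite -bigcup_seq/=; exists i => /=; first by rewrite mem_index_enum.
by exists Y => //; rewrite setTI.
Qed.

Lemma measurable_fun_rVP (f : T1 -> 'rV[T]_n) :
  measurable_fun [set: T1] f <->
  forall i, measurable_fun [set: T1] (fun x => f x ord0 i).
Proof.
split=> [mf i|mf].
  exact: (measurableT_comp (measurable_rV_coord i) mf).
apply: (@measurability _ _ _ _ setT f
  (\big[setU/set0]_(i < n) preimage_set_system setT
     (fun v : 'rV[T]_n => v ord0 i) measurable)).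
  by [].
move=> _ [B + <-].
rewrite -bigcup_seq => -[i _ [C mC <-]].
by rewrite setTI -comp_preimage; apply: mf.
Qed.

End measurable_fun_rV.

(* Lebesgue measure on the Borel sets of R^n: the n-fold product of the Lebesgue
   measure on R; on R^0 it is the unit mass at the only point. *)
Section lebesgue_measure_rV.
Context {R : realType}.

Definition rV_cons n (p : R * 'rV[R]_n) : 'rV[R]_n.+1 :=
  \row_i (if unlift ord0 i is Some j then p.2 ord0 j else p.1).

Definition rV_uncons n (v : 'rV[R]_n.+1) : R * 'rV[R]_n :=
  (v ord0 ord0, \row_j v ord0 (lift ord0 j)).

Lemma rV_consK n : cancel (@rV_cons n) (@rV_uncons n).
Proof.
move=> [x v]; rewrite /rV_uncons /rV_cons/= mxE unlift_none; congr pair.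
by apply/rowP => j; rewrite !mxE liftK.
Qed.

Lemma measurable_rV_cons n : measurable_fun setT (@rV_cons n).
Proof.
apply/measurable_fun_rVP => i.
rewrite /rV_cons; under eq_fun do rewrite mxE.
case: (unliftP ord0 i) => [j|] _; last exact: measurable_fst.
exact: (measurableT_comp (measurable_rV_coord j) measurable_snd).
Qed.

Lemma measurable_rV_uncons n : measurable_fun setT (@rV_uncons n).
Proof.
apply/measurable_fun_pairP; split; first exact: measurable_rV_coord.
apply/measurable_fun_rVP => j.
apply: (eq_measurable_fun (fun v : 'rV[R]_n.+1 => v ord0 (lift ord0 j))).
  by move=> v _; rewrite /= mxE.
exact: measurable_rV_coord.
Qed.

Section step.
Variables (n : nat) (m : {sigma_finite_measure set 'rV[R]_n -> \bar R}).

Definition lebesgue_rVS : set 'rV[R]_n.+1 -> \bar R :=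
  pushforward (lebesgue_measure \x m)%E (@rV_cons n).

Let lebesgue_rVS0 : lebesgue_rVS set0 = 0%E.
Proof. by rewrite /lebesgue_rVS /pushforward preimage_set0 measure0. Qed.

Let lebesgue_rVS_ge0 A : (0 <= lebesgue_rVS A)%E.
Proof. by rewrite /lebesgue_rVS /pushforward measure_ge0. Qed.

Let lebesgue_rVS_sigma_additive : semi_sigma_additive lebesgue_rVS.
Proof.
move=> F mF tF mUF; rewrite /lebesgue_rVS /pushforward preimage_bigcup.
have mcons A : measurable A -> measurable (@rV_cons n @^-1` A).
  by move=> mA; rewrite -[X in measurable X]setTI; exact: measurable_rV_cons.
apply: measure_semi_sigma_additive.
- by move=> k; exact: mcons.
- apply/trivIsetP => /= i j _ _ ij; rewrite -preimage_setI.
  by move/trivIsetP : tF => /(_ _ _ _ _ ij) ->//; rewrite preimage_set0.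
- by rewrite -preimage_bigcup; exact: mcons.
Qed.

HB.instance Definition _ := isMeasure.Build _ _ _ lebesgue_rVS
  lebesgue_rVS0 lebesgue_rVS_ge0 lebesgue_rVS_sigma_additive.

Let lebesgue_rVS_sigma_finite : sigma_finite setT lebesgue_rVS.
Proof.
have /sigma_finiteP[F [TF ndF Foo]] := sigma_finiteT (@lebesgue_measure R).
have /sigma_finiteP[G [TG ndG Goo]] := sigma_finiteT m.
exists (fun k => @rV_uncons n @^-1` (F k `*` G k)).
  rewrite -preimage_bigcup (_ : \bigcup_k _ = setT) ?preimage_setT//.
  apply/seteqP; split=> // -[x v] _.
  have [i _ Fix] : (\bigcup_k F k) x by rewrite -TF.
  have [j _ Gjv] : (\bigcup_k G k) v by rewrite -TG.
  exists (maxn i j) => //; split=> /=.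
    by move: x Fix; exact/subsetPset/ndF/leq_maxl.
  by move: v Gjv; exact/subsetPset/ndG/leq_maxr.
move=> k; have [mF Fk] := Foo k; have [mG Gk] := Goo k; split.
  rewrite -[X in measurable X]setTI; apply: measurable_rV_uncons => //.
  exact: measurableX.
rewrite /lebesgue_rVS /pushforward -comp_preimage.
have -> : @rV_uncons n \o @rV_cons n = id.
  by apply/funext => p; exact: rV_consK.
rewrite preimage_id.
by rewrite product_measure1E// lte_mul_pinfty// ge0_fin_numE.
Qed.

HB.instance Definition _ := Measure_isSigmaFinite.Build _ _ _ lebesgue_rVS
  lebesgue_rVS_sigma_finite.

End step.

Fixpoint lebesgue_rV n : {sigma_finite_measure set 'rV[R]_n -> \bar R} :=
  if n is n'.+1 then lebesgue_rVS (lebesgue_rV n')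
  else dirac (0 : 'rV[R]_0).

End lebesgue_measure_rV.

Section euclidean.
Context {R : realType}.

Definition dotv n (u v : 'rV[R]_n) : R := \sum_i u ord0 i * v ord0 i.

(* The library norm of ['rV[R]_n] is the sup norm, hence these definitions. *)
Definition enorm n (v : 'rV[R]_n) : R := Num.sqrt (dotv v v).

Definition eball n (c : 'rV[R]_n) (r : R) : set 'rV[R]_n :=
  [set x | enorm (x - c) < r].

(* kappa_n *)
Definition ball_volume n : R := fine (lebesgue_rV n (eball 0 1)).

(* omega_n, the area of the unit sphere: the ball of radius r has volume
   kappa_n * r ^ n, and its derivative at r = 1 is n * kappa_n. *)
Definition sphere_area n : R := n%:R * ball_volume n.

(* S = A^* *)
Definition is_ball_rearrangement n (A S : set 'rV[R]_n) :=
  exists rho : R, S = eball 0 rho /\ lebesgue_rV n S = lebesgue_rV n A.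

(* The centre of a ball (0 if A is not a ball). *)
Definition ball_center n (A : set 'rV[R]_n) : 'rV[R]_n :=
  xget 0 [set c | exists2 r : R, 0 < r & A = eball c r].

End euclidean.

Section polarization.
Context {R : realType} {d : nat}.

(* The reflection across the hyperplane {x | dotv v x = b}. *)
Definition reflect (v : 'rV[R]_d) (b : R) (x : 'rV[R]_d) : 'rV[R]_d :=
  x - (2 * (dotv v x - b) / dotv v v) *: v.

Record reflection := Reflection {
  normal : 'rV[R]_d;
  offset : R;
  normal_neq0 : normal != 0;
  reflect_origin_neq0 : reflect normal offset 0 != 0 }.

Definition reflection_fun (s : reflection) : 'rV[R]_d -> 'rV[R]_d :=
  reflect (normal s) (offset s).
Coercion reflection_fun : reflection >-> Funclass.

(* [offset s != 0] as s moves the origin; the two open half-spaces are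
   told apart by comparing the sign of [offset s - dotv (normal s) x] with its
   sign at x = 0. *)
Definition half_pos (s : reflection) : set 'rV[R]_d :=
  [set x | 0 < (offset s - dotv (normal s) x) * offset s].

Definition half_neg (s : reflection) : set 'rV[R]_d :=
  [set x | (offset s - dotv (normal s) x) * offset s < 0].

Definition polarize (s : reflection) (f : 'rV[R]_d -> R) (x : 'rV[R]_d) : R :=
  if x \in half_pos s then Num.max (f x) (f (s x))
  else if x \in half_neg s then Num.min (f x) (f (s x))
  else f x.

Definition polarize_set (s : reflection) (A : set 'rV[R]_d) : set 'rV[R]_d :=
  [set x | polarize s \1_A x = 1].

Lemma indic_polarize_set s A :
  \1_(polarize_set s A) = polarize s \1_A :> ('rV[R]_d -> R).
Proof.
apply/funext => x; rewrite [LHS]indicE.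
have : polarize s \1_A x = 0 \/ polarize s \1_A x = 1.
  have i01 y : (\1_A y : R) = 0 \/ (\1_A y : R) = 1.
    by rewrite indicE; case: (y \in A); [right|left].
  rewrite /polarize; case: ifP => _; last case: ifP => _; last exact: i01.
    by rewrite /Num.max; case: ifP.
  by rewrite /Num.min; case: ifP.
case=> pE; rewrite pE.
  rewrite (_ : _ \in _ = false)//; apply/negP; rewrite inE /polarize_set/= pE.
  by move/eqP; rewrite eq_sym oner_eq0.
by rewrite (_ : _ \in _ = true)//; apply/mem_set.
Qed.

(* [polarize_iter s A n] polarizes A with respect to s 0, then s 1, ..., then
   s (n - 1). *)
Fixpoint polarize_iter (s : nat -> reflection) (A : set 'rV[R]_d) (n : nat) :
    set 'rV[R]_d :=
  if n is n'.+1 then polarize_set (s n') (polarize_iter s A n') else A.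

End polarization.
Arguments reflection R d : clear implicits.

Section probability.
Context {R : realType} {disp : measure_display} {T : measurableType disp}.
Variable P : probability T R.

Definition mutually_independent {disp'} {T' : measurableType disp'}
    (Z : nat -> T -> T') :=
  forall (J : seq nat) (B : nat -> set T'), uniq J ->
    (forall j, j \in J -> measurable (B j)) ->
    P (\bigcap_(j in [set` J]) Z j @^-1` B j) =
    (\prod_(j <- J) P (Z j @^-1` B j))%E.

Definition iid_reflections {d} (L : R) (sigma : nat -> T -> reflection R d) :=
  [/\ forall i, measurable_fun setT (fun w => sigma i w 0),
      forall i (B : set 'rV[R]_d), measurable B ->
        P [set w | B (sigma i w 0)] =
        (((2 * L * sphere_area d)^-1)%:E *
         \int[lebesgue_rV d]_(x in B `&` eball 0 (2 * L))
           (enorm x ^- d.-1)%:E)%E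
    & mutually_independent (fun i w => sigma i w 0)].

(* mu is the law of the limit. *)
Definition cvg_in_distribution (Z : nat -> T -> R) (mu : set R -> \bar R) :=
  (forall n, measurable_fun setT (Z n)) /\
  forall f : R -> R, continuous f -> (exists M, forall x, `|f x| <= M) ->
    (\int[P]_w (f (Z n w))%:E @[n --> \oo] --> \int[mu]_y (f y)%:E)%E.

(* The set A_n and the distance X_n of its centre from the origin, started from
   A_0 = A. *)
Definition polarized {d} (sigma : nat -> T -> reflection R d)
    (A : set 'rV[R]_d) (n : nat) (w : T) : set 'rV[R]_d :=
  polarize_iter (fun i => sigma i w) A n.

Definition center_dist {d} (sigma : nat -> T -> reflection R d)
    (A : set 'rV[R]_d) (n : nat) (w : T) : R :=
  enorm (ball_center (polarized sigma A n w)).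

End probability.

Section constants.
Context {R : realType} {d : nat}.
Variable u : 'rV[R]_d.

(* c_a, for a > 0 real, and c_0 = 1 *)
Definition cst_c (L a : R) : R :=
  if a == 0 then 1 else
  (2 * L * sphere_area d)^-1 *
  \int[lebesgue_rV d]_(y in eball 0 1)
    ((1 - enorm y `^ a) * enorm (u - y) ^- d.-1).

(* \overline c_k *)
Definition cst_cbar (k : nat) : R :=
  if k == 0%N then 1 else
  (sphere_area d)^-1 *
  \int[lebesgue_rV d]_(y in eball 0 1)
    ((1 - enorm y ^+ k) * enorm (u - y) ^- d.-1).

(* \ell_d *)
Definition cst_ell (L : R) : R :=
  (2 * L * sphere_area d)^-1 *
  \int[lebesgue_rV d]_(y in eball 0 1)
    ((1 - enorm y) * (enorm y)^-1 * enorm (u - y) ^- d.-1).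

Definition alpha_seq (n : nat) : R :=
  n%:R * \sum_(0 <= k < n.+1) 'C(n, k)%:R * (-1) ^+ k * 2 ^- k.+1 *
           \prod_(0 <= i < k.+1) cst_cbar i.

(* alpha_d *)
Definition cst_alpha : R := limn alpha_seq.

End constants.

(* Main.v *)
(* The centre of the polarized ball moves from x to its mirror image exactly when
   |x - p| < |x|, where p = sigma(0), so its norm is a Markov chain with transition
   x |-> min(|x|, |x - p|).  The density |p|^-(d-1) is the one for which scaling
   gives E|X'|^alpha = |x|^alpha - c_alpha |x|^(alpha+1); iterating this with
   alpha = j, j+1, ... gives (i).  The symmetry of the law makes a move happen with
   probability at most 1/2, whence (ii) by induction on n.  Lyapunov's inequality
   turns the recursion into (iv), and the same computation for 1/|X|, followed by
   Jensen's inequality, gives (v).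

   For (vi), convexity of the moments in n makes n^j E[X_n^j] nondecreasing, and the
   recursion forces its limits to satisfy c_j m_(j+1) = j m_j, so that m_j grows
   factorially.  Such moments control E[phi(exp(-h n X_n))] for every Lipschitz phi, by
   the Taylor expansion of exp(-h x) and Bernstein polynomials; hence the
   distribution functions converge, and the quantile functions of n X_n converge
   almost everywhere on ]0,1[ to the required variable Y.  Finally the symmetric
   difference of two balls of radius r at distance x has measure
   2 kappa_(d-1) r^(d-1) x (1 + o(1)) as x -> 0, by slicing along the axis of the
   centres, and (vii) follows along the same coupling. *)
From HB Require Import structures.
From mathcomp Require Import all_boot all_order all_algebra.
From mathcomp Require Import all_classical all_reals all_analysis.
From mathcomp Require Import measurable_realfun ring lra.
Require Import Defs.
Set Implicit Arguments.
Unset Strict Implicit.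
Unset Printing Implicit Defensive.
Import Order.TTheory GRing.Theory Num.Theory.
Import numFieldNormedType.Exports.
Local Open Scope classical_set_scope.
Local Open Scope ring_scope.

(** * Euclidean geometry of row vectors *)

(** The radial part of the law of sigma(0) is uniform on ]0, 2L[. Hence the chain of norms started
    at q x, with 0 <= q <= 1, is q times the chain started at x, run on a clock that ticks with
    probability q only. This thinning is why the limits in (vi) forget X_0, so that alpha_d can be
    read off from the start X_0 = L, where X_0 / (2L) = 1/2 produces the powers of 1/2. It is used
    in algebraic form: E[X_n^j] is a polynomial in X_0, [moment_poly], and the limits are studied on
    these polynomials.

    Lebesgue measure is built as a product, which displays its behaviour under translations and
    dilations but not under rotations. Rotations are needed for the constants to be independent of
    u, and for (vii). Reflections replace them, and they preserve the measure because a
    translation-invariant measure is determined by its value on the unit ball.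

    No limit variable is given in advance. Realising all the n X_n on ]0,1[ with pointwise
    convergence yields Y, and whatever is a function of n X_n, as in (vii), then converges on the
    same space. *)

Section euclidean_space.
Context {R : realType} {n : nat}.
Implicit Types (u v w : 'rV[R]_n) (x k : R).

Lemma dotvC u v : dotv u v = dotv v u.
Proof. by apply: eq_bigr => i _; rewrite mulrC. Qed.

Lemma dotvDl u v w : dotv (u + v) w = dotv u w + dotv v w.
Proof. by rewrite -big_split; apply: eq_bigr => i _; rewrite !mxE mulrDl. Qed.

Lemma dotvZl k u w : dotv (k *: u) w = k * dotv u w.
Proof. by rewrite mulr_sumr; apply: eq_bigr => i _; rewrite !mxE mulrA. Qed.

Lemma dotvNl u w : dotv (- u) w = - dotv u w.
Proof. by rewrite -scaleN1r dotvZl mulN1r. Qed.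

Lemma dotvDr u v w : dotv w (u + v) = dotv w u + dotv w v.
Proof. by rewrite dotvC dotvDl !(dotvC w). Qed.

Lemma dotvZr k u w : dotv w (k *: u) = k * dotv w u.
Proof. by rewrite dotvC dotvZl (dotvC w). Qed.

Lemma dotvNr u w : dotv w (- u) = - dotv w u.
Proof. by rewrite dotvC dotvNl (dotvC w). Qed.

Definition dotvE := (dotvDl, dotvDr, dotvZl, dotvZr, dotvNl, dotvNr).

Lemma dotv_ge0 v : 0 <= dotv v v.
Proof. by apply: sumr_ge0 => i _; rewrite -expr2 sqr_ge0. Qed.

Lemma dotv_eq0 v : (dotv v v == 0) = (v == 0).
Proof.
apply/eqP/eqP => [/psumr_eq0P v0|->]; last first.
  by rewrite /dotv big1// => i _; rewrite mxE mul0r.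
apply/rowP => i; rewrite mxE; apply/eqP.
rewrite -sqrf_eq0 expr2; apply/eqP/v0 => // j _.
by rewrite -expr2 sqr_ge0.
Qed.

Lemma enorm_ge0 v : 0 <= enorm v.
Proof. exact: sqrtr_ge0. Qed.

Lemma sqr_enorm v : enorm v ^+ 2 = dotv v v.
Proof. by rewrite sqr_sqrtr ?dotv_ge0. Qed.

Lemma enorm_eq0 v : (enorm v == 0) = (v == 0).
Proof. by rewrite -sqrf_eq0 sqr_enorm dotv_eq0. Qed.

Lemma enorm0 : enorm (0 : 'rV[R]_n) = 0.
Proof. by apply/eqP; rewrite enorm_eq0. Qed.

Lemma enorm_gt0 v : (0 < enorm v) = (v != 0).
Proof. by rewrite lt_def enorm_ge0 andbT enorm_eq0. Qed.

Lemma enormZ k v : enorm (k *: v) = `|k| * enorm v.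
Proof.
by rewrite /enorm !dotvE mulrA -expr2 sqrtrM ?sqr_ge0// sqrtr_sqr.
Qed.

Lemma enormN v : enorm (- v) = enorm v.
Proof. by rewrite -scaleN1r enormZ normrN1 mul1r. Qed.

Lemma enormB v w : enorm (v - w) = enorm (w - v).
Proof. by rewrite -enormN opprB. Qed.

Lemma dotv_le v w : dotv v w <= enorm v * enorm w.
Proof.
have [->|v0] := eqVneq v 0.
  by rewrite enorm0 mul0r /dotv big1// => i _; rewrite mxE mul0r.
have [->|w0] := eqVneq w 0.
  by rewrite enorm0 mulr0 /dotv big1// => i _; rewrite mxE mulr0.
have := dotv_ge0 (enorm w *: v - enorm v *: w).
rewrite !dotvE (dotvC w v) -!sqr_enorm.
move: v0 w0; rewrite -!enorm_gt0; set a := enorm v; set b := enorm w => a0 b0.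
move=> h; rewrite -subr_ge0 -(pmulr_rge0 _ (mulr_gt0 a0 b0)).
nra.
Qed.

Lemma ler_enormD v w : enorm (v + w) <= enorm v + enorm w.
Proof.
rewrite -(ler_sqr (enorm_ge0 _)) ?nnegrE ?addr_ge0 ?enorm_ge0//.
rewrite sqrrD !sqr_enorm !dotvE (dotvC w v).
have := dotv_le v w; lra.
Qed.

Lemma ler_enormB v w : enorm v - enorm w <= enorm (v - w).
Proof. by rewrite lerBlDr (le_trans _ (ler_enormD _ _))// subrK. Qed.

Lemma enorm_sub_sqr v w :
  enorm (v - w) ^+ 2 = enorm v ^+ 2 - 2 * dotv v w + enorm w ^+ 2.
Proof. by rewrite !sqr_enorm !dotvE (dotvC w v); ring. Qed.

Lemma ltr_enorm_sqr v w : (enorm v < enorm w) = (enorm v ^+ 2 < enorm w ^+ 2).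
Proof. by rewrite ltr_pXn2r// nnegrE enorm_ge0. Qed.

Lemma ler_enorm_sqr v w : (enorm v <= enorm w) = (enorm v ^+ 2 <= enorm w ^+ 2).
Proof. by rewrite ler_pXn2r// nnegrE enorm_ge0. Qed.

Lemma measurable_fun_dotv d (T : measurableType d) (f g : T -> 'rV[R]_n) :
  measurable_fun setT f -> measurable_fun setT g ->
  measurable_fun setT (fun t => dotv (f t) (g t)).
Proof.
move=> /measurable_fun_rVP mf /measurable_fun_rVP mg.
by apply: measurable_sum => i; exact: measurable_funM.
Qed.

Lemma measurable_fun_addv d (T : measurableType d) (f g : T -> 'rV[R]_n) :
  measurable_fun setT f -> measurable_fun setT g ->
  measurable_fun setT (fun t => f t + g t).
Proof.
move=> /measurable_fun_rVP mf /measurable_fun_rVP mg.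
apply/measurable_fun_rVP => i; under eq_fun do rewrite mxE.
exact: measurable_funD.
Qed.

Lemma measurable_fun_scalev d (T : measurableType d) (k : T -> R)
    (f : T -> 'rV[R]_n) :
  measurable_fun setT k -> measurable_fun setT f ->
  measurable_fun setT (fun t => k t *: f t).
Proof.
move=> mk /measurable_fun_rVP mf.
apply/measurable_fun_rVP => i; under eq_fun do rewrite mxE.
exact: measurable_funM.
Qed.

Lemma measurable_fun_oppv d (T : measurableType d) (f : T -> 'rV[R]_n) :
  measurable_fun setT f -> measurable_fun setT (fun t => - f t).
Proof.
move=> mf; under eq_fun do rewrite -scaleN1r.
exact: measurable_fun_scalev.
Qed.

Lemma measurable_fun_subv d (T : measurableType d) (f g : T -> 'rV[R]_n) :
  measurable_fun setT f -> measurable_fun setT g ->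
  measurable_fun setT (fun t => f t - g t).
Proof. by move=> mf mg; apply: measurable_fun_addv => //; exact: measurable_fun_oppv. Qed.

Lemma measurable_fun_enorm d (T : measurableType d) (f : T -> 'rV[R]_n) :
  measurable_fun setT f -> measurable_fun setT (fun t => enorm (f t)).
Proof.
move=> mf; rewrite /enorm.
apply: (@measurableT_comp _ _ _ _ _ _ (@Num.sqrt R)).
  by apply: continuous_measurable_fun; exact: sqrt_continuous.
exact: measurable_fun_dotv.
Qed.

Lemma measurable_eball c x : measurable (eball c x : set 'rV[R]_n).
Proof.
rewrite /eball -[X in measurable X]setTI.
have -> : [set v | enorm (v - c) < x] = (fun v => enorm (v - c)) @^-1` `]-oo, x[.
  by apply/seteqP; split => v /=; rewrite in_itv.
apply: measurable_fun_enorm => //.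
exact: measurable_fun_subv.
Qed.

(** An inclusion between balls with distinct centres a and b forces |a - b| + y <= y' ([half]).
    Adding this for the two inclusions would give |c - c'| <= 0. This is what makes [ball_center]
    meaningful. *)
Lemma eball_inj c c' x x' : 0 < x -> 0 < x' ->
  eball c x = eball c' x' :> set 'rV[R]_n -> c = c'.
Proof.
have half (a b : 'rV[R]_n) y y' : 0 < y -> a != b ->
    eball a y `<=` eball b y' -> enorm (a - b) + y <= y'.
  move=> y0 ab sub; set e := enorm (a - b).
  have e0 : 0 < e by rewrite enorm_gt0 subr_eq0.
  apply/ler_addgt0Pr => z z0; rewrite -lerBlDr.
  have [yz|zy] := leP y z.
    have := sub a; rewrite /eball/= subrr enorm0 => /(_ y0); rewrite -/e; lra.
  (* The point at distance y - z from a on the side away from b: it nearly realises the largest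
     distance to b within the ball. *)
  have := sub (a + ((y - z) / e) *: (a - b)).
  rewrite /eball/= [a + _]addrC addrK enormZ -/e ger0_norm; last first.
    by rewrite divr_ge0 ?subr_ge0// ltW.
  rewrite divfK ?gt_eqF// ltrBlDr ltrDl => /(_ z0).
  rewrite -addrA -[X in _ + X]scale1r -scalerDl enormZ -/e ger0_norm; last first.
    by rewrite addr_ge0// divr_ge0 ?subr_ge0// ltW.
  rewrite mulrDl mul1r divfK ?gt_eqF//; lra.
move=> x0 x'0 E; apply/eqP; apply/negPn/negP => cc'.
have h1 := half _ _ _ x' x0 cc'; have h2 := half c' c x' x x'0.
have := h1; rewrite E => /(_ (@subset_refl _ _)).
move: h2; rewrite E eq_sym enormB => /(_ cc' (@subset_refl _ _)).
have : 0 < enorm (c - c') by rewrite enorm_gt0 subr_eq0.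
lra.
Qed.

End euclidean_space.

(** * Lebesgue measure on R^n: affine maps, uniqueness, volume of balls *)

Lemma product_measure_preimage d1 d2 (T1 : measurableType d1)
    (T2 : measurableType d2) (R : realType)
    (m1 : {sigma_finite_measure set T1 -> \bar R})
    (m2 : {sigma_finite_measure set T2 -> \bar R})
    (f : T1 -> T1) (g : T2 -> T2) (s t : R) :
  measurable_fun setT f -> measurable_fun setT g -> 0 < s -> 0 < t ->
  (forall A, measurable A -> m1 (f @^-1` A) = (s%:E * m1 A)%E) ->
  (forall A, measurable A -> m2 (g @^-1` A) = (t%:E * m2 A)%E) ->
  forall A, measurable A ->
  (m1 \x m2)%E ((fun p => (f p.1, g p.2)) @^-1` A) = ((s * t)%:E * (m1 \x m2) A)%E.
Proof.
move=> mf mg s0 t0 m1f m2g A mA.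
have st0 : 0 < s * t by exact: mulr_gt0.
have mfg : measurable_fun setT (fun p : T1 * T2 => (f p.1, g p.2)).
  apply/measurable_fun_pairP; split.
    exact: (measurableT_comp mf measurable_fst).
  exact: (measurableT_comp mg measurable_snd).
have k0 : 0 <= (s * t)^-1 by rewrite invr_ge0 ltW.
(* The image of the product under (f, g), divided by s t, agrees with the product on rectangles, and
   the product measure is unique. This is the passage from dimension n to n + 1. *)
pose m' : {measure set (T1 * T2) -> \bar R} :=
  mscale (NngNum k0) (measure_function_pushforward__canonical__measure_function_Measure
     (m1 \x m2)%E mfg).
have m'E X : m' X = ((s * t)^-1%:E * (m1 \x m2)
    ((fun p => (f p.1, g p.2)) @^-1` X))%E by [].
suff -> : (m1 \x m2)%E A = m' A.
  by rewrite m'E muleA -EFinM divff ?gt_eqF// mul1e.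
apply: product_measure_unique => //.
move=> X Y mX mY; rewrite m'E (_ : _ @^-1` _ = (f @^-1` X) `*` (g @^-1` Y))//.
rewrite product_measure1E//; last 2 first.
- by rewrite -[X in measurable X]setTI; exact: mf.
- by rewrite -[X in measurable X]setTI; exact: mg.
transitivity ((s * t)^-1%:E * ((s%:E * m1 X) * (t%:E * m2 Y)))%E.
  by congr (_ * (_ * _))%E; [exact: m1f|exact: m2g].
transitivity (((s * t)^-1 * (s * t))%:E * (m1 X * m2 Y))%E.
  by rewrite !EFinM -!muleA; do 2 congr (_ * _)%E; rewrite muleCA.
by rewrite mulVf ?gt_eqF// mul1e.
Qed.

Section affine.
Context {R : realType}.

Lemma lebesgue_measure_affine (t b : R) : 0 < t -> forall A, measurable A ->
  lebesgue_measure ((fun x => t * x + b) @^-1` A : set (measurableTypeR R)) =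
  (t^-1%:E * lebesgue_measure A)%E.
Proof.
move=> t0 A mA.
have mf : measurable_fun [set: measurableTypeR R]
    (fun x : measurableTypeR R => t * x + b : measurableTypeR R).
  by apply: measurable_funD => //; exact: measurable_funM.
pose m' : {measure set (measurableTypeR R) -> \bar R} :=
  mscale (NngNum (ltW t0)) (measure_function_pushforward__canonical__measure_function_Measure
     (@lebesgue_measure R) mf).
have m'E X : m' X = (t%:E * lebesgue_measure
    ((fun x => t * x + b)%R @^-1` X : set (measurableTypeR R)))%E by [].
suff -> : lebesgue_measure A = m' A.
  by rewrite m'E muleA -EFinM mulVf ?gt_eqF// mul1e.
apply: lebesgue_measure_unique => // _ [[x y]] _ <-; rewrite m'E.
have -> : (fun x => t * x + b) @^-1` `]x, y]%classic =
    `](x - b) / t, (y - b) / t]%classic.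
  apply/seteqP; split => z /=; rewrite !in_itv/= ltr_pdivrMr// ler_pdivlMr//;
    rewrite ltrBlDr lerBrDr (mulrC z)//.
rewrite !lebesgue_measure_itv/= !lte_fin ltr_pM2r ?invr_gt0// ltrD2r.
case: ifPn => _; last by rewrite mule0.
by rewrite -!EFinB -EFinM -mulrBl mulrC divfK ?gt_eqF// opprB addrA subrK.
Qed.

Lemma lebesgue_rVS_E n (A : set 'rV[R]_n.+1) :
  lebesgue_rV n.+1 A = (lebesgue_measure \x lebesgue_rV n)%E (@rV_cons R n @^-1` A).
Proof. by []. Qed.

Lemma measurable_preimage d1 d2 (T1 : measurableType d1) (T2 : measurableType d2)
  (f : T1 -> T2) A : measurable_fun setT f -> measurable A -> measurable (f @^-1` A).
Proof. by move=> mf mA; rewrite -[X in measurable X]setTI; exact: mf. Qed.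

Lemma measurable_affine n (t : R) (b : 'rV[R]_n) :
  measurable_fun setT (fun v : 'rV[R]_n => t *: v + b).
Proof.
by apply: measurable_fun_addv => //; exact: measurable_fun_scalev.
Qed.

Lemma lebesgue_rV_affine n (t : R) (b : 'rV[R]_n) : 0 < t ->
  forall A, measurable A ->
  lebesgue_rV n ((fun v : 'rV[R]_n => t *: v + b) @^-1` A) =
  ((t ^- n)%:E * lebesgue_rV n A)%E.
Proof.
move=> t0; elim: n b => [|n IH] b A mA.
  rewrite expr0 invr1 mul1e/=; congr dirac.
  apply/funext => v /=; congr (A _).
  by apply/rowP => -[].
rewrite lebesgue_rVS_E -comp_preimage.
pose b' : 'rV[R]_n := \row_j b ord0 (lift ord0 j).
have -> : ((fun v => t *: v + b) \o @rV_cons R n) =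
    @rV_cons R n \o (fun p : measurableTypeR R * 'rV[R]_n =>
      (t * p.1 + b ord0 ord0 : measurableTypeR R, t *: p.2 + b')).
  apply/funext => -[x v]; apply/rowP => i /=; rewrite !mxE.
  by case: unliftP => [j|] ->; rewrite /= ?mxE.
rewrite comp_preimage.
rewrite lebesgue_rVS_E exprS invfM.
apply: (@product_measure_preimage _ _ (measurableTypeR R) 'rV[R]_n R
  lebesgue_measure (lebesgue_rV n) (fun x => t * x + b ord0 ord0)
  (fun v => t *: v + b')) => //.
- by apply: measurable_funD => //; exact: measurable_funM.
- exact: measurable_affine.
- by rewrite invr_gt0.
- by rewrite invr_gt0 exprn_gt0.
- by move=> B mB; exact: lebesgue_measure_affine.
- by move=> B mB; exact: IH.
- exact: (measurable_preimage (@measurable_rV_cons _ _) mA).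
Qed.

End affine.

Section translation_invariant_measures.
Context {R : realType} {n : nat}.
Variables mu nu : {sigma_finite_measure set 'rV[R]_n -> \bar R}.
Hypothesis muT : forall (b : 'rV[R]_n) A, measurable A ->
  mu ((fun v => v + b) @^-1` A) = mu A.
Hypothesis nuT : forall (b : 'rV[R]_n) A, measurable A ->
  nu ((fun v => v + b) @^-1` A) = nu A.

(* Fubini for [1_A(x) 1_B(x + y)] over [mu(dx) nu(dy)], translating x by -y. *)
Lemma translation_invariant_cross A B : measurable A -> measurable B ->
  (mu A * nu B = nu ((fun v => - v)%R @^-1` A) * mu B)%E.
Proof.
move=> mA mB.
pose S : set ('rV[R]_n * 'rV[R]_n) := [set p | A p.1 /\ B (p.1 + p.2)].
pose S' : set ('rV[R]_n * 'rV[R]_n) := [set p | A (p.1 - p.2) /\ B p.1].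
have m1 : measurable_fun setT (fun p : 'rV[R]_n * 'rV[R]_n => p.1).
  exact: measurable_fst.
have m2 : measurable_fun setT (fun p : 'rV[R]_n * 'rV[R]_n => p.2).
  exact: measurable_snd.
have mS : measurable S.
  apply: measurableI; first exact: (measurable_preimage m1 mA).
  exact: (measurable_preimage (measurable_fun_addv m1 m2) mB).
have mS' : measurable S'.
  apply: measurableI; last exact: (measurable_preimage m1 mB).
  exact: (measurable_preimage (measurable_fun_subv m1 m2) mA).
have mNA : measurable ((fun v => - v) @^-1` A).
  have mN : measurable_fun setT (fun v : 'rV[R]_n => - v).
    by apply: measurable_fun_oppv; exact: measurable_id.
  exact: (measurable_preimage mN mA).
have := indic_fubini_tonelli mu nu mS.
have := indic_fubini_tonelli mu nu mS'.
rewrite !indic_fubini_tonelli_FE// !indic_fubini_tonelli_GE//.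
have -> : mu \o ysection S = mu \o ysection S'.
  apply/funext => y /=; rewrite -(@muT (- y) (ysection S y)); last first.
    exact: measurable_ysection.
  congr (mu _); apply/seteqP.
  by split => x; rewrite /preimage/= /ysection/= !inE /S /S'/= subrK.
move=> <- E; move: E.
have -> : nu \o xsection S = (fun x => (\1_A x)%:E * nu B)%E.
  apply/funext => x /=; rewrite indicE; case: (boolP (x \in A)) => [|Ax].
    rewrite inE => Ax; rewrite mul1e -(nuT x mB); congr (nu _).
    by apply/seteqP; split => y; rewrite /xsection/= inE /S/= addrC// => -[].
  rewrite mul0e (_ : xsection _ _ = set0) ?measure0//.
  apply/seteqP; split => y //; rewrite /xsection/= inE => -[/= /mem_set].
  by rewrite (negbTE Ax).
have -> : nu \o xsection S' = (fun x => (\1_B x)%:E * nu ((fun v => - v)%R @^-1` A))%E.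
  apply/funext => x /=; rewrite indicE; case: (boolP (x \in B)) => [|Bx].
    rewrite inE => Bx; rewrite mul1e -(nuT (- x) mNA); congr (nu _).
    by apply/seteqP; split => y; rewrite /xsection/= inE /S'/= opprB// => -[].
  rewrite mul0e (_ : xsection _ _ = set0) ?measure0//.
  apply/seteqP; split => y //; rewrite /xsection/= inE => -[/= _ /mem_set].
  by rewrite (negbTE Bx).
rewrite !ge0_integralZr//=; last 2 first.
- by apply/measurable_EFinP; exact: measurable_indic.
- by apply/measurable_EFinP; exact: measurable_indic.
by rewrite !integral_indic//= !setIT muleC [RHS]muleC => ->; rewrite muleC.
Qed.

(** Take A = D in [translation_invariant_cross] and cancel mu D = nu D. The symmetry of D absorbs
    the sign change in that identity. *)
Lemma translation_invariant_unique (D : set 'rV[R]_n) : measurable D ->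
  (fun v => - v) @^-1` D = D -> mu D = nu D -> (0 < mu D < +oo)%E ->
  forall B, measurable B -> mu B = nu B.
Proof.
move=> mD ND munu /andP[D0 Doo] B mB.
have := translation_invariant_cross mD mB; rewrite ND -munu.
have muD : mu D \is a fin_num by rewrite ge0_fin_numE// ltW.
move/(congr1 (fun z => (fine (mu D))^-1%:E * z)%E).
rewrite -{2 4}(fineK muD) !muleA -!EFinM mulVf ?mul1e//.
by rewrite gt_eqF// fine_gt0// D0.
Qed.

End translation_invariant_measures.

Section lebesgue_rV_theory.
Context {R : realType} {n : nat}.
Local Notation mu := (@lebesgue_rV R n).
Implicit Types (v b c : 'rV[R]_n) (x : R) (A : set 'rV[R]_n).

Lemma lebesgue_rV_translate b A : measurable A ->
  mu ((fun v => v + b) @^-1` A) = mu A.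
Proof.
move=> mA; have := lebesgue_rV_affine b (@ltr01 R) mA.
rewrite expr1n invr1 mul1e => <-; congr (lebesgue_rV n _).
by apply/seteqP; split=> v; rewrite /preimage/= scale1r.
Qed.

Lemma lebesgue_rV_eball c x : 0 < x ->
  mu (eball c x) = ((x ^+ n)%:E * mu (eball 0 1))%E.
Proof.
move=> x0; have x'0 : 0 < x^-1 by rewrite invr_gt0.
rewrite -(invrK (x ^+ n)) -exprVn -(lebesgue_rV_affine (- (x^-1 *: c)) x'0); last first.
  exact: measurable_eball.
congr (lebesgue_rV n _); apply/seteqP.
by split => v; rewrite /eball/preimage/= subr0 -scalerBr enormZ gtr0_norm//
  mulrC ltr_pdivrMr// mul1r.
Qed.
End lebesgue_rV_theory.

Section ball_volume.
Context {R : realType}.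

Lemma dotv_cons n (p q : R * 'rV[R]_n) :
  dotv (rV_cons p) (rV_cons q) = p.1 * q.1 + dotv p.2 q.2.
Proof.
rewrite /dotv big_ord_recl !mxE unlift_none; congr (_ + _).
by apply: eq_bigr => i _; rewrite !mxE liftK.
Qed.

Lemma enorm_cons_sqr n (p : R * 'rV[R]_n) :
  enorm (rV_cons p) ^+ 2 = p.1 ^+ 2 + enorm p.2 ^+ 2.
Proof. by rewrite !sqr_enorm dotv_cons expr2. Qed.

Lemma lebesgue_rV_ball_lty n : (lebesgue_rV n (eball 0 1 : set 'rV[R]_n) < +oo)%E.
Proof.
elim: n => [|n IH].
  by rewrite /= diracE; case: (_ \in _); rewrite ltry.
rewrite lebesgue_rVS_E.
apply: (@le_lt_trans _ _ ((lebesgue_measure \x lebesgue_rV n)%E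
    (`]-1, 1[%classic `*` eball 0 1))).
  apply: le_measure.
  - rewrite inE; apply: (measurable_preimage (@measurable_rV_cons _ _)).
    exact: measurable_eball.
  - by rewrite inE; apply: measurableX => //; exact: measurable_eball.
  - move=> [x v]; rewrite /eball/= !subr0 in_itv/= => h.
    have : enorm (rV_cons (x, v)) ^+ 2 < 1 by rewrite expr_lt1// enorm_ge0.
    rewrite enorm_cons_sqr/= => h1; split.
      by rewrite -ltr_norml -(@expr_lt1 _ 2)// -normrX ger0_norm ?sqr_ge0//;
        have := sqr_ge0 (enorm v); lra.
    by rewrite -(@expr_lt1 _ 2)// ?enorm_ge0//; have := sqr_ge0 x; lra.
rewrite product_measure1E//; last exact: measurable_eball.
rewrite [X in (X * _)%E](_ : _ = (1 - -1)%:E) ?lte_mul_pinfty//.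
apply: etrans (lebesgue_measure_itv _) _.
by rewrite /= lte_fin ifT// ltrN10.
Qed.

Lemma lebesgue_rV_setT_gt0 n : (0 < lebesgue_rV n [set: 'rV[R]_n])%E.
Proof.
elim: n => [|n IH]; first by rewrite /= diracT lte01.
rewrite lebesgue_rVS_E preimage_setT -setXTT product_measure1E//.
apply: mule_gt0 => //.
apply: (@lt_le_trans _ _ (lebesgue_measure (`]0, 1[%classic : set R))).
  by rewrite lebesgue_measure_itv/= lte_fin ltr01 sube0 lte01.
by apply: le_measure; rewrite ?inE.
Qed.

(** Otherwise every ball about the origin would be null by scaling, and so would their countable
    union, the whole space. *)
Lemma lebesgue_rV_ball_gt0 n : (0 < lebesgue_rV n (eball 0 1 : set 'rV[R]_n))%E.
Proof.
rewrite lt_def measure_ge0 andbT; apply/eqP => B0.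
have := lebesgue_rV_setT_gt0 n; rewrite lt_def => /andP[/eqP + _]; apply.
have -> : [set: 'rV[R]_n] = \bigcup_k eball 0 k.+1%:R.
  apply/seteqP; split => // v _; exists (Num.bound (enorm v)) => //=.
  rewrite /eball/= subr0 (lt_trans (archi_boundP (enorm_ge0 _)))//.
  by rewrite ltr_nat.
apply/eqP; rewrite eq_le measure_ge0 andbT.
apply: le_trans (measure_sigma_subadditive _ _ _ (@subset_refl _ _)) _ => //.
- by move=> k; exact: measurable_eball.
- by apply: bigcup_measurable => k _; exact: measurable_eball.
rewrite eseries0// => k _ _.
apply: etrans (lebesgue_rV_eball 0 (ltr0Sn _ _)) _.
by rewrite B0 mule0.
Qed.

Lemma lebesgue_rV_ball_fin n : lebesgue_rV n (eball 0 1 : set 'rV[R]_n) \is a fin_num.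
Proof. by rewrite ge0_fin_numE// lebesgue_rV_ball_lty. Qed.

Lemma ball_volumeK n :
  (@ball_volume R n)%:E = lebesgue_rV n (eball 0 1 : set 'rV[R]_n).
Proof. by rewrite fineK// lebesgue_rV_ball_fin. Qed.

Lemma ball_volume_gt0 n : 0 < @ball_volume R n.
Proof. by rewrite -lte_fin ball_volumeK lebesgue_rV_ball_gt0. Qed.

Lemma lebesgue_rV_eballE n (c : 'rV[R]_n) x : 0 < x ->
  lebesgue_rV n (eball c x) = (x ^+ n * ball_volume n)%:E.
Proof. by move=> x0; rewrite lebesgue_rV_eball// EFinM ball_volumeK. Qed.

Lemma opp_eball0 n (x : R) : (fun v => - v) @^-1` (eball 0 x : set 'rV[R]_n) = eball 0 x.
Proof. by apply/seteqP; split => v; rewrite /eball/= !subr0 enormN. Qed.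

(** The cross identity with both measures equal to Lebesgue measure and B the unit ball, whose
    finite positive measure cancels. *)
Lemma lebesgue_rV_opp n (A : set 'rV[R]_n) : measurable A ->
  lebesgue_rV n ((fun v => - v) @^-1` A) = lebesgue_rV n A.
Proof.
move=> mA.
have := translation_invariant_cross (@lebesgue_rV_translate R n)
  (@lebesgue_rV_translate R n) mA (@measurable_eball R n 0 1).
rewrite -ball_volumeK => /(congr1 (fun z => z * (ball_volume n)^-1%:E)%E).
by rewrite -!muleA -EFinM divff ?mule1// gt_eqF// ball_volume_gt0.
Qed.

End ball_volume.

(** * Densities and changes of variables in integrals *)

Section integral_transfer.
Local Open Scope ereal_scope.
Context d (T : measurableType d) (R : realType).

Import HBNNSimple.

(** By simple functions and monotone convergence. The density is given through the values of nu on
    sets, which is how the law of the reflections and the exponential law are presented. *)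
Lemma ge0_integral_density (mu nu : {measure set T -> \bar R}) (g : T -> R) :
  measurable_fun setT g -> (forall x, (0 <= g x)%R) ->
  (forall A, measurable A -> nu A = \int[mu]_(x in A) (g x)%:E) ->
  forall f : T -> \bar R, measurable_fun setT f -> (forall x, 0 <= f x) ->
  \int[nu]_x f x = \int[mu]_x (f x * (g x)%:E).
Proof.
move=> mg g0 nuE f mf f0; pose f_ := nnsfun_approx measurableT mf.
transitivity (limn (fun n => \int[nu]_x (f_ n x)%:E)).
  rewrite -monotone_convergence//.
  - apply: eq_integral => y _; apply/esym/cvg_lim => //.
    by apply: cvg_nnsfun_approx => // *; apply: f0; rewrite inE.
  - by move=> n; exact/measurable_EFinP/measurable_funP.
  - by move=> n y _; rewrite lee_fin.
  - by move=> y _ m n mn; rewrite lee_fin; exact/lefP/nd_nnsfun_approx.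
transitivity (limn (fun n => \int[mu]_x ((f_ n x)%:E * (g x)%:E))); last first.
  rewrite -monotone_convergence//.
  - apply: eq_integral => y _; apply/cvg_lim => //.
    apply: cvgeZr => //.
    by apply: cvg_nnsfun_approx => // *; apply: f0; rewrite inE.
  - move=> n; apply: emeasurable_funM; last exact/measurable_EFinP.
    exact/measurable_EFinP/measurable_funP.
  - by move=> n y _; rewrite mule_ge0 ?lee_fin.
  - move=> y _ m n mn; rewrite lee_wpmul2r ?lee_fin//.
    exact/lefP/nd_nnsfun_approx.
congr (limn _); apply/funext => n.
rewrite integralT_nnsfun sintegralE.
under [RHS]eq_integral.
  move=> x _; rewrite fimfunE -fsumEFin// ge0_mule_fsuml; last first.
    by move=> r; rewrite nnfun_muleindic_ge0.
  over.
rewrite ge0_integral_fsum//; last 2 first.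
- move=> r; apply: emeasurable_funM; last exact/measurable_EFinP.
  by apply/measurable_EFinP/measurable_funM.
- by move=> r x _; apply: mule_ge0; [exact: nnfun_muleindic_ge0|rewrite lee_fin].
apply: eq_fsbigr => r _.
rewrite nuE//.
have [r0|r0] := leP 0%R r; last first.
  rewrite preimage_nnfun0// integral_set0 mule0 integral0_eq// => x _.
  by rewrite indicE in_set0 mulr0 mul0e.
under [RHS]eq_integral do rewrite EFinM -muleA.
rewrite ge0_integralZl//; last 2 first.
- apply: emeasurable_funM; last exact/measurable_EFinP.
  by apply/measurable_EFinP; exact: measurable_indic.
- by move=> x _; rewrite mule_ge0 ?lee_fin.
congr (_ * _); rewrite integral_mkcond; apply: eq_integral => x _.
by rewrite patchE indicE; case: (x \in _); rewrite ?mul1e ?mul0e.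
Qed.

Lemma ge0_integral_measure_preimage (mu : {measure set T -> \bar R}) (h : T -> T)
    (k : R) : measurable_fun setT h -> (0 <= k)%R ->
  (forall A, measurable A -> mu (h @^-1` A) = k%:E * mu A) ->
  forall f : T -> \bar R, measurable_fun setT f -> (forall x, 0 <= f x) ->
  \int[mu]_x f (h x) = k%:E * \int[mu]_x f x.
Proof.
move=> mh k0 muh f mf f0.
rewrite -(@ge0_integral_mscale _ _ _ mu _ measurableT (NngNum k0) f)//.
rewrite (_ : \int[mu]_x f (h x) = \int[mu]_(x in h @^-1` setT) (f \o h) x)//.
rewrite -(ge0_integral_pushforward mh)//.
apply: eq_measure_integral => //= A mA _.
by rewrite /pushforward muh.
Qed.

End integral_transfer.

Section measurable_inverse.
Context d (T : measurableType d) (R : realType).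

(** The power -1 agrees with the inverse on nonnegative numbers, also at 0, where both are 0. *)
Lemma measurable_fun_invr (f : T -> R) : measurable_fun setT f ->
  (forall t, 0 <= f t) -> measurable_fun setT (fun t => (f t)^-1).
Proof.
move=> mf f0; under eq_fun do rewrite -powR_inv1//.
exact: (measurableT_comp (@measurable_powR R (-1)) mf).
Qed.

End measurable_inverse.

(** * Linear reflections as measure-preserving isometries *)

Section isometries.
Context {R : realType} {n : nat}.
Implicit Types (v x : 'rV[R]_n).

Lemma reflect0D v x y : reflect v 0 (x + y) = reflect v 0 x + reflect v 0 y.
Proof.
rewrite /reflect dotvDr !subr0 mulrDr mulrDl scalerDl opprD.
by rewrite addrACA.
Qed.

Lemma reflect0Z v c x : reflect v 0 (c *: x) = c *: reflect v 0 x.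
Proof.
rewrite /reflect dotvZr !subr0 scalerBr scalerA; congr (_ - _ *: _).
by rewrite mulrCA !mulrA.
Qed.

Lemma reflect0B v x y : reflect v 0 (x - y) = reflect v 0 x - reflect v 0 y.
Proof. by rewrite reflect0D -scaleN1r reflect0Z scaleN1r. Qed.

Lemma dotv_reflect0 v x y : dotv (reflect v 0 x) (reflect v 0 y) = dotv x y.
Proof.
have [->|v0] := eqVneq v 0.
  by rewrite /reflect !scaler0 !subr0.
have : dotv v v != 0 by rewrite dotv_eq0.
rewrite /reflect !dotvE !subr0 (dotvC x v) => v0'; field.
by [].
Qed.

Lemma enorm_reflect0 v x : enorm (reflect v 0 x) = enorm x.
Proof. by rewrite /enorm dotv_reflect0. Qed.

Lemma reflect0K v : involutive (reflect v 0).
Proof.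
have [->|v0] := eqVneq v 0 => x.
  by rewrite /reflect !scaler0 !subr0.
have : dotv v v != 0 by rewrite dotv_eq0.
rewrite /reflect !dotvE !subr0 => v0'.
rewrite -addrA -opprD -scalerDl [X in X *: _](_ : _ = 0) ?scale0r ?subr0//.
by field.
Qed.

Lemma measurable_reflect v b : measurable_fun setT (reflect v b : 'rV[R]_n -> _).
Proof.
apply: measurable_fun_subv; first exact: measurable_id.
apply: measurable_fun_scalev => //.
apply: measurable_funM => //; apply: measurable_funM => //.
apply: measurable_funB => //.
by apply: measurable_fun_dotv => //; exact: measurable_id.
Qed.

(** The image measure is again translation invariant, because [reflect v 0] is linear, and it gives
    the same value to the unit ball. Uniqueness concludes. *)
Lemma lebesgue_rV_reflect v (A : set 'rV[R]_n) : measurable A ->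
  lebesgue_rV n (reflect v 0 @^-1` A) = lebesgue_rV n A.
Proof.
move=> mA.
pose nu0 : {measure set 'rV[R]_n -> \bar R} :=
  measure_function_pushforward__canonical__measure_function_Measure
    (@lebesgue_rV R n) (measurable_reflect v 0).
have ball0 k : reflect v 0 @^-1` (eball 0 k) = eball 0 k.
  by apply/seteqP; split => x; rewrite /eball/= !subr0 enorm_reflect0.
have sf : sigma_finite setT nu0.
  exists (fun k => eball 0 k.+1%:R).
    apply/seteqP; split => // x _; exists (Num.bound (enorm x)) => //=.
    rewrite /eball/= subr0 (lt_trans (archi_boundP (enorm_ge0 _)))//.
    by rewrite ltr_nat.
  move=> k; split; first exact: measurable_eball.
  rewrite /nu0/= /pushforward ball0 -/(lebesgue_rV n _) lebesgue_rV_eballE//.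
  by rewrite ltry.
pose nu : {sigma_finite_measure set 'rV[R]_n -> \bar R} :=
  HB.pack (Measure.sort nu0) (Measure_isSigmaFinite.Build _ _ _ (Measure.sort nu0) sf).
suff : lebesgue_rV n A = nu A by move=> ->.
apply: (@translation_invariant_unique _ _ _ nu _ _ (eball 0 1)) => //.
- by move=> b B mB; exact: lebesgue_rV_translate.
- move=> b B mB; rewrite /nu/= /pushforward.
  rewrite -[RHS](lebesgue_rV_translate (reflect v 0 b)).
    congr (lebesgue_rV n _); apply/seteqP.
    by split => x; rewrite /preimage/= reflect0D reflect0K.
  exact: (measurable_preimage (measurable_reflect v 0)).
- exact: measurable_eball.
- exact: opp_eball0.
- by rewrite /nu/= /pushforward ball0.
- by rewrite lebesgue_rV_ball_gt0 lebesgue_rV_ball_lty.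
Qed.

(** The hyperplane orthogonal to x - y bisects the pair, so any two vectors of equal norm are
    exchanged by a reflection fixing the origin. For x = y the normal is 0 and [reflect] is the
    identity. *)
Lemma reflect_swap x y : enorm x = enorm y -> reflect (x - y) 0 x = y.
Proof.
move=> xy; have [->|xyN] := eqVneq x y.
  by rewrite subrr /reflect scaler0 subr0.
have : dotv (x - y) (x - y) != 0 by rewrite dotv_eq0 subr_eq0.
have : dotv x x = dotv y y by rewrite -!sqr_enorm xy.
rewrite /reflect !dotvE (dotvC y x) => E D.
rewrite (_ : 2 * _ / _ = 1); first by rewrite scale1r opprB addrC subrK.
rewrite -[RHS](divff D) E; congr (_ / _); ring.
Qed.

End isometries.

(** * One step of the chain of norms *)
Definition radial_density {R : realType} {d : nat} (x : 'rV[R]_d) : R :=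
  enorm x ^- d.-1.

Section polarization_step.
Context {R : realType} {d : nat}.
Variables (L C : R) (rho : probability 'rV[R]_d R).
Hypotheses (d_ge1 : (1 <= d)%N) (L_gt0 : 0 < L) (C_gt0 : 0 < C).
Hypothesis rhoE : forall B : set 'rV[R]_d, measurable B ->
  rho B = (C%:E * \int[lebesgue_rV d]_(x in B `&` eball 0 (2 * L)%R)
             (radial_density x)%:E)%E.

Local Notation mu := (@lebesgue_rV R d).
Local Notation k := (@radial_density R d).

Lemma kernel_ge0 x : 0 <= k x.
Proof. by rewrite invr_ge0 exprn_ge0// enorm_ge0. Qed.

Lemma measurable_kernel d1 (T1 : measurableType d1) (f : T1 -> 'rV[R]_d) :
  measurable_fun setT f -> measurable_fun setT (fun x => k (f x)).
Proof.
move=> mf; apply: measurable_fun_invr.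
  by apply: measurable_funX; exact: measurable_fun_enorm.
by move=> x; rewrite exprn_ge0// enorm_ge0.
Qed.

Lemma measurable_subl (a : 'rV[R]_d) : measurable_fun setT (fun p : 'rV[R]_d => a - p).
Proof. by apply: measurable_fun_subv => //; exact: measurable_id. Qed.

Lemma measurable_dist (a : 'rV[R]_d) :
  measurable_fun setT (fun p : 'rV[R]_d => enorm (a - p)%R).
Proof. by apply: measurable_fun_enorm; exact: measurable_subl. Qed.

Lemma integral_rho (f : 'rV[R]_d -> \bar R) : measurable_fun setT f ->
  (forall x, (0 <= f x)%E) ->
  (\int[rho]_x f x = C%:E * \int[mu]_(x in eball 0 (2 * L)%R) (f x * (k x)%:E))%E.
Proof.
move=> mf f0.
have mk : measurable_fun setT k by apply: measurable_kernel; exact: measurable_id.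
pose g : 'rV[R]_d -> R := fun x => C * (k x * \1_(eball 0 (2 * L)) x).
have mg : measurable_fun setT g.
  apply: measurable_funM => //; apply: measurable_funM => //.
  by apply: measurable_indic; exact: measurable_eball.
have g0 x : 0 <= g x.
  by rewrite !mulr_ge0 ?kernel_ge0// ltW// C_gt0.
have mkB : measurable_fun setT (fun x => (k x * \1_(eball 0 (2 * L)) x)%:E).
  apply/measurable_EFinP/measurable_funM => //.
  by apply: measurable_indic; exact: measurable_eball.
rewrite (@ge0_integral_density _ _ _ mu rho g)//; last first.
  move=> A mA; apply: (etrans (rhoE mA)); rewrite /g.
  under [RHS]eq_integral do rewrite EFinM.
  rewrite ge0_integralZl_EFin//; last 3 first.
  - by move=> x _; rewrite lee_fin mulr_ge0 ?kernel_ge0.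
  - exact: measurable_funTS.
  - by rewrite ltW// C_gt0.
  congr (_ * _)%E.
  rewrite integral_mkcondr; apply: eq_integral => x _.
  by rewrite patchE indicE; case: (x \in _); rewrite ?mulr1 ?mulr0.
rewrite [in RHS]integral_mkcond -ge0_integralZl_EFin//.
- apply: eq_integral => x _; rewrite patchE /g indicE.
  by case: (x \in _); rewrite ?mulr1 ?mulr0 ?mule0// EFinM muleCA.
- move=> x _; apply: erestrict_ge0 => y _.
  by rewrite mule_ge0// lee_fin kernel_ge0.
- apply/(measurable_restrictT _ (measurable_eball _ _)); apply: measurable_funTS.
  by apply: emeasurable_funM => //; exact/measurable_EFinP.
- by rewrite ltW// C_gt0.
Qed.

(** Substitute z = a - p. The bound on [enorm a + s] keeps the ball inside the support of [rho], so
    the cut-off at 2L disappears. *)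
Lemma integral_rho_ball (a : 'rV[R]_d) (s : R) (F : R -> \bar R) :
  enorm a + s <= 2 * L -> measurable_fun setT F -> (forall x, (0 <= F x)%E) ->
  (\int[rho]_(p in eball a s) F (enorm (a - p)%R) =
   C%:E * \int[mu]_(z in eball 0 s) (F (enorm z) * (k (a - z)%R)%:E))%E.
Proof.
move=> asL mF F0.
have mFd (b : 'rV[R]_d) : measurable_fun setT (fun p : 'rV[R]_d => F (enorm (b - p))).
  exact: (measurableT_comp mF (measurable_dist b)).
rewrite integral_mkcond integral_rho; last 2 first.
- apply/(measurable_restrictT _ (measurable_eball _ _)).
  exact: measurable_funTS.
- by move=> x; apply: erestrict_ge0 => y _; exact: F0.
congr (_ * _)%E.
pose G := (fun z => (F (enorm z) * (k (a - z)%R)%:E)%E) \_ (eball 0 s).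
have mG : measurable_fun setT G.
  apply/(measurable_restrictT _ (measurable_eball _ _)); apply: measurable_funTS.
  apply: emeasurable_funM; first exact: (measurableT_comp mF (measurable_fun_enorm (@measurable_id _ _ _))).
  by apply/measurable_EFinP/measurable_kernel; exact: measurable_subl.
have G0 z : (0 <= G z)%E.
  by apply: erestrict_ge0 => y _; rewrite mule_ge0// lee_fin kernel_ge0.
have mua A : measurable A ->
    mu ((fun y : 'rV[R]_d => a - y) @^-1` A) = (1%:E * mu A)%E.
  move=> mA; rewrite mul1e -[RHS]lebesgue_rV_opp// -[RHS](lebesgue_rV_translate (- a)).
    by congr (lebesgue_rV d _); apply/seteqP; split => x; rewrite /preimage/= opprB.
  apply: (@measurable_preimage _ _ _ _ (fun v : 'rV[R]_d => - v)) => //.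
  by apply: measurable_fun_oppv; exact: measurable_id.
have := @ge0_integral_measure_preimage _ _ _ mu _ 1 (measurable_subl a) ler01 mua G mG G0.
rewrite mul1e [X in _ = X -> _](_ : _ = \int[mu]_(z in eball 0 s)
  (F (enorm z) * (k (a - z)%R)%:E))%E; last by rewrite [RHS]integral_mkcond.
move=> <-.
rewrite [LHS]integral_mkcond; apply: eq_integral => x _.
rewrite !patchE /G patchE.
have E : (a - x \in (eball 0 s : set 'rV[R]_d)) = (x \in eball a s).
  by apply/idP/idP; rewrite !inE /eball/= subr0 enormB.
rewrite E; case: (boolP (x \in eball a s)) => xa;
  case: (boolP (x \in _)) => xL //.
- by rewrite opprB subrKC.
- exfalso; move/negP: xL; apply; move: xa; rewrite !inE /eball/= subr0 => xa.
  have := ler_enormD a (x - a); rewrite subrKC => h.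
  by apply: le_lt_trans h _; apply: lt_le_trans asL; rewrite ltrD2l.
- exact: mul0e.
Qed.

(** A dilation by |a| contributes |a|^d and the homogeneous kernel takes back |a|^(d-1). The single
    factor left over is the extra power of |x| in the moment recursion. The reflection [H] then
    turns the direction of a into u. *)
Lemma integral_rho_unit (a u : 'rV[R]_d) (F : R -> \bar R) :
  0 < enorm a -> enorm a <= L -> enorm u = 1 ->
  measurable_fun setT F -> (forall x, (0 <= F x)%E) ->
  (\int[rho]_(p in eball a (enorm a)) F (enorm (a - p) / enorm a)%R =
   (C * enorm a)%:E * \int[mu]_(y in eball 0 1) (F (enorm y) * (k (u - y)%R)%:E))%E.
Proof.
move=> a0 aL u1 mF F0; set x := enorm a in a0 aL *.
have mFx : measurable_fun setT (fun s : R => F (s / x)).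
  by apply: measurableT_comp => //; exact: measurable_funM.
have axL : enorm a + x <= 2 * L by rewrite -/x mulr_natl mulr2n lerD.
apply: etrans (integral_rho_ball axL mFx (fun s => F0 _)) _.
rewrite (EFinM C x) -muleA; congr (_ * _)%E.
pose H := reflect (x^-1 *: a - u) 0.
have Ha : H (x^-1 *: a) = u.
  apply: reflect_swap; rewrite enormZ u1 gtr0_norm ?invr_gt0// -/x.
  by rewrite mulVf// gt_eqF.
pose G1 v := (fun y => (F (enorm y) * (k (v - y)%R)%:E)%E) \_ (eball 0 1 : set 'rV[R]_d).
have mG1 v : measurable_fun setT (G1 v).
  apply/(measurable_restrictT _ (measurable_eball _ _)); apply: measurable_funTS.
  apply: emeasurable_funM.
    apply: (measurableT_comp mF); apply: measurable_fun_enorm.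
    exact: measurable_id.
  by apply/measurable_EFinP/measurable_kernel; exact: measurable_subl.
have G10 v y : (0 <= G1 v y)%E.
  apply: erestrict_ge0 => z _.
  by rewrite mule_ge0// lee_fin kernel_ge0.
rewrite [in RHS]integral_mkcond -/(G1 u).
have muH A : measurable A -> mu (H @^-1` A) = (1%:E * mu A)%E.
  by move=> mA; rewrite mul1e; exact: lebesgue_rV_reflect.
have := @ge0_integral_measure_preimage _ _ _ mu H 1 (measurable_reflect _ _)
  ler01 muH (G1 u) (mG1 u) (G10 u).
rewrite mul1e => <-.
have -> : (fun y => G1 u (H y)) = G1 (x^-1 *: a).
  apply/funext => y; rewrite /G1 !patchE.
  have -> : (H y \in (eball 0 1 : set 'rV[R]_d)) = (y \in eball 0 1).
    by apply/idP/idP; rewrite !inE /eball/= !subr0 enorm_reflect0.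
  case: ifPn => // _; rewrite enorm_reflect0; congr (_ * _%:E)%E.
  rewrite -Ha /radial_density; congr (_ ^- _).
  rewrite -[RHS](enorm_reflect0 (x^-1 *: a - u)); congr enorm.
  by rewrite reflect0B.
pose G := (fun z => (F (enorm z / x)%R * (k (a - z)%R)%:E)%E) \_ (eball 0 x : set 'rV[R]_d).
rewrite [LHS]integral_mkcond -/G.
have mG : measurable_fun setT G.
  apply/(measurable_restrictT _ (measurable_eball _ _)); apply: measurable_funTS.
  apply: emeasurable_funM; first exact: (measurableT_comp mFx (measurable_fun_enorm (@measurable_id _ _ _))).
  by apply/measurable_EFinP/measurable_kernel; exact: measurable_subl.
have G0 z : (0 <= G z)%E.
  by apply: erestrict_ge0 => y _; rewrite mule_ge0// lee_fin kernel_ge0.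
have mx : measurable_fun setT (fun y : 'rV[R]_d => x *: y).
  by apply: measurable_fun_scalev => //; exact: measurable_id.
have mux A : measurable A ->
    mu ((fun y : 'rV[R]_d => x *: y) @^-1` A) = ((x ^- d)%:E * mu A)%E.
  move=> mA; rewrite -(lebesgue_rV_affine 0 a0)//.
  by congr (lebesgue_rV d _); apply/seteqP; split => y; rewrite /preimage/= addr0.
have xd0 : 0 <= x ^- d by rewrite invr_ge0 exprn_ge0// ltW.
have := @ge0_integral_measure_preimage _ _ _ mu _ _ mx xd0 mux G mG G0.
move/(congr1 (fun z => (x ^+ d)%:E * z)%E).
have xd1 : x ^+ d * x ^- d = 1 by rewrite divff// expf_neq0// gt_eqF.
rewrite muleA -(EFinM (x ^+ d)) xd1 mul1e => <-.
have -> : (fun y => G (x *: y)) = (fun y => (x ^- d.-1)%:E * G1 (x^-1 *: a)%R y)%E.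
  apply/funext => y; rewrite /G /G1 !patchE.
  have -> : (x *: y \in (eball 0 x : set 'rV[R]_d)) = (y \in eball 0 1).
    apply/idP/idP; rewrite !inE /eball/= !subr0 enormZ gtr0_norm//;
    by rewrite -ltr_pdivlMl// mulVf ?gt_eqF.
  case: ifPn => // _; last by rewrite mule0.
  rewrite enormZ gtr0_norm// mulrC mulKf ?gt_eqF// muleCA -EFinM.
  congr (_ * _%:E)%E.
  rewrite /radial_density -{1}[a](scalerKV (lt0r_neq0 a0)) -scalerBr enormZ gtr0_norm//.
  by rewrite exprMn invfM.
rewrite ge0_integralZl//; last by rewrite lee_fin invr_ge0 exprn_ge0// ltW.
rewrite muleA -EFinM; congr (_%:E * _)%E.
rewrite -{1}(prednK d_ge1) exprS mulfK// expf_neq0// gt_eqF//.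
Qed.

(** For |z| < |a| and l >= 1 the point l a - z is farther from the origin than a - z and carries
    less density, so the same new distance |z| is less likely to be reached from farther out. *)
Lemma le_integral_rho_ray (a : 'rV[R]_d) (l : R) (G : R -> \bar R) :
  0 < enorm a -> 1 <= l -> l * enorm a <= L ->
  measurable_fun setT G -> (forall x, (0 <= G x)%E) ->
  (\int[rho]_(p in eball (l *: a)%R (enorm a)) G (enorm (l *: a - p)%R) <=
   \int[rho]_(p in eball a (enorm a)) G (enorm (a - p)%R))%E.
Proof.
move=> a0 l1 laL mG G0.
have l0 : 0 < l by lra.
have ala : enorm a <= l * enorm a by rewrite ler_peMl// ltW.
have mF (b : 'rV[R]_d) : measurable_fun (eball 0 (enorm a) : set 'rV[R]_d) (fun z => (G (enorm z) * (k (b - z)%R)%:E)%E).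
  apply: measurable_funTS; apply: emeasurable_funM.
    apply: (measurableT_comp mG); apply: measurable_fun_enorm.
    exact: measurable_id.
  by apply/measurable_EFinP/measurable_kernel; exact: measurable_subl.
have h1 : enorm (l *: a) + enorm a <= 2 * L.
  by rewrite enormZ gtr0_norm// mulr_natl mulr2n lerD// (le_trans ala).
have h2 : enorm a + enorm a <= 2 * L.
  by rewrite mulr_natl mulr2n lerD// (le_trans ala).
have -> := integral_rho_ball h1 mG G0.
have -> := integral_rho_ball h2 mG G0.
apply: lee_wpmul2l; first by rewrite lee_fin ltW.
apply: ge0_le_integral => //.
- exact: measurable_eball.
- by move=> z _; rewrite mule_ge0// lee_fin kernel_ge0.
move=> z; rewrite /eball/= subr0 => za.
rewrite lee_wpmul2l// lee_fin /radial_density lef_pV2 ?posrE; last 2 first.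
- rewrite exprn_gt0// enorm_gt0 subr_eq0; apply/eqP => E.
  move: za; rewrite -E enormZ gtr0_norm//; lra.
- by rewrite exprn_gt0// enorm_gt0 subr_eq0; apply/eqP => E; move: za; rewrite E ltxx.
rewrite lerXn2r ?nnegrE ?enorm_ge0// ler_enorm_sqr !enorm_sub_sqr enormZ dotvZl.
rewrite gtr0_norm//; have := dotv_le a z; have := enorm_ge0 z.
nra.
Qed.

End polarization_step.

Lemma bounded_integrable d (T : measurableType d) (R : realType)
    (P : probability T R) (f : T -> R) (M : R) :
  measurable_fun setT f -> (forall t, `|f t| <= M) ->
  P.-integrable setT (EFin \o f).
Proof.
move=> mf fM.
apply: (@le_integrable _ _ _ _ _ _ _ (EFin \o cst M)) => //.
- exact/measurable_EFinP.
- by move=> t _; rewrite /= lee_fin (le_trans (fM t))// ler_norm.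
- exact: finite_measure_integrable_cst.
Qed.

Lemma integral_probability_cst d (T : measurableType d) (R : realType)
    (P : probability T R) (c : R) : (\int[P]_x c%:E = c%:E)%E.
Proof.
apply: etrans (integral_cst P measurableT c%:E) _.
by rewrite -[RHS]mule1; congr (_ * _)%E; exact: probability_setT.
Qed.

(** * Moments as polynomials in the starting distance *)

Section moment_polynomials.
Context {R : realType}.
Variable c : nat -> R.

(** E[X_n^j] as a function of X_0 = x. The recursion is that of the last step of the chain;
    [integral_rho_moment_poly] provides the one of the first step. *)
Fixpoint moment_poly (n j : nat) (x : R) : R :=
  if n is n'.+1 then moment_poly n' j x - c j * moment_poly n' j.+1 x
  else x ^+ j.

Lemma measurable_moment_poly n j : measurable_fun setT (moment_poly n j).
Proof.
elim: n j => [|n IH] j /=; first exact: measurable_funX.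
by apply: measurable_funB => //; exact: measurable_funM.
Qed.

Lemma moment_poly_bounded L n j :
  exists M : R, forall x : R, 0 <= x <= L -> `|moment_poly n j x| <= M.
Proof.
elim: n j => [|n IH] j /=.
  exists (L ^+ j) => x /andP[x0 xL].
  by rewrite ger0_norm ?exprn_ge0// lerXn2r// nnegrE (le_trans x0).
have [M1 H1] := IH j; have [M2 H2] := IH j.+1.
exists (M1 + `|c j| * M2) => x xL.
rewrite (le_trans (ler_normB _ _))// lerD ?H1// normrM ler_wpM2l//.
exact: H2.
Qed.

Lemma moment_poly0 n j : (0 < j)%N -> moment_poly n j 0 = 0.
Proof.
elim: n j => [|n IH] j j0 /=; first by rewrite expr0n gtn_eqF.
by rewrite !IH// mulr0 subr0.
Qed.

Lemma moment_polyE n j x : moment_poly n j x =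
  \sum_(0 <= k < n.+1) 'C(n, k)%:R * (-1) ^+ k * x ^+ (k + j) *
    \prod_(1 <= i < k.+1) c (i + j - 1)%N.
Proof.
elim: n j => [|n IH] j /=.
  by rewrite big_nat1 big_geq// bin0 expr0 !mul1r mulr1.
rewrite !IH [in RHS]big_nat_recl// bin0 expr0.
rewrite [X in _ = _ + X](_ : _ = \sum_(0 <= i < n.+1)
      'C(n, i.+1)%:R * (-1) ^+ i.+1 * x ^+ (i.+1 + j) *
       \prod_(1 <= i0 < i.+2) c (i0 + j - 1)%N +
    \sum_(0 <= i < n.+1)
      'C(n, i)%:R * (-1) ^+ i.+1 * x ^+ (i.+1 + j) *
       \prod_(1 <= i0 < i.+2) c (i0 + j - 1)%N); last first.
  by rewrite -big_split; apply: eq_bigr => i _; rewrite binS natrD !mulrDl.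
rewrite addrA; congr (_ + _).
  rewrite [LHS]big_nat_recl// bin0 expr0; congr (_ + _).
  by rewrite [in RHS]big_nat_recr//= bin_small// !mul0r addr0.
rewrite mulr_sumr -sumrN; apply: eq_bigr => i _.
rewrite [in RHS]big_nat_recl// add1n subn1/= addnS addSn.
rewrite (_ : \prod_(1 <= i0 < i.+1) c (i0 + j.+1 - 1)%N =
             \prod_(1 <= i0 < i.+1) c (i0.+1 + j - 1)%N); last first.
  by apply: eq_bigr => m _; rewrite addnS addSn.
by rewrite [(-1) ^+ i.+1]exprS; ring.
Qed.

End moment_polynomials.

Section moment_step.
Context {R : realType} {d : nat}.
Variables (L C : R) (rho : probability 'rV[R]_d R) (u : 'rV[R]_d).
Hypotheses (d_ge1 : (1 <= d)%N) (L_gt0 : 0 < L) (C_gt0 : 0 < C).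
Hypothesis rhoE : forall B : set 'rV[R]_d, measurable B ->
  rho B = (C%:E * \int[lebesgue_rV d]_(x in B `&` eball 0 (2 * L)%R)
             (radial_density x)%:E)%E.
Hypothesis u1 : enorm u = 1.

Local Notation mu := (@lebesgue_rV R d).
Local Notation k := (@radial_density R d).

Definition one_step (a p : 'rV[R]_d) : R := Num.min (enorm a) (enorm (a - p)).

Lemma one_step_ge0 a p : 0 <= one_step a p.
Proof. by rewrite le_min !enorm_ge0. Qed.

Lemma one_step_le a p : one_step a p <= enorm a.
Proof. by rewrite ge_min lexx. Qed.

Lemma one_step_in a p : p \in eball a (enorm a) -> one_step a p = enorm (a - p).
Proof.
rewrite inE /eball/= (enormB p a) /one_step => h.
by apply/min_idPr; exact: ltW.
Qed.

Lemma one_step_out a p : p \notin eball a (enorm a) -> one_step a p = enorm a.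
Proof.
move=> h; rewrite /one_step min_l// leNgt; apply/negP => h'; move/negP: h; apply.
by rewrite inE /eball/= enormB.
Qed.

Lemma measurable_one_step a : measurable_fun setT (one_step a).
Proof. by apply: measurable_minr => //; exact: measurable_dist. Qed.

(** Up to the factor C L, the integral is the mass that [rho] gives to the ball of centre L u and
    radius L, which is at most 1. No polar coordinates are involved. *)
Lemma kernel_integrable :
  mu.-integrable (eball 0 1) (fun y => (k (u - y))%:E).
Proof.
have mk : measurable_fun (eball 0 1) (fun y => (k (u - y))%:E).
  by apply/measurable_funTS/measurable_EFinP/measurable_kernel; exact: measurable_subl.
apply/integrableP; split => //.
have Lu : enorm (L *: u) = L by rewrite enormZ u1 mulr1 gtr0_norm.
have Lu0 : 0 < enorm (L *: u) by rewrite Lu.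
have LuL : enorm (L *: u) <= L by rewrite Lu.
have := integral_rho_unit d_ge1 C_gt0 rhoE Lu0 LuL u1 (@measurable_cst _ _ _ _ _ 1%E)
  (fun _ => lee01).
rewrite integral_cst; last exact: measurable_eball.
rewrite mul1e => E.
rewrite (_ : (\int[mu]_(y in _) _)%E =
  (\int[mu]_(y in eball 0 1) (cst 1 (enorm y) * (k (u - y))%:E))%E); last first.
  by apply: eq_integral => y _; rewrite mul1e gee0_abs// lee_fin kernel_ge0.
have CL : 0 < C * enorm (L *: u) by rewrite mulr_gt0.
rewrite ltNge; apply/negP; rewrite leye_eq => /eqP Eoo.
move: E; rewrite Eoo gt0_muley ?lte_fin// => E.
by have := probability_le1 rho (@measurable_eball R d (L *: u) (enorm (L *: u))); rewrite E.
Qed.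

(** The functional behind all the constants: c_alpha is its value at 1 - s^alpha and ell_d its value
    at (1 - s) / s, with C = (2 L omega_d)^-1. *)
Definition kernel_mean (F : R -> R) : R :=
  C * \int[mu]_(y in eball 0 1) (F (enorm y) * enorm (u - y) ^- d.-1).

Lemma measurable_comp_kernel (F : R -> R) : measurable_fun setT F ->
  measurable_fun setT (fun y => F (enorm y) * k (u - y)).
Proof.
move=> mF; apply: measurable_funM; last first.
  by apply: measurable_kernel; exact: measurable_subl.
exact: (measurableT_comp mF (measurable_fun_enorm (@measurable_id _ _ _))).
Qed.

Lemma bounded_kernel_integrable (F : R -> R) (M : R) : measurable_fun setT F ->
  (forall s, 0 <= s < 1 -> `|F s| <= M) ->
  mu.-integrable (eball 0 1) (fun y => (F (enorm y) * k (u - y))%:E).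
Proof.
move=> mF FM.
apply: (@le_integrable _ _ _ mu _ (measurable_eball _ _) _
  (fun y => M%:E * (k (u - y)%R)%:E)%E).
- by apply/measurable_funTS/measurable_EFinP; exact: measurable_comp_kernel.
- move=> y; rewrite /eball/= subr0 => y1.
  rewrite lee_fin !normrM ler_wpM2r// (le_trans (FM _ _)) ?enorm_ge0//.
  exact: ler_norm.
- by apply: integrableZl; [exact: measurable_eball|exact: kernel_integrable].
Qed.

Lemma integral_rho_kernel_mean (a : 'rV[R]_d) (F : R -> R) :
  0 < enorm a -> enorm a <= L -> measurable_fun setT F ->
  (forall s, 0 <= s < 1 -> 0 <= F s) ->
  mu.-integrable (eball 0 1) (fun y => (F (enorm y) * k (u - y))%:E) ->
  (\int[rho]_(p in eball a (enorm a)) (F (enorm (a - p) / enorm a))%:E =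
   (enorm a * kernel_mean F)%:E)%E.
Proof.
move=> a0 aL mF F0 iF.
(* [integral_rho_unit] asks for a function that is nonnegative everywhere, whereas F is so on [0,
   1[, the range of the ratio |a - p| / |a| on the ball. *)
pose F' := fun s => (Num.max (F s) 0)%:E.
have mF' : measurable_fun setT F' by exact/measurable_EFinP/measurable_maxr.
have F'0 s : (0 <= F' s)%E by rewrite lee_fin le_max lexx orbT.
have := integral_rho_unit d_ge1 C_gt0 rhoE a0 aL u1 mF' F'0.
rewrite (_ : \int[rho]_(p in _) _ =
   \int[rho]_(p in eball a (enorm a)) (F (enorm (a - p) / enorm a))%:E)%E; last first.
  apply: eq_integral => p; rewrite inE /eball/= enormB => pa; congr (_%:E).
  rewrite max_l// F0// divr_ge0 ?enorm_ge0//= ltr_pdivrMr// mul1r//.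
move=> ->; rewrite (_ : (\int[mu]_(y in _) _)%E =
  (\int[mu]_(y in eball 0 1) (F (enorm y) * k (u - y))%:E)%E); last first.
  apply: eq_integral => y; rewrite inE /eball/= subr0 => y1.
  by rewrite /F' max_l// F0// enorm_ge0.
rewrite -(@fineK _ (\int[mu]_(y in _) _)%E); last first.
  by apply: integrable_fin_num => //; exact: measurable_eball.
by rewrite -EFinM /kernel_mean mulrA (mulrC C).
Qed.

Lemma kernel_mean_ge0 (F : R -> R) : (forall s, 0 <= s < 1 -> 0 <= F s) ->
  0 <= kernel_mean F.
Proof.
move=> F0; rewrite mulr_ge0 ?(ltW C_gt0)//; apply: Rintegral_ge0 => y.
by rewrite /eball/= subr0 => y1; rewrite mulr_ge0 ?kernel_ge0// F0// enorm_ge0.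
Qed.

Lemma le_kernel_mean (F G : R -> R) (M : R) :
  measurable_fun setT F -> measurable_fun setT G ->
  (forall s, 0 <= s < 1 -> `|F s| <= M) -> (forall s, 0 <= s < 1 -> `|G s| <= M) ->
  (forall s, 0 <= s < 1 -> F s <= G s) -> kernel_mean F <= kernel_mean G.
Proof.
move=> mF mG FM GM FG; apply: ler_wpM2l; first exact: ltW.
apply: le_Rintegral.
- exact: measurable_eball.
- exact: bounded_kernel_integrable FM.
- exact: bounded_kernel_integrable GM.
move=> y; rewrite /eball/= subr0 => y1.
by rewrite ler_wpM2r ?kernel_ge0// FG// enorm_ge0.
Qed.

Definition decrement (alpha : R) : R := kernel_mean (fun s => 1 - s `^ alpha).

Lemma decrement_integrand (alpha : R) : 0 < alpha ->
  measurable_fun setT (fun s : R => 1 - s `^ alpha) /\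
  (forall s, 0 <= s < 1 -> 0 <= 1 - s `^ alpha <= 1).
Proof.
move=> a0; split.
  by apply: measurable_funB => //; exact: measurable_powR.
move=> s /andP[s0 s1]; rewrite subr_ge0 gerBl powR_ge0 andbT.
have := @ge0_ler_powR R alpha (ltW a0) s 1; rewrite powR1; apply.
- by rewrite nnegrE.
- by rewrite nnegrE.
- exact: ltW.
Qed.

(** The loss |a|^alpha - X'^alpha vanishes off the ball where the centre moves, and on it equals
    |a|^alpha (1 - s^alpha) with s = |a - p| / |a|. Its mean is |a|^alpha times |a| c_alpha. *)
Lemma integral_rho_powR (a : 'rV[R]_d) (alpha : R) : 0 < alpha -> enorm a <= L ->
  (\int[rho]_p (one_step a p `^ alpha)%:E =
   (enorm a `^ alpha - decrement alpha * enorm a `^ (alpha + 1))%:E)%E.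
Proof.
move=> al0 aL.
have [mF F01] := decrement_integrand al0.
have [a0|] := ltP 0 (enorm a); last first.
  rewrite le_eqVlt ltNge enorm_ge0 orbF => /eqP a0.
  rewrite a0 !powR0 ?gt_eqF ?addr_gt0// mulr0 subr0.
  apply: integral0_eq => p _; rewrite (_ : one_step a p = 0) ?powR0 ?gt_eqF//.
  by apply/eqP; rewrite eq_le one_step_ge0 -a0 one_step_le.
pose F s : R := 1 - s `^ alpha.
have iF : mu.-integrable (eball 0 1) (fun y => (F (enorm y) * k (u - y))%:E).
  apply: (@bounded_kernel_integrable F 1) => // s s1.
  by have /andP[h1 h2] := F01 _ s1; rewrite ger0_norm.
have F0 s : 0 <= s < 1 -> 0 <= F s by move=> /F01/andP[].
have := integral_rho_kernel_mean a0 aL mF F0 iF.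
rewrite -/(decrement alpha) => E.
have mp : measurable_fun setT (fun p => one_step a p `^ alpha).
  exact: (measurableT_comp (@measurable_powR R alpha) (measurable_one_step a)).
have bp p : `|one_step a p `^ alpha| <= enorm a `^ alpha.
  rewrite ger0_norm ?powR_ge0// ge0_ler_powR ?nnegrE ?one_step_ge0 ?enorm_ge0//.
  - exact: ltW.
  - exact: one_step_le.
have -> : (\int[rho]_p (one_step a p `^ alpha)%:E =
  \int[rho]_p ((enorm a `^ alpha)%:E - (enorm a `^ alpha - one_step a p `^ alpha)%:E))%E.
  by apply: eq_integral => p _; rewrite -EFinB opprB subrKC.
have ip : rho.-integrable setT (fun p => (enorm a `^ alpha - one_step a p `^ alpha)%:E).
  apply: (@bounded_integrable _ _ _ _ _ (enorm a `^ alpha)).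
    exact: measurable_funB.
  move=> p; rewrite ger0_norm ?gerBl ?powR_ge0// subr_ge0.
  exact: le_trans (ler_norm _) (bp p).
have ic : rho.-integrable setT (EFin \o cst (enorm a `^ alpha)).
  exact: finite_measure_integrable_cst.
apply: etrans (integralB_EFin measurableT ic ip) _.
rewrite [X in (X - _)%E](_ : _ = (enorm a `^ alpha)%:E); last first.
  exact: integral_probability_cst.
rewrite EFinB; congr (_ - _)%E.
rewrite powRD ?(gt_eqF a0) ?implybT// powRr1 ?enorm_ge0//.
rewrite mulrCA EFinM (mulrC (decrement _)) -E -ge0_integralZl_EFin//; last 4 first.
- exact: measurable_eball.
- move=> p; rewrite /eball/= enormB => pa; rewrite lee_fin F0//.
  by rewrite divr_ge0 ?enorm_ge0//= ltr_pdivrMr// mul1r.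
- apply/measurable_funTS/measurable_EFinP.
  apply: (measurableT_comp mF); apply: measurable_funM => //.
  exact: measurable_dist.
- exact: powR_ge0.
rewrite [RHS]integral_mkcond; apply: eq_integral => p _; rewrite patchE.
case: ifPn => pa; last by rewrite one_step_out// subrr.
rewrite one_step_in// -EFinM /F mulrBr mulr1 -powRM ?enorm_ge0//.
  by rewrite mulrC divfK// gt_eqF.
by rewrite divr_ge0 ?enorm_ge0.
Qed.


Local Notation c := (fun j : nat => decrement j%:R).

Lemma bounded_one_step_integrable (g : R -> R) (M : R) (a : 'rV[R]_d) :
  measurable_fun setT g -> (forall x, 0 <= x <= L -> `|g x| <= M) ->
  enorm a <= L -> rho.-integrable setT (EFin \o (fun p => g (one_step a p))).
Proof.
move=> mg gM aL; apply: (@bounded_integrable _ _ _ _ _ M).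
  exact: (measurableT_comp mg (measurable_one_step a)).
by move=> p; rewrite gM// one_step_ge0 (le_trans (one_step_le a p)).
Qed.

(** The recursion of the first step. It is the one that compares two starting points, since
    [integral_rho_mono] concerns a single step followed by a monotone function. *)
Lemma integral_rho_moment_poly n j (a : 'rV[R]_d) : (0 < j)%N -> enorm a <= L ->
  \int[rho]_p moment_poly c n j (one_step a p) = moment_poly c n.+1 j (enorm a).
Proof.
move=> + aL; elim: n j => [|n IH] j j0.
  rewrite /Rintegral /=.
  have jR : 0 < j%:R :> R by rewrite ltr0n.
  have := integral_rho_powR jR aL.
  rewrite (_ : (\int[rho]_p (one_step a p `^ j%:R)%:E)%E =
    (\int[rho]_p (one_step a p ^+ j)%:E)%E); last first.
    by apply: eq_integral => p _; rewrite powR_mulrn// one_step_ge0.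
  by move=> ->; rewrite /= natr1 !powR_mulrn ?enorm_ge0.
have [M1 H1] := moment_poly_bounded c L n j.
have [M2 H2] := moment_poly_bounded c L n j.+1.
have i1 := bounded_one_step_integrable (measurable_moment_poly c n j) H1 aL.
have i2 := bounded_one_step_integrable (measurable_moment_poly c n j.+1) H2 aL.
transitivity (\int[rho]_p (moment_poly c n j (one_step a p) -
  c j * moment_poly c n j.+1 (one_step a p))).
  by [].
rewrite RintegralB//; last first.
  by have := integrableZl measurableT (c j) i2.
rewrite RintegralZl// !IH//.
Qed.

Lemma rho_opp (B : set 'rV[R]_d) : measurable B ->
  rho ((fun v => - v) @^-1` B) = rho B.
Proof.
move=> mB.
have mN : measurable_fun setT (fun v : 'rV[R]_d => - v).
  by apply: measurable_fun_oppv; exact: measurable_id.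
apply: etrans (rhoE (measurable_preimage mN mB)) _.
apply/esym; apply: etrans (rhoE mB) _; congr (_ * _)%E.
pose f := (fun x => (k x)%:E) \_ (B `&` eball 0 (2 * L)).
have mf : measurable_fun setT f.
  apply/(measurable_restrictT _ (measurableI _ _ mB (measurable_eball _ _))).
  by apply/measurable_funTS/measurable_EFinP/measurable_kernel; exact: measurable_id.
have f0 x : (0 <= f x)%E by apply: erestrict_ge0 => y _; rewrite lee_fin kernel_ge0.
have muN (A : set 'rV[R]_d) : measurable A -> mu ((fun v => - v) @^-1` A) = (1%:E * mu A)%E.
  by move=> mA; rewrite mul1e; exact: lebesgue_rV_opp.
have := @ge0_integral_measure_preimage _ _ _ mu _ 1 mN ler01 muN f mf f0.
rewrite mul1e => E; rewrite [LHS]integral_mkcond [RHS]integral_mkcond.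
apply: etrans (esym E) _; apply: eq_integral => x _.
rewrite /f !patchE.
rewrite (_ : (x \in _ `&` _) = (- x \in B `&` eball 0 (2 * L))).
  by rewrite /radial_density enormN.
by apply/idP/idP; rewrite !inE /eball/= !subr0 enormN.
Qed.

(** Since |a - p|^2 + |a + p|^2 >= 2 |a|^2, the ball does not contain both p and -p, and [rho] is
    symmetric. *)
Lemma rho_eball_le_half (a : 'rV[R]_d) : (rho (eball a (enorm a)) <= 2^-1%:E)%E.
Proof.
set B := eball a (enorm a); have mB : measurable B by exact: measurable_eball.
have mN : measurable_fun setT (fun v : 'rV[R]_d => - v).
  by apply: measurable_fun_oppv; exact: measurable_id.
have mNB := measurable_preimage mN mB.
have disj : B `&` (fun v => - v) @^-1` B = set0.
  apply/seteqP; split => // p []; rewrite /B /eball/=.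
  rewrite !ltr_enorm_sqr !enorm_sub_sqr enormN dotvNl.
  by have := sqr_ge0 (enorm p); lra.
have : (rho (B `|` (fun v => - v)%R @^-1` B) <= 1)%E.
  by apply: probability_le1; exact: measurableU.
rewrite measureU//; rewrite [X in (_ + X)%E](_ : _ = rho B); last exact: rho_opp.
have fB : rho B \is a fin_num by exact: fin_num_measure.
rewrite -[X in (X + _ <= _)%E -> _](fineK fB) -[X in (_ + X <= _)%E -> _](fineK fB).
by rewrite -[X in _ -> (X <= _)%E](fineK fB) -EFinD !lee_fin; lra.
Qed.

(* Neither chain moves outside a ball of probability at most 1/2; on that ball
   [le_integral_rho_ray] compares the decreases from the two starting points. *)
Lemma integral_rho_mono (g : R -> R) (x x' : R) : measurable_fun setT g ->
  (forall s t, 0 <= s -> s <= t -> t <= L -> g s <= g t) ->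
  0 <= x -> x <= x' -> x' <= L ->
  (g x' - g x) / 2 <= \int[rho]_p g (one_step (x' *: u) p) -
                      \int[rho]_p g (one_step (x *: u) p).
Proof.
move=> mg gnd x0 xx' x'L.
have nxu y : 0 <= y -> enorm (y *: u) = y.
  by move=> y0; rewrite enormZ u1 mulr1 ger0_norm.
have x'0 : 0 <= x' by exact: le_trans xx'.
have xL : x <= L by exact: le_trans x'L.
have gM s : 0 <= s <= L -> `|g s| <= Num.max `|g 0| `|g L|.
  move=> /andP[s0 sL]; have h1 := gnd 0 s (lexx _) s0 sL.
  have h2 := gnd s L s0 sL (lexx _).
  rewrite ler_norml; apply/andP; split.
    rewrite lerNl (le_trans _ (_ : `|g 0| <= _)) ?le_max ?lexx//.
    by have := ler_norm (- g 0); rewrite normrN; lra.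
  by rewrite (le_trans h2)// (le_trans (ler_norm _))// le_max lexx orbT.
have D y : 0 <= y -> y <= L ->
    (\int[rho]_(p in eball (y *: u) y) (g y - g (enorm (y *: u - p)))%:E =
     (g y - \int[rho]_p g (one_step (y *: u) p))%:E)%E.
  move=> y0 yL.
  have ig := bounded_one_step_integrable (a := y *: u) mg gM.
  rewrite nxu// in ig; have {}ig := ig yL.
  have ic : rho.-integrable setT (EFin \o cst (g y)).
    exact: finite_measure_integrable_cst.
  have -> : g y = \int[rho]_p cst (g y) p.
    by rewrite /Rintegral integral_probability_cst.
  rewrite -RintegralB// /Rintegral fineK; last first.
    apply: integrable_fin_num => //.
    exact: (integrableB measurableT ic ig).
  rewrite [LHS]integral_mkcond; apply: eq_integral => p _.
  rewrite patchE integral_probability_cst/=; case: ifPn => py.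
    by rewrite one_step_in// nxu.
  by rewrite one_step_out ?nxu// subrr.
pose G s := Num.max (g x - g s) 0.
have mG : measurable_fun setT (fun s => (G s)%:E).
  by apply/measurable_EFinP/measurable_maxr => //; exact: measurable_funB.
have G0 s : (0 <= (G s)%:E)%E by rewrite lee_fin le_max lexx orbT.
set B' := eball (x' *: u) x'; set B := eball (x' *: u) x.
have BB' : B `<=` B' by move=> p; rewrite /B /B' /eball/= => h; exact: lt_le_trans xx'.
have mB : measurable B by exact: measurable_eball.
have mB' : measurable B' by exact: measurable_eball.
have ray : (\int[rho]_(p in B) (G (enorm (x' *: u - p)))%:E <=
            \int[rho]_(p in eball (x *: u) x) (g x - g (enorm (x *: u - p)))%:E)%E.
  have [x_gt0|] := ltP 0 x; last first.
    rewrite le_eqVlt ltNge x0 orbF => /eqP x_eq0.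
    rewrite (_ : B = set0) ?integral_set0; last first.
      by apply/seteqP; split => // p; rewrite /B /eball/= x_eq0 ltNge enorm_ge0.
    rewrite D// x_eq0 lee_fin scale0r.
    rewrite (_ : \int[rho]_p _ = g 0) ?subrr//.
    rewrite /Rintegral (_ : (\int[rho]_p _)%E = (g 0)%:E)//.
    rewrite -[RHS](integral_probability_cst rho); apply: eq_integral => p _.
    congr (g _)%:E; apply/eqP; rewrite eq_le one_step_ge0 andbT.
    by rewrite (le_trans (one_step_le _ _))// enorm0.
  have l1 : 1 <= x' / x by rewrite ler_pdivlMr// mul1r.
  have xu0 : 0 < enorm (x *: u) by rewrite nxu.
  have lL : x' / x * enorm (x *: u) <= L by rewrite nxu// divfK ?gt_eqF.
  have := le_integral_rho_ray C_gt0 rhoE xu0 l1 lL mG G0.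
  rewrite scalerA divfK ?gt_eqF// nxu// => h; apply: le_trans h _.
  rewrite le_eqVlt; apply/orP; left; apply/eqP.
  apply: eq_integral => p; rewrite inE /eball/= enormB => h.
  by rewrite /G max_l// subr_ge0 gnd ?enorm_ge0// ltW.
(* The loss from x' splits at the level g x. The part above is at most g x' - g x and occurs on B',
   of probability at most 1/2; the part below is [G], nonzero on B only, and [ray] bounds it by the
   loss from x. *)
have main : (\int[rho]_(p in B') (g x' - g (enorm (x' *: u - p)))%:E <=
    (g x' - g x)%:E * rho B' + \int[rho]_(p in B) (G (enorm (x' *: u - p)))%:E)%E.
  have gx0 : (0 <= (g x' - g x)%:E)%E by rewrite lee_fin subr_ge0 gnd.
  rewrite -integral_cst// -[X in (_ <= _ + X)%E](_ :
    (\int[rho]_(p in B') (((fun p => (G (enorm (x' *: u - p)))%:E) \_ B) p) = _)%E); last first.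
    by rewrite -integral_mkcondr setIC; congr (integral _ _ _); apply/setIidPl.
  have mGd : measurable_fun setT (fun p : 'rV[R]_d => (G (enorm (x' *: u - p)))%:E).
    by apply: (measurableT_comp mG); exact: measurable_dist.
  have mGB : measurable_fun B' ((fun p : 'rV[R]_d => (G (enorm (x' *: u - p)))%:E) \_ B).
    by apply: measurable_funTS; apply/(measurable_restrictT _ mB); exact: measurable_funTS.
  rewrite -ge0_integralD//; last first.
    by move=> p _; apply: erestrict_ge0 => q _.
  apply: ge0_le_integral => //.
  - move=> p; rewrite /B' /eball/= enormB => h.
    by rewrite lee_fin subr_ge0 gnd ?enorm_ge0// ltW.
  - apply/measurable_funTS/measurable_EFinP/measurable_funB => //.
    by apply: (measurableT_comp mg); exact: measurable_dist.
  - exact: emeasurable_funD.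
  move=> p Bp; rewrite patchE; case: ifPn => pB.
    rewrite -EFinD lee_fin /G; set m := Num.max _ _.
    have : g x - g (enorm (x' *: u - p)) <= m by rewrite le_max lexx.
    by rewrite /cst; lra.
  rewrite adde0 lee_fin lerB// gnd//.
    by rewrite leNgt; apply/negP => h; move/negP: pB; apply; rewrite inE /B /eball/= enormB.
  by move: Bp; rewrite /B' /eball/= enormB => /ltW h; exact: le_trans h x'L.
have half := rho_eball_le_half (x' *: u); rewrite nxu// in half.
have fB' : rho B' \is a fin_num by exact: fin_num_measure.
move: (le_trans main (leeD2l _ ray)); rewrite !D// -/B' -(fineK fB') -EFinM -EFinD lee_fin.
move: half; rewrite -/B' -(fineK fB') lee_fin.
have : 0 <= g x' - g x by rewrite subr_ge0 gnd.
nra.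
Qed.

End moment_step.

(** * The chain of centres *)
Section polarized_ball.
Context {R : realType} {d : nat}.
Implicit Types (s : reflection R d) (x y c p : 'rV[R]_d).

Lemma normal_sqr_gt0 s : 0 < dotv (normal s) (normal s).
Proof. by rewrite lt_def dotv_ge0 dotv_eq0 normal_neq0. Qed.

Lemma reflection_origin s :
  s 0 = (2 * offset s / dotv (normal s) (normal s)) *: normal s.
Proof.
rewrite /reflection_fun /reflect sub0r (_ : dotv _ 0 = 0); last first.
  by rewrite -(scale0r 0) dotvZr mul0r.
by rewrite sub0r -scaleNr mulrN mulNr opprK.
Qed.

Lemma offset_neq0 s : offset s != 0.
Proof.
apply: contra (reflect_origin_neq0 s) => /eqP b0.
by have := reflection_origin s; rewrite /reflection_fun b0 mulr0 mul0r scale0r => ->.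
Qed.

Lemma reflection_reflect0 s x : s x = reflect (normal s) 0 x + s 0.
Proof.
rewrite reflection_origin /reflection_fun /reflect subr0 -addrA; congr (_ + _).
by rewrite mulrBr mulrBl scalerBl opprB addrC.
Qed.

Lemma enorm_reflection s x y : enorm (s x - s y) = enorm (x - y).
Proof.
rewrite -(enorm_reflect0 (normal s) (x - y)) reflect0B; congr enorm.
by rewrite reflection_reflect0 (reflection_reflect0 s y) opprD addrACA subrr addr0.
Qed.

Lemma reflectionK s : involutive s.
Proof.
move=> x; have /lt0r_neq0 n0 := normal_sqr_gt0 s.
rewrite /reflection_fun /reflect -addrA -opprD -scalerDl.
rewrite [X in X *: _](_ : _ = 0) ?scale0r ?subr0// !dotvE.
by field.
Qed.

(** The sign of the added term tells whether x and c lie on the same side of the hyperplane: if they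
    do, x is at least as near to c as s x is. *)
Lemma enorm_reflection_sub s x c :
  enorm (s x - c) ^+ 2 = enorm (x - c) ^+ 2 +
    4 * (offset s - dotv (normal s) x) * (offset s - dotv (normal s) c) /
    dotv (normal s) (normal s).
Proof.
have /lt0r_neq0 n0 := normal_sqr_gt0 s.
rewrite !enorm_sub_sqr /reflection_fun /reflect sqr_enorm !dotvE !sqr_enorm.
rewrite !dotvE (dotvC x (normal s)).
by field.
Qed.

(** The second branch point is the image of x under the reflection taking 0 to p, whose hyperplane
    is dotv p x = dotv p p / 2. It is written in p alone because the law concerns p = sigma(0), not
    the pair of normal and offset. *)
Definition move x p : 'rV[R]_d :=
  if enorm (x - p) < enorm x then x - (2 * dotv p x / dotv p p - 1) *: p else x.

Lemma reflection_move s x : s x = x - (2 * dotv (s 0) x / dotv (s 0) (s 0) - 1) *: s 0.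
Proof.
have n0 := lt0r_neq0 (normal_sqr_gt0 s).
have b0 := offset_neq0 s.
rewrite [in RHS]reflection_origin {1}/reflection_fun /reflect !dotvE scalerA.
congr (_ - _ *: _); field.
by rewrite n0 b0.
Qed.

Lemma half_negE s x : half_neg s x <-> enorm (x - s 0) < enorm x.
Proof.
have n0 := normal_sqr_gt0 s.
rewrite /half_neg/= ltr_enorm_sqr enorm_sub_sqr -(enormN (s 0)) -[- s 0]add0r.
rewrite -[0 - s 0]opprB enormN enorm_reflection_sub.
rewrite subr0 enorm0 reflection_origin dotvZr (dotvC x).
rewrite (_ : dotv _ 0 = 0); last by rewrite -(scale0r 0) dotvZr mul0r.
rewrite expr0n/= add0r subr0.
rewrite -(subr_lt0 (enorm x ^+ 2)) (_ : _ + _ - enorm x ^+ 2 = 4 / dotv (normal s) (normal s) *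
  ((offset s - dotv (normal s) x) * offset s)); last first.
  by field; rewrite gt_eqF.
have k0 : 0 < 4 / dotv (normal s) (normal s) by rewrite divr_gt0.
by rewrite (pmulr_rlt0 _ k0); split.
Qed.

(** Polarizing a set takes the union with its mirror image on the side of 0 and the intersection on
    the other side. For a ball, [enorm_reflection_sub] makes one of the two conditions imply the
    other on each side, so a single ball remains, centred at whichever of c and s c is not on the
    far side. *)
Lemma polarize_eball s c r :
  polarize_set s (eball c r) = eball (move c (s 0)) r.
Proof.
have n0 := normal_sqr_gt0 s.
have b0 : 0 < offset s ^+ 2 by rewrite exprn_even_gt0//= offset_neq0.
have cE : move c (s 0) = if (offset s - dotv (normal s) c) * offset s < 0 then s c else c.
  rewrite /move -reflection_move.
  have [h1 h2] := half_negE s c.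
  case: ifPn => [h|/negP h]; case: ifPn => // h'.
    by move/negP: h'; case; exact: h2.
  by case: h; exact: h1.
(* [enorm_reflection_sub] multiplied and divided by [offset s ^+ 2], so that the two factors are the
   quantities whose signs define the half-spaces. *)
have key x : enorm (s x - c) ^+ 2 = enorm (x - c) ^+ 2 + 4 / dotv (normal s) (normal s) / offset s ^+ 2 *
   (((offset s - dotv (normal s) x) * offset s) * ((offset s - dotv (normal s) c) * offset s)).
  by rewrite enorm_reflection_sub; field; rewrite offset_neq0 gt_eqF.
have k0 : 0 < 4 / dotv (normal s) (normal s) / offset s ^+ 2 by rewrite !divr_gt0.
have swap x : enorm (x - s c) = enorm (s x - c).
  by rewrite -(enorm_reflection s (s x)) reflectionK.
have ind (A : set 'rV[R]_d) x : (\1_A x : R) = if x \in A then 1 else 0.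
  by rewrite indicE; case: (x \in A).
have memE (x y : 'rV[R]_d) : (x \in eball y r) = (enorm (x - y) < r).
  by apply/idP/idP; rewrite inE.
have polE x : polarize_set s (eball c r) x <-> (
    if x \in half_pos s then (enorm (x - c) < r) || (enorm (s x - c) < r)
    else if x \in half_neg s then (enorm (x - c) < r) && (enorm (s x - c) < r)
    else enorm (x - c) < r).
  rewrite /polarize_set/= /polarize !ind !memE.
  by case: ifPn => _; [|case: ifPn => _];
    case: (ltP (enorm (x - c)) r) => _; case: (ltP (enorm (s x - c)) r) => _ /=;
    rewrite ?maxxx ?minxx /Num.max /Num.min ?ltxx ?ltr01 ?ltr10;
    split => //= /eqP; rewrite ?(eq_sym 0) ?oner_eq0.
have memP x : (x \in half_pos s) = (0 < (offset s - dotv (normal s) x) * offset s).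
  by apply/idP/idP; rewrite inE.
have memN x : (x \in half_neg s) = ((offset s - dotv (normal s) x) * offset s < 0).
  by apply/idP/idP; rewrite inE.
apply/seteqP; suff main x : polarize_set s (eball c r) x <-> eball (move c (s 0)) r x.
  by split => x /main.
rewrite polE memP memN /eball/= cE.
move: (key x); set X := (offset s - dotv (normal s) x) * offset s.
set Y := (offset s - dotv (normal s) c) * offset s => kx.
have imp1 : 0 <= X * Y -> (enorm (s x - c) < r) ==> (enorm (x - c) < r).
  move=> XY; apply/implyP; apply: le_lt_trans.
  by rewrite ler_enorm_sqr kx lerDl mulr_ge0// ltW.
have imp2 : X * Y <= 0 -> (enorm (x - c) < r) ==> (enorm (s x - c) < r).
  move=> XY; apply/implyP; apply: le_lt_trans.
  by rewrite ler_enorm_sqr kx gerDl mulr_ge0_le0// ltW.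
rewrite (_ : (enorm (x - (if Y < 0 then s c else c)) < r) =
  if Y < 0 then enorm (s x - c) < r else enorm (x - c) < r); last first.
  by case: ifPn; rewrite // swap.
(* X and Y locate x and c: positive on the side of 0, negative on the other side. For X = 0 the
   point x is on the hyperplane and both implications hold. *)
case: (ltgtP 0 X) => hX; case: (ltP Y 0) => hY; move: imp1 imp2.
- by move=> _ /(_ (mulr_ge0_le0 (ltW hX) (ltW hY))); case: (_ < r); case: (_ < r).
- by move=> /(_ (mulr_ge0 (ltW hX) hY)) + _; case: (_ < r); case: (_ < r).
- by move=> /(_ (mulr_le0 (ltW hX) (ltW hY))) + _; case: (_ < r); case: (_ < r).
- by move=> _ /(_ (mulr_le0_ge0 (ltW hX) hY)); case: (_ < r); case: (_ < r).
- by rewrite -hX mul0r lexx => /(_ isT) + /(_ isT); case: (_ < r); case: (_ < r).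
- by [].
Qed.

(** The reflection is an isometry exchanging 0 and p, so the image of x has norm |x - p|. *)
Lemma enorm_move x p : enorm (move x p) = one_step x p.
Proof.
rewrite /move /one_step; case: ifPn => h; last by rewrite (min_idPl _)// leNgt.
rewrite (min_idPr _) ?ltW//; apply/eqP; rewrite -(eqrXn2 (_ : 0 < 2)%N) ?enorm_ge0//.
have p0 : dotv p p != 0.
  by rewrite dotv_eq0; apply/eqP => p0; move: h; rewrite p0 subr0 ltxx.
rewrite !sqr_enorm !dotvE (dotvC x p); apply/eqP; field.
by [].
Qed.

Lemma measurable_move d1 (T : measurableType d1) (f g : T -> 'rV[R]_d) :
  measurable_fun setT f -> measurable_fun setT g ->
  measurable_fun setT (fun t => move (f t) (g t)).
Proof.
move=> mf mg; apply: measurable_fun_ifT => //.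
  apply: measurable_fun_ltr; apply: measurable_fun_enorm => //.
  exact: measurable_fun_subv.
apply: measurable_fun_subv => //; apply: measurable_fun_scalev => //.
apply: measurable_funB => //; apply: measurable_funM.
  by apply: measurable_funM => //; exact: measurable_fun_dotv.
apply: measurable_fun_invr; first exact: measurable_fun_dotv.
by move=> t; exact: dotv_ge0.
Qed.

Fixpoint center_seq (p : nat -> 'rV[R]_d) (a : 'rV[R]_d) (n : nat) : 'rV[R]_d :=
  if n is n'.+1 then move (center_seq p a n') (p n') else a.

Lemma polarize_iter_eball (s : nat -> reflection R d) (a : 'rV[R]_d) r n :
  polarize_iter s (eball a r) n = eball (center_seq (fun i => s i 0) a n) r.
Proof. by elim: n => //= n ->; rewrite polarize_eball. Qed.

Lemma ball_center_eball c r : 0 < r -> ball_center (eball c r) = c.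
Proof.
move=> r0; rewrite /ball_center.
case: xgetP => [y _ [r' r'0 E]|/(_ c)]; last by case; exists r.
by apply/esym; exact: eball_inj E.
Qed.

Lemma enorm_center_seq_le (p : nat -> 'rV[R]_d) a n : enorm (center_seq p a n) <= enorm a.
Proof.
by elim: n => //= n IH; rewrite enorm_move (le_trans (one_step_le _ _)).
Qed.

End polarized_ball.

(** * Independence and the Markov property of the centres *)

Lemma finite_measure_eq_rectangles d1 d2 (T1 : measurableType d1)
    (T2 : measurableType d2) (R : realType)
    (m1 m2 : {measure set (T1 * T2) -> \bar R}) :
  (m1 setT < +oo)%E ->
  (forall A B, measurable A -> measurable B -> m1 (A `*` B) = m2 (A `*` B)) ->
  forall D, measurable D -> m1 D = m2 D.
Proof.
move=> m1oo m12 D mD.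
pose G : set (set (T1 * T2)) :=
  [set G | exists A, measurable A /\ exists B, measurable B /\ G = A `*` B].
apply: (measure_unique G (fun=> setT)) => //.
- rewrite measurable_prod_measurableType //; congr (<<s _ >>).
  rewrite predeqE; split => [[A mA [B mB <-]]|[A [mA [B [mB ->]]]]].
    by exists A; split => //; exists B.
  by exists A => //; exists B.
- move=> /= _ _ [X1 [mX1 [X2 [mX2 ->]]]] [Y1 [mY1 [Y2 [mY2 ->]]]].
  rewrite -setXI; exists (X1 `&` Y1); split; first exact: measurableI.
  by exists (X2 `&` Y2); split => //; exact: measurableI.
- move=> _; exists setT; split => //; exists setT; split => //.
  by rewrite setXTT.
- by rewrite bigcup_const.
- by move=> A [A1 [mA1 [A2 [mA2 ->]]]]; exact: m12.
Qed.

Section center_chain.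
Context {R : realType} {disp : measure_display} {T : measurableType disp}.
Context {d : nat}.
Variables (P : probability T R) (Z : nat -> T -> 'rV[R]_d) (a : 'rV[R]_d).
Hypothesis mZ : forall i, measurable_fun setT (Z i).
Hypothesis indepZ : mutually_independent P Z.

Definition center_at (n : nat) (w : T) : 'rV[R]_d := center_seq (Z ^~ w) a n.

Lemma measurable_center_at n : measurable_fun setT (center_at n).
Proof.
elim: n => [|n IH]; first exact: measurable_cst.
exact: measurable_move.
Qed.

Lemma measurable_cylinder (J : seq nat) (B : nat -> set 'rV[R]_d) :
  (forall j, j \in J -> measurable (B j)) ->
  measurable (\bigcap_(j in [set` J]) Z j @^-1` B j).
Proof.
move=> mB; apply: fin_bigcap_measurable; first exact: finite_seq.
move=> j jJ; exact: (measurable_preimage (mZ j) (mB _ jJ)).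
Qed.

Definition law_at n : probability 'rV[R]_d R :=
  distribution P (mfun_Sub (mem_set (mZ n))).

Definition center_law n : probability 'rV[R]_d R :=
  distribution P (mfun_Sub (mem_set (measurable_center_at n))).

Lemma measurable_center_pair n : measurable_fun setT (fun w => (center_at n w, Z n w)).
Proof. by apply/measurable_fun_pairP; split; [exact: measurable_center_at|exact: mZ]. Qed.

(** The centre at time n against a finite list of present and future reflections. The list is
    arbitrary so that the induction on n closes: passing to n + 1 consumes the index n. *)
Definition center_indep n := forall B (J : seq nat) (BJ : nat -> set 'rV[R]_d),
  measurable B -> uniq J -> (forall j, j \in J -> (n <= j)%N) ->
  (forall j, j \in J -> measurable (BJ j)) ->
  P (center_at n @^-1` B `&` \bigcap_(j in [set` J]) Z j @^-1` BJ j) =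
  (P (center_at n @^-1` B) * P (\bigcap_(j in [set` J]) Z j @^-1` BJ j))%E.

(** On a rectangle this is [center_indep] for the list n :: J. Both sides are finite measures in D,
    the left one being P restricted to the future event, so rectangles suffice. General D are needed
    because the next centre is a function of the pair. *)
Lemma center_joint n (J : seq nat) (BJ : nat -> set 'rV[R]_d) :
  center_indep n -> uniq J -> (forall j, j \in J -> (n < j)%N) ->
  (forall j, j \in J -> measurable (BJ j)) ->
  forall D, measurable D ->
  P ((fun w => (center_at n w, Z n w)) @^-1` D `&` \bigcap_(j in [set` J]) Z j @^-1` BJ j) =
  (P (\bigcap_(j in [set` J]) Z j @^-1` BJ j) * (center_law n \x law_at n) D)%E.
Proof.
move=> ind uJ nJ mBJ D mD.
set E := \bigcap_(j in _) _; have mE : measurable E by exact: measurable_cylinder.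
have fE : P E \is a fin_num by exact: fin_num_measure.
have E0 : 0 <= fine (P E) by rewrite fine_ge0.
pose m1 : {measure set ('rV[R]_d * 'rV[R]_d) -> \bar R} :=
  measure_function_pushforward__canonical__measure_function_Measure
    (mrestr P mE) (measurable_center_pair n).
pose m2 : {measure set ('rV[R]_d * 'rV[R]_d) -> \bar R} :=
  mscale (NngNum E0) (center_law n \x law_at n)%E.
have : m1 D = m2 D; last first.
  by rewrite /m1 /m2 /= /pushforward /mrestr /mscale /= fineK.
apply: finite_measure_eq_rectangles => //.
  rewrite /m1 /= /pushforward /mrestr setTI.
  by rewrite (le_lt_trans (probability_le1 P mE))// ltry.
move=> A B mA mB; rewrite /m1 /m2 /= /pushforward /mrestr /mscale /= fineK//.
pose BJ' := fun j => if j == n then B else BJ j.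
have nnJ : n \notin J by apply/negP => /nJ; rewrite ltnn.
have bE : \bigcap_(j in [set` (n :: J)]) Z j @^-1` BJ' j = Z n @^-1` B `&` E.
  apply/seteqP; split => w /= h.
    split; first by have := h n (mem_head _ _); rewrite /BJ'/= eqxx.
    move=> j jJ; have := h j; rewrite /= inE jJ orbT => /(_ isT).
    by rewrite /BJ'; case: eqP => // jn; move: nnJ; rewrite -jn jJ.
  move=> j; rewrite /= inE => /orP[/eqP ->|jJ]; first by rewrite /BJ' eqxx; case: h.
  rewrite /BJ'; case: eqP => [jn|_]; first by move: nnJ; rewrite -jn jJ.
  by case: h => _; apply.
have uJ' : uniq (n :: J) by rewrite /= nnJ.
have mBJ' j : j \in n :: J -> measurable (BJ' j).
  rewrite /BJ' inE; case: eqP => //= _ jJ; exact: mBJ.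
have nJ' j : j \in n :: J -> (n <= j)%N.
  by rewrite inE => /orP[/eqP ->//|/nJ/ltnW].
have := ind A (n :: J) BJ' mA uJ' nJ' mBJ'; rewrite bE => indA.
rewrite (_ : (fun w => (center_at n w, Z n w)) @^-1` (A `*` B) `&` E =
  center_at n @^-1` A `&` (Z n @^-1` B `&` E)); last first.
  by rewrite setIA.
apply: (etrans indA).
rewrite -/E -bE (indepZ uJ' mBJ') big_cons /BJ' eqxx.
rewrite (_ : (\prod_(j <- J) _)%E = P E); last first.
  rewrite /E (indepZ uJ mBJ) big_seq [RHS]big_seq; apply: eq_bigr => j jJ.
  by case: eqP => // jn; move: nnJ; rewrite -jn jJ.
apply/esym; rewrite [X in (_ * X)%E](_ : _ = center_law n A * law_at n B)%E; last first.
  exact: product_measure1E.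
by rewrite muleCA (muleC (P E)).
Qed.

Lemma center_joint_law n : center_indep n -> forall D, measurable D ->
  P ((fun w => (center_at n w, Z n w)) @^-1` D) = (center_law n \x law_at n)%E D.
Proof.
move=> ind D mD.
have h1 (j : nat) : j \in [::] -> (n < j)%N by [].
have h2 (j : nat) : j \in [::] -> measurable [set: 'rV[R]_d] by [].
have := center_joint ind (isT : uniq [::]) h1 h2 mD.
rewrite (_ : \bigcap_(j in _) _ = setT); last by apply/seteqP; split.
by rewrite setIT [X in _ = (X * _)%E -> _]probability_setT mul1e.
Qed.

Lemma center_independent n : center_indep n.
Proof.
elim: n => [|n IH] B J BJ mB uJ nJ mBJ.
  rewrite /center_at/=; have [aB|aB] := pselect (B a).
    rewrite (_ : _ @^-1` B = setT); last by apply/seteqP; split.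
    by rewrite setTI [X in (X * _)%E]probability_setT mul1e.
  rewrite (_ : _ @^-1` B = set0); last by apply/seteqP; split.
  by rewrite set0I measure0 mul0e.
have mm : measurable_fun setT (fun q : 'rV[R]_d * 'rV[R]_d => move q.1 q.2).
  exact: measurable_move.
have mD := measurable_preimage mm mB.
have pre : center_at n.+1 @^-1` B = (fun w => (center_at n w, Z n w)) @^-1`
    ((fun q : 'rV[R]_d * 'rV[R]_d => move q.1 q.2) @^-1` B) by [].
rewrite pre (center_joint IH uJ nJ mBJ mD) muleC; congr (_ * _)%E.
exact/esym/center_joint_law.
Qed.

(** The pair of the centre and the next reflection has a product law, so Tonelli's theorem
    integrates the reflection out first. *)
Lemma expectation_center_step n (h : 'rV[R]_d -> \bar R) :
  measurable_fun setT h -> (forall x, (0 <= h x)%E) ->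
  (\int[P]_w h (center_at n.+1 w) =
   \int[P]_w \int[law_at n]_p h (move (center_at n w) p))%E.
Proof.
move=> mh h0.
have mm : measurable_fun setT (fun q : 'rV[R]_d * 'rV[R]_d => move q.1 q.2).
  exact: measurable_move.
have mhm : measurable_fun setT (fun q : 'rV[R]_d * 'rV[R]_d => h (move q.1 q.2)).
  exact: (measurableT_comp mh mm).
pose pair w := (center_at n w, Z n w).
have mpair : measurable_fun setT pair by exact: measurable_center_pair.
transitivity (\int[pushforward P pair]_q h (move q.1 q.2))%E.
  by rewrite (ge0_integral_pushforward mpair).
transitivity (\int[center_law n \x law_at n]_q h (move q.1 q.2))%E.
  apply: eq_measure_integral => D mD _; rewrite /pushforward.
  by apply: center_joint_law => //; exact: center_independent.
rewrite fubini_tonelli1//.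
have mF := measurable_fun_fubini_tonelli_F (m2 := law_at n) _ mhm (fun q => h0 (move q.1 q.2)).
rewrite /center_law /distribution (ge0_integral_pushforward (measurable_center_at n))//.
by move=> x _; apply: integral_ge0.
Qed.

End center_chain.

(** * One-step estimates: strict monotonicity, positivity of c_alpha, inverse moments *)

Lemma lebesgue_rV_eball_gt0 (R : realType) n (c : 'rV[R]_n) x : 0 < x ->
  (0 < lebesgue_rV n (eball c x))%E.
Proof.
by move=> x0; rewrite lebesgue_rV_eballE// lte_fin mulr_gt0 ?exprn_gt0 ?ball_volume_gt0.
Qed.

Section moment_step_estimates.
Context {R : realType} {d : nat}.
Variables (L C : R) (rho : probability 'rV[R]_d R) (u : 'rV[R]_d).
Hypotheses (d_ge1 : (1 <= d)%N) (L_gt0 : 0 < L) (C_gt0 : 0 < C).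
Hypothesis rhoE : forall B : set 'rV[R]_d, measurable B ->
  rho B = (C%:E * \int[lebesgue_rV d]_(x in B `&` eball 0 (2 * L)%R)
             (radial_density x)%:E)%E.
Hypothesis u1 : enorm u = 1.

Local Notation mu := (@lebesgue_rV R d).
Local Notation k := (@radial_density R d).
Local Notation c := (fun j : nat => decrement C u j%:R).

Let enormZu x : 0 <= x -> enorm (x *: u) = x.
Proof. by move=> x0; rewrite enormZ u1 mulr1 ger0_norm. Qed.

(** By [integral_rho_mono] each step keeps at least half of the gap between the two starts, so after
    n steps at least 2^-n of the gap x'^j - x^j is left. *)
Lemma moment_poly_lt n j x x' : (0 < j)%N -> 0 <= x -> x < x' -> x' <= L ->
  moment_poly c n j x < moment_poly c n j x'.
Proof.
elim: n j x x' => [|n IH] j x x' j0 x0 xx' x'L /=.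
  by rewrite ltr_pXn2r ?nnegrE// (le_trans x0)// ltW.
have x'0 : 0 <= x' by rewrite (le_trans x0)// ltW.
have mono s t : 0 <= s -> s <= t -> t <= L -> moment_poly c n j s <= moment_poly c n j t.
  move=> s0; rewrite le_eqVlt => /orP[/eqP->//|st] tL.
  by rewrite ltW// IH.
have := integral_rho_mono C_gt0 rhoE u1 (measurable_moment_poly c n j) mono x0 (ltW xx') x'L.
have h y : 0 <= y -> y <= L -> \int[rho]_p moment_poly c n j (one_step (y *: u) p) =
    moment_poly c n j y - c j * moment_poly c n j.+1 y.
  move=> y0 yL; rewrite (integral_rho_moment_poly d_ge1 L_gt0 C_gt0 rhoE u1)// ?enormZu//.
rewrite !h//; last by rewrite (le_trans (ltW xx')).
have := IH j _ _ j0 x0 xx' x'L; lra.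
Qed.

Lemma moment_poly_ge0 n j x : (0 < j)%N -> 0 <= x -> x <= L -> 0 <= moment_poly c n j x.
Proof.
move=> j0; rewrite le_eqVlt => /orP[/eqP <- _|x0 xL]; first by rewrite moment_poly0.
by rewrite -(moment_poly0 c n j0) ltW// moment_poly_lt.
Qed.

Lemma decrement_gt0 alpha : 0 < alpha -> 0 < decrement C u alpha.
Proof.
move=> al0; have [mF F01] := decrement_integrand (R := R) al0.
have iF : mu.-integrable (eball 0 1) (fun y => ((1 - enorm y `^ alpha) * k (u - y))%:E).
  apply: (@bounded_kernel_integrable _ _ _ _ _ _ d_ge1 L_gt0 C_gt0 rhoE u1 (fun s => 1 - s `^ alpha) 1) => //.
  by move=> s /F01/andP[h1 h2]; rewrite ger0_norm.
have F0 y : eball 0 1 y -> (0 <= ((1 - enorm y `^ alpha) * k (u - y))%:E)%E.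
  rewrite /eball/= subr0 => y1; rewrite lee_fin mulr_ge0 ?kernel_ge0//.
  by have := F01 (enorm y); rewrite enorm_ge0 y1 => /(_ isT)/andP[].
rewrite mulr_gt0// fine_gt0//; apply/andP; split; last first.
  by rewrite -ge0_fin_numE ?integral_ge0// integrable_fin_num//; exact: measurable_eball.
have h0 : 0 < 2^-1 :> R by [].
(* A lower bound of the integrand on the ball of radius 1/2, where |y|^alpha <= 2^-alpha and |u - y|
   <= 2. *)
pose b := (1 - 2^-1 `^ alpha) * 2 ^- d.-1.
have b0 : 0 < b.
  rewrite mulr_gt0 ?invr_gt0 ?exprn_gt0// subr_gt0.
  have := @gt0_ltr_powR R alpha al0 2^-1 1; rewrite powR1 => -> //.
    by rewrite nnegrE.
    by rewrite nnegrE.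
  by rewrite invf_lt1// ltr1n.
have sub : eball 0 2^-1 `<=` (eball 0 1 : set 'rV[R]_d).
  by move=> y; rewrite /eball/= => /lt_trans; apply; rewrite invf_lt1// ltr1n.
have mEF : measurable_fun setT (fun y => ((1 - enorm y `^ alpha) * k (u - y))%:E).
  apply/measurable_EFinP.
  exact: (@measurable_comp_kernel _ _ u (fun s : R => 1 - s `^ alpha)).
apply: (@lt_le_trans _ _ (\int[mu]_(y in eball 0 2^-1) b%:E)%E).
  rewrite integral_cst; last exact: measurable_eball.
  apply: mule_gt0; first by rewrite lte_fin.
  exact: lebesgue_rV_eball_gt0.
apply: (@le_trans _ _ (\int[mu]_(y in eball 0 2^-1)
    ((1 - enorm y `^ alpha) * k (u - y))%:E)%E); last first.
  apply: ge0_subset_integral => //; try exact: measurable_eball.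
  exact: measurable_funTS.
apply: ge0_le_integral => //.
- exact: measurable_eball.
- by move=> y _; rewrite lee_fin ltW.
- exact: measurable_funTS.
move=> y; rewrite /eball/= subr0 => y1; rewrite lee_fin ler_pM//.
- rewrite subr_ge0 ltW//; have := @gt0_ltr_powR R alpha al0 2^-1 1.
  by rewrite powR1 => -> //; rewrite ?nnegrE// invf_lt1// ltr1n.
- rewrite lerB// ge0_ler_powR ?nnegrE ?enorm_ge0//; exact: ltW.
have uy : 0 < enorm (u - y).
  have := ler_enormB u y; rewrite u1.
  have : 2^-1 < 1 :> R by rewrite invf_lt1// ltr1n.
  by lra.
rewrite /radial_density lef_pV2 ?posrE ?exprn_gt0// lerXn2r ?nnegrE ?enorm_ge0//.
have := ler_enormD u (- y); rewrite u1 enormN.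
have : 2^-1 < 1 :> R by rewrite invf_lt1// ltr1n.
lra.
Qed.

Lemma decrement_nat_mono i j : (0 < i)%N -> (i <= j)%N ->
  decrement C u i%:R <= decrement C u j%:R.
Proof.
move=> i0 ij.
have j0 : (0 < j)%N by exact: leq_trans ij.
have iR : 0 < i%:R :> R by rewrite ltr0n.
have jR : 0 < j%:R :> R by rewrite ltr0n.
have [mF F01] := decrement_integrand iR; have [mG G01] := decrement_integrand jR.
apply: (le_kernel_mean d_ge1 L_gt0 C_gt0 rhoE u1 (M := 1)) => //.
- by move=> s /F01/andP[h1 h2]; rewrite ger0_norm.
- by move=> s /G01/andP[h1 h2]; rewrite ger0_norm.
move=> s /andP[s0 s1]; rewrite lerB// !powR_mulrn//.
by rewrite ler_wiXn2l// ltW.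
Qed.

Lemma measurable_set0v : measurable [set 0 : 'rV[R]_d].
Proof.
rewrite (_ : [set 0] = (@enorm R d) @^-1` [set 0]); last first.
  by apply/seteqP; split => v /=; [move=> ->; rewrite enorm0|move/eqP; rewrite enorm_eq0 => /eqP].
apply: measurable_preimage; last exact: measurable_set1.
by apply: measurable_fun_enorm; exact: measurable_id.
Qed.

Lemma lebesgue_rV_set0 : mu [set 0] = 0%E.
Proof.
have m0 := measurable_set0v.
apply/eqP; rewrite eq_le measure_ge0 andbT; apply/lee_addgt0Pr => e e0; rewrite add0e.
have v0 := ball_volume_gt0 (R := R) d.
pose s := Num.min 1 (e / ball_volume d).
have s0 : 0 < s by rewrite lt_min ltr01 divr_gt0.
apply: (@le_trans _ _ (mu (eball 0 s))).
  apply: le_measure; rewrite ?inE//; first exact: measurable_eball.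
  by move=> v ->; rewrite /eball/= subrr enorm0.
rewrite lebesgue_rV_eballE// lee_fin -ler_pdivlMr//.
apply: (@le_trans _ _ s); last by rewrite ge_min lexx orbT.
rewrite -[leRHS]expr1; apply: ler_wiXn2l => //; first exact: ltW.
by rewrite /s ge_min lexx.
Qed.

(** Finiteness again comes from the mass of [rho] being at most 1, here on the ball of radius 2L,
    and a dilation brings this ball to the unit ball. *)
Lemma radial_density_integrable : mu.-integrable (eball 0 1) (fun y => (k y)%:E).
Proof.
have mk : measurable_fun setT (fun y => (k y)%:E).
  by apply/measurable_EFinP/measurable_kernel; exact: measurable_id.
apply/integrableP; split; first exact: measurable_funTS.
under eq_integral do rewrite gee0_abs ?lee_fin ?kernel_ge0//.
set x := 2 * L; have x0 : 0 < x by rewrite mulr_gt0.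
have foo : (\int[mu]_(y in eball 0 x) (k y)%:E < +oo)%E.
  have := probability_le1 rho (@measurable_eball R d 0 x).
  rewrite [X in (X <= _)%E -> _](rhoE (@measurable_eball R d 0 x)) setIid -/x.
  move=> h; rewrite ltNge; apply/negP; rewrite leye_eq => /eqP Eoo.
  by move: h; rewrite Eoo gt0_muley ?lte_fin.
pose G := (fun y => (k y)%:E) \_ (eball 0 x : set 'rV[R]_d).
have mG : measurable_fun setT G.
  by apply/(measurable_restrictT _ (measurable_eball _ _)); apply: measurable_funTS.
have G0 z : (0 <= G z)%E.
  by apply: erestrict_ge0 => y _; rewrite lee_fin kernel_ge0.
have mx : measurable_fun setT (fun y : 'rV[R]_d => x *: y).
  by apply: measurable_fun_scalev => //; exact: measurable_id.
have mux A : measurable A ->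
    mu ((fun y : 'rV[R]_d => x *: y) @^-1` A) = ((x ^- d)%:E * mu A)%E.
  move=> mA; rewrite -(lebesgue_rV_affine 0 x0)//.
  by congr (lebesgue_rV d _); apply/seteqP; split => y; rewrite /preimage/= addr0.
have xd0 : 0 <= x ^- d by rewrite invr_ge0 exprn_ge0// ltW.
have E := @ge0_integral_measure_preimage _ _ _ mu _ _ mx xd0 mux G mG G0.
have Goo : (\int[mu]_y G (x *: y)%R < +oo)%E.
  rewrite E -[X in (_ * X)%E]integral_mkcond lte_mul_pinfty//.
move: Goo; have -> : (fun y => G (x *: y)) = (fun y => (x ^- d.-1)%:E *
    ((fun y => (k y)%:E) \_ (eball 0 1)) y)%E.
  apply/funext => y; rewrite /G !patchE.
  have -> : (x *: y \in (eball 0 x : set 'rV[R]_d)) = (y \in eball 0 1).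
    apply/idP/idP; rewrite !inE /eball/= !subr0 enormZ gtr0_norm//;
    by rewrite -ltr_pdivlMl// mulVf ?gt_eqF.
  case: ifPn => // _; last by rewrite mule0.
  by rewrite -EFinM /radial_density enormZ gtr0_norm// exprMn invfM.
rewrite ge0_integralZl//; last 3 first.
- by apply/(measurable_restrictT _ (measurable_eball _ _)); apply: measurable_funTS.
- by move=> y _; apply: erestrict_ge0 => z _; rewrite lee_fin kernel_ge0.
- by rewrite lee_fin invr_ge0 exprn_ge0// ltW.
rewrite -[X in (_ * X < _)%E]integral_mkcond => h.
rewrite ltNge; apply/negP; rewrite leye_eq => /eqP Eoo.
by move: h; rewrite Eoo gt0_muley ?ltxx// lte_fin invr_gt0 exprn_gt0.
Qed.

(** The two singularities are apart. For |y| < 1/2 one has |u - y| >= 1/2, and d > 1 gives |y|^-1 <=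
    |y|^-(d-1); for |y| >= 1/2 the factor (1 - |y|) / |y| is at most 2. *)
Lemma inverse_kernel_integrable : (1 < d)%N ->
  mu.-integrable (eball 0 1)
    (fun y => ((1 - enorm y) * (enorm y)^-1 * k (u - y))%:E).
Proof.
move=> d1.
have mF : measurable_fun setT (fun y : 'rV[R]_d => ((1 - enorm y) * (enorm y)^-1 * k (u - y))%:E).
  have me : measurable_fun setT (@enorm R d) by apply: measurable_fun_enorm; exact: measurable_id.
  apply/measurable_EFinP/measurable_funM; last first.
    by apply: measurable_kernel; exact: measurable_subl.
  apply: measurable_funM; first exact: measurable_funB.
  by apply: measurable_fun_invr => // y; exact: enorm_ge0.
apply: (@le_integrable _ _ _ mu _ (measurable_eball _ _) _
  (fun y => (2 ^+ d.-1)%:E * (k y)%:E + 2%:E * (k (u - y)%R)%:E)%E).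
- exact: measurable_funTS.
- move=> y; rewrite /eball/= subr0 => y1.
  have n0 := enorm_ge0 y; have k1 := kernel_ge0 y; have k2 := kernel_ge0 (u - y).
  have F0 : 0 <= (1 - enorm y) * (enorm y)^-1.
    by rewrite mulr_ge0 ?invr_ge0// subr_ge0 ltW.
  have G0 : 0 <= 2 ^+ d.-1 * k y + 2 * k (u - y).
    by rewrite addr_ge0 ?mulr_ge0 ?exprn_ge0.
  rewrite lee_fin (ger0_norm (mulr_ge0 F0 k2)) (ger0_norm G0).
  have [y2|y2] := ltP (enorm y) 2^-1.
    apply: (@le_trans _ _ (2 ^+ d.-1 * k y)); last by rewrite lerDl mulr_ge0.
    rewrite mulrC ler_pM//.
      have uy : 2^-1 <= enorm (u - y) by have := ler_enormB u y; rewrite u1; lra.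
      have uy0 : 0 < enorm (u - y) by apply: lt_le_trans uy; rewrite invr_gt0.
      rewrite /radial_density -exprVn lerXn2r ?nnegrE ?invr_ge0 ?enorm_ge0//.
      by rewrite -[leRHS]invrK lef_pV2 ?posrE ?invr_gt0.
    have [->|yn0] := eqVneq y 0; first by rewrite enorm0 invr0 mulr0 kernel_ge0.
    have ny : 0 < enorm y by rewrite enorm_gt0.
    apply: (@le_trans _ _ (enorm y)^-1).
      by rewrite ler_piMl ?invr_ge0// gerBl.
    rewrite /radial_density lef_pV2 ?posrE ?exprn_gt0//.
    rewrite -[leRHS]expr1 ler_wiXn2l// ?ltW//.
    by rewrite -ltnS prednK// ltnW.
  apply: (@le_trans _ _ (2 * k (u - y))); last by rewrite lerDr mulr_ge0// exprn_ge0.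
  rewrite ler_wpM2r//.
  have ny : 0 < enorm y by rewrite (lt_le_trans _ y2)// invr_gt0.
  apply: (@le_trans _ _ (enorm y)^-1).
    by rewrite ler_piMl ?invr_ge0// gerBl.
  by rewrite -[leRHS]invrK lef_pV2 ?posrE// invr_gt0.
apply: integrableD; first exact: measurable_eball.
  by apply: integrableZl; [exact: measurable_eball|exact: radial_density_integrable].
apply: integrableZl; first exact: measurable_eball.
exact: (kernel_integrable d_ge1 L_gt0 C_gt0 rhoE u1).
Qed.

(** A move raises 1/|a| by (1 - s) / s / |a| with s = |a - p| / |a|, and the mean of this is ell_d
    whatever |a|. The shift by eps keeps the inverse decreasing down to 0, where the conventional
    inverse is 0; it is removed only after Jensen's inequality. *)
Lemma integral_rho_inverse (a : 'rV[R]_d) (eps : R) : (1 < d)%N -> 0 < eps ->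
  enorm a <= L ->
  (\int[rho]_p ((one_step a p + eps)^-1)%:E <=
   ((enorm a + eps)^-1 + kernel_mean C u (fun s => (1 - s) * s^-1))%:E)%E.
Proof.
move=> d1 eps0 aL; set ell := kernel_mean _ _ _.
have ell0 : 0 <= ell.
  apply: (kernel_mean_ge0 _ C_gt0) => s /andP[s0 s1].
  by rewrite mulr_ge0 ?invr_ge0// subr_ge0 ltW.
have [a0|] := ltP 0 (enorm a); last first.
  rewrite le_eqVlt ltNge enorm_ge0 orbF => /eqP a0.
  rewrite [leLHS](_ : _ = ((enorm a + eps)^-1)%:E) ?lee_fin ?lerDl//.
  rewrite -[RHS](integral_probability_cst rho); apply: eq_integral => p _.
  do 2 congr (_ _); congr (_ + _); apply/eqP; rewrite eq_le one_step_le a0.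
  exact: one_step_ge0.
set x := enorm a in a0 aL *.
(* Since x <= L, delta * x <= eps, so [F (m / x) / x] bounds the increase of the shifted inverse at
   every p, also at p = a, where (1 - s) / s has the conventional value 0. *)
pose delta := eps / L; have delta0 : 0 < delta by rewrite divr_gt0.
pose F s : R := (1 - s) * (Num.max s 0 + delta)^-1.
have mF : measurable_fun setT F.
  apply: measurable_funM; first exact: measurable_funB.
  apply: measurable_fun_invr.
    by apply: measurable_funD => //; exact: measurable_maxr.
  by move=> s; rewrite addr_ge0 ?(ltW delta0)// le_max lexx orbT.
have F0 s : 0 <= s < 1 -> 0 <= F s.
  move=> /andP[s0 s1]; rewrite mulr_ge0 ?subr_ge0 ?(ltW s1)//.
  by rewrite invr_ge0 addr_ge0 ?(ltW delta0)// le_max lexx orbT.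
have iF : mu.-integrable (eball 0 1) (fun y => (F (enorm y) * k (u - y))%:E).
  apply: (bounded_kernel_integrable d_ge1 L_gt0 C_gt0 rhoE u1 (M := delta^-1)) => // s s01.
  rewrite ger0_norm ?F0//; move: s01 => /andP[s0 s1].
  rewrite /F (max_idPl s0) -[leRHS]mul1r ler_pM ?subr_ge0 ?(ltW s1) ?invr_ge0 ?addr_ge0 ?(ltW delta0)//.
    by rewrite gerBl.
  by rewrite lef_pV2 ?posrE// ?lerDr// ltr_wpDl.
have Fell : kernel_mean C u F <= ell.
  have iG := inverse_kernel_integrable d1.
  rewrite ler_wpM2l ?(ltW C_gt0)//; apply: fine_le.
  - by apply: integrable_fin_num => //; exact: measurable_eball.
  - by apply: integrable_fin_num => //; exact: measurable_eball.
  apply: ae_ge0_le_integral.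
  - exact: measurable_eball.
  - move=> y; rewrite /eball/= subr0 => y1.
    by rewrite lee_fin mulr_ge0 ?kernel_ge0// F0// enorm_ge0.
  - exact: (measurable_int mu).
  - move=> y; rewrite /eball/= subr0 => y1.
    by rewrite lee_fin mulr_ge0 ?kernel_ge0// mulr_ge0 ?invr_ge0 ?enorm_ge0// subr_ge0 ltW.
  - exact: (measurable_int mu).
  (* At y = 0 the integrand of ell_d is 0 by the convention on inverses, so the comparison holds off
     this null set only. *)
  exists [set 0]; split; [exact: measurable_set0v|exact: lebesgue_rV_set0|].
  move=> y /= h; apply: contrapT => /eqP y0; apply: h.
  rewrite /eball/= subr0 => y1; have ny : 0 < enorm y by rewrite enorm_gt0.
  rewrite lee_fin ler_wpM2r ?kernel_ge0// ler_wpM2l ?subr_ge0 ?(ltW y1)//.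
  by rewrite (max_idPl (enorm_ge0 _)) lef_pV2 ?posrE ?addr_gt0// lerDl ltW.
have mFd : measurable_fun setT (fun p : 'rV[R]_d => (F (enorm (a - p) / x))%:E).
  apply/measurable_EFinP/(measurableT_comp mF)/measurable_funM => //.
  exact: measurable_dist.
have mB : measurable (eball a x) by exact: measurable_eball.
have mFB : measurable_fun setT
    ((fun p => (F (enorm (a - p) / x) * x^-1)%:E) \_ (eball a x)).
  apply/(measurable_restrictT _ mB); apply: measurable_funTS.
  by apply/measurable_EFinP/measurable_funM => //; exact/measurable_EFinP.
have FB0 p : (0 <= ((fun p => (F (enorm (a - p) / x) * x^-1)%:E) \_ (eball a x)) p)%E.
  apply: erestrict_ge0 => q; rewrite /eball/= enormB => qa.
  rewrite lee_fin mulr_ge0 ?invr_ge0 ?(ltW a0)// F0// divr_ge0 ?enorm_ge0 ?(ltW a0)//=.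
  by rewrite ltr_pdivrMr// mul1r.
have xe0 : 0 <= (x + eps)^-1 by rewrite invr_ge0 addr_ge0// ltW.
have moe : measurable_fun setT (fun p => ((one_step a p + eps)^-1)%:E).
  apply/measurable_EFinP/measurable_fun_invr.
    by apply: measurable_funD => //; exact: measurable_one_step.
  by move=> p; rewrite addr_ge0 ?one_step_ge0// ltW.
apply: (@le_trans _ _ (\int[rho]_p (((x + eps)^-1)%:E +
    ((fun p => (F (enorm (a - p) / x) * x^-1)%:E) \_ (eball a x)) p))%E).
  apply: ge0_le_integral => //.
  - by move=> p _; rewrite lee_fin invr_ge0 addr_ge0 ?one_step_ge0// ltW.
  - exact: emeasurable_funD.
  move=> p _; rewrite patchE; case: ifPn => pa; last by rewrite one_step_out// adde0.
  rewrite one_step_in// -EFinD lee_fin.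
  move: pa; rewrite inE /eball/= (enormB p a) -/x.
  move: (enorm_ge0 (a - p)); set m := enorm (a - p) => m0 mx.
  rewrite /F (max_idPl _) ?divr_ge0 ?(ltW a0)// -lerBlDl.
  have me : 0 < m + eps by rewrite ltr_wpDl.
  have xe : 0 < x + eps by rewrite addr_gt0.
  have mde : 0 < m + delta * x by rewrite ltr_wpDl// mulr_gt0.
  rewrite (_ : (m + eps)^-1 - (x + eps)^-1 = (x - m) / ((m + eps) * (x + eps))); last first.
    by field; rewrite !gt_eqF.
  rewrite (_ : (1 - m / x) * (m / x + delta)^-1 * x^-1 = (x - m) / (x * (m + delta * x))); last first.
    by field; rewrite !gt_eqF.
  rewrite ler_wpM2l ?subr_ge0 ?(ltW mx)// lef_pV2 ?posrE ?mulr_gt0//.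
  have dx : delta * x <= eps by rewrite /delta mulrAC ler_pdivrMr// ler_wpM2l// ltW.
  apply: (@le_trans _ _ (x * (m + eps))); first by rewrite ler_wpM2l ?(ltW a0)// lerD2l.
  by rewrite mulrC ler_wpM2l ?(ltW me)// lerDl ltW.
rewrite ge0_integralD//.
rewrite [X in (X + _ <= _)%E](_ : _ = ((x + eps)^-1)%:E); last exact: integral_probability_cst.
rewrite EFinD leeD2l// -integral_mkcond.
under eq_integral do rewrite EFinM.
rewrite ge0_integralZr//; last 3 first.
- exact: measurable_funTS.
- move=> p; rewrite /eball/= enormB => pa; rewrite lee_fin F0//.
  by rewrite divr_ge0 ?enorm_ge0 ?(ltW a0)//= ltr_pdivrMr// mul1r.
- by rewrite lee_fin invr_ge0 ltW.
have -> := integral_rho_kernel_mean d_ge1 C_gt0 rhoE u1 a0 aL mF F0 iF.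
by rewrite -EFinM lee_fin mulrAC divff ?gt_eqF// mul1r.
Qed.

End moment_step_estimates.

(** The exponential exp(-t) lies between the two sides. *)
Lemma sub_le_powR_add1 (R : realType) (alpha t : R) : 0 < alpha -> 0 <= t ->
  1 - t <= (1 + t / alpha) `^ (- alpha).
Proof.
move=> al0 t0.
have ta0 : 0 <= t / alpha by rewrite divr_ge0// ltW.
apply: (@le_trans _ _ (expR (- t))); first by have := expR_ge1Dx (- t).
rewrite /powR gt_eqF; last by rewrite ltr_wpDr.
rewrite ler_expR mulNr lerN2 mulrC -ler_pdivlMr//.
by apply: le_ln1Dx; lra.
Qed.

(** * Moments of the chain *)
Section chain_moments.
Context {R : realType} {disp : measure_display} {T : measurableType disp}.
Context {d : nat}.
Variables (L C : R) (P : probability T R) (Z : nat -> T -> 'rV[R]_d).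
Variables (a u : 'rV[R]_d).
Hypotheses (d_ge1 : (1 <= d)%N) (L_gt0 : 0 < L) (C_gt0 : 0 < C).
Hypothesis mZ : forall i, measurable_fun setT (Z i).
Hypothesis indepZ : mutually_independent P Z.
Hypothesis lawZ : forall i (B : set 'rV[R]_d), measurable B ->
  law_at P mZ i B = (C%:E * \int[lebesgue_rV d]_(x in B `&` eball 0 (2 * L)%R)
             (radial_density x)%:E)%E.
Hypotheses (u1 : enorm u = 1) (aL : enorm a <= L).

Local Notation cen := (center_at Z a).
Local Notation X := (fun n w => enorm (cen n w)).
Local Notation c := (decrement C u).

Lemma center_norm_le n w : X n w <= enorm a.
Proof. exact: enorm_center_seq_le. Qed.

Lemma center_norm_leL n w : X n w <= L.
Proof. exact: le_trans (center_norm_le n w) aL. Qed.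

Lemma measurable_center_norm n : measurable_fun setT (X n).
Proof. by apply: measurable_fun_enorm; exact: measurable_center_at. Qed.

Lemma bounded_center_integrable n (g : R -> R) (M : R) : measurable_fun setT g ->
  (forall x, 0 <= x <= L -> `|g x| <= M) ->
  P.-integrable setT (EFin \o (fun w => g (X n w))).
Proof.
move=> mg gM; apply: (@bounded_integrable _ _ _ _ _ M).
  exact: (measurableT_comp mg (measurable_center_norm n)).
by move=> w; rewrite gM// enorm_ge0 center_norm_leL.
Qed.

Definition chain_moment n (alpha : R) : R := \int[P]_w (X n w `^ alpha).

Lemma powR_integrable n alpha : 0 < alpha ->
  P.-integrable setT (EFin \o (fun w => X n w `^ alpha)).
Proof.
move=> al0; apply: (@bounded_center_integrable n (fun x => x `^ alpha) (L `^ alpha)).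
  exact: measurable_powR.
move=> x /andP[x0 xL]; rewrite ger0_norm ?powR_ge0// ge0_ler_powR ?nnegrE//.
- exact: ltW.
- exact: le_trans xL.
Qed.

Lemma chain_momentE n alpha : 0 < alpha ->
  (\int[P]_w (X n w `^ alpha)%:E = (chain_moment n alpha)%:E)%E.
Proof. by move=> al0; rewrite fineK// integrable_fin_num//; exact: powR_integrable. Qed.

Lemma chain_momentS n alpha : 0 < alpha ->
  chain_moment n.+1 alpha = chain_moment n alpha - c alpha * chain_moment n (alpha + 1).
Proof.
move=> al0; apply: EFin_inj; rewrite -chain_momentE//.
have h0 (x : 'rV[R]_d) : (0 <= (enorm x `^ alpha)%:E)%E by rewrite lee_fin powR_ge0.
have mh : measurable_fun setT (fun x : 'rV[R]_d => (enorm x `^ alpha)%:E).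
  apply/measurable_EFinP/(measurableT_comp (@measurable_powR R alpha)).
  by apply: measurable_fun_enorm; exact: measurable_id.
apply: etrans (expectation_center_step a mZ indepZ n mh h0) _.
rewrite (_ : (\int[P]_w _)%E = (\int[P]_w ((X n w `^ alpha)%:E -
    (c alpha * X n w `^ (alpha + 1))%:E))%E); last first.
  apply: eq_integral => w _.
  under eq_integral do rewrite enorm_move.
  rewrite (integral_rho_powR d_ge1 L_gt0 C_gt0 (lawZ n) u1 al0 (center_norm_leL n w)).
  by rewrite EFinB.
have al1 : 0 < alpha + 1 by rewrite addr_gt0.
have i1 := powR_integrable n al0; have i2 := powR_integrable n al1.
have i3 := integrableZl measurableT (c alpha) i2.
apply: etrans (integralB_EFin measurableT i1 i3) _.
rewrite EFinB; congr (_ - _)%E; first exact: chain_momentE.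
under eq_integral do rewrite EFinM.
by rewrite integralZl// chain_momentE// EFinM.
Qed.

Lemma chain_moment0 alpha : chain_moment 0 alpha = enorm a `^ alpha.
Proof.
rewrite /chain_moment /Rintegral [X in fine X](_ : _ = (enorm a `^ alpha)%:E)//.
exact: (integral_probability_cst P (enorm a `^ alpha)).
Qed.

Lemma chain_moment_poly n j : (0 < j)%N ->
  chain_moment n j%:R = moment_poly (fun j => c j%:R) n j (enorm a).
Proof.
elim: n j => [|n IH] j j0.
  by rewrite chain_moment0 powR_mulrn// enorm_ge0.
by rewrite chain_momentS ?ltr0n//= natr1 !IH.
Qed.

Lemma expectation_center_norm_exp n j : (0 < j)%N ->
  ('E_P[fun w => (X n w ^+ j)%R] = (moment_poly (fun j => c j%:R) n j (enorm a))%:E)%E.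
Proof.
move=> j0; rewrite -chain_moment_poly// -chain_momentE ?ltr0n// unlock.
by apply: eq_integral => w _; rewrite powR_mulrn// enorm_ge0.
Qed.

Lemma chain_moment_ge0 n alpha : 0 <= chain_moment n alpha.
Proof. by apply: Rintegral_ge0 => w _; exact: powR_ge0. Qed.

Lemma chain_moment_lyapunov n alpha : 0 < alpha ->
  chain_moment n alpha `^ (alpha^-1 * (alpha + 1)) <= chain_moment n (alpha + 1).
Proof.
move=> al0; have al1 : 0 < alpha + 1 by rewrite addr_gt0.
set e := chain_moment n alpha; have e0 : 0 <= e by exact: chain_moment_ge0.
(* The case of equality in Young's inequality: with b^alpha = E[X^alpha], taking the mean of [young]
   gives e b <= E[X^(alpha + 1)]. *)
pose b := e `^ alpha^-1; have b0 : 0 <= b by exact: powR_ge0.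
have be : b `^ alpha = e by rewrite -powRrM mulVf ?gt_eqF// powRr1.
rewrite powRrM -/b.
have young x : 0 <= x -> x `^ alpha * b <=
    x `^ (alpha + 1) * (alpha / (alpha + 1)) + b `^ (alpha + 1) / (alpha + 1).
  move=> x0.
  have p0 : 0 < (alpha + 1) / alpha by rewrite divr_gt0.
  have pq : ((alpha + 1) / alpha)^-1 + (alpha + 1)^-1 = 1.
    by field; rewrite !gt_eqF.
  have := @conjugate_powR R (x `^ alpha) b ((alpha + 1) / alpha) (alpha + 1)
    (powR_ge0 _ _) b0 p0 al1 pq.
  by rewrite -powRrM mulrCA divff ?gt_eqF// mulr1 invf_div.
have i1 := powR_integrable n al0; have i2 := powR_integrable n al1.
have ic : P.-integrable setT (EFin \o cst (b `^ (alpha + 1) / (alpha + 1))).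
  exact: finite_measure_integrable_cst.
have i3 : P.-integrable setT (EFin \o (fun w => X n w `^ alpha * b)).
  exact: (integrableZr measurableT b i1).
have i4 : P.-integrable setT (EFin \o (fun w => X n w `^ (alpha + 1) * (alpha / (alpha + 1)))).
  exact: (integrableZr measurableT (alpha / (alpha + 1)) i2).
have i5 : P.-integrable setT (EFin \o (fun w => X n w `^ (alpha + 1) * (alpha / (alpha + 1)) +
    cst (b `^ (alpha + 1) / (alpha + 1)) w)).
  exact: (integrableD measurableT i4 ic).
have := le_Rintegral measurableT i3 i5 (fun w _ => young _ (enorm_ge0 _)).
rewrite RintegralZr// RintegralD// RintegralZr//.
rewrite -/(chain_moment n alpha) -/(chain_moment n (alpha + 1)) -/e.
rewrite /Rintegral [X in _ + fine X](_ : _ = (b `^ (alpha + 1) / (alpha + 1))%:E); last first.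
  exact: integral_probability_cst.
have <- : b `^ alpha * b = b `^ (alpha + 1) by rewrite powRD ?(gt_eqF al1)//; rewrite powRr1.
rewrite be /= => h; rewrite -(ler_pM2r (_ : 0 < alpha / (alpha + 1))) ?divr_gt0//.
have : e * b = e * b * (alpha / (alpha + 1)) + e * b / (alpha + 1).
  by field; rewrite gt_eqF.
by move: h => /=; lra.
Qed.

(** In terms of z = E[X_n^alpha]^(-1/alpha) the claim is linear growth: Lyapunov's inequality bounds
    the next moment by z^(-alpha) (1 - c_alpha / z), and [sub_le_powR_add1] turns this into a gain
    of at least c_alpha / alpha in z. A zero moment is treated apart, as z would not invert it. *)
Lemma chain_moment_upper n alpha : 0 < alpha -> 0 < enorm a ->
  chain_moment n alpha <= ((enorm a)^-1 + c alpha * alpha^-1 * n%:R) `^ (- alpha).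
Proof.
move=> al0 a0.
have c0 : 0 < c alpha by exact: (decrement_gt0 d_ge1 L_gt0 C_gt0 (lawZ 0) u1).
have cal0 : 0 < c alpha * alpha^-1 by rewrite divr_gt0.
elim: n => [|n IH].
  by rewrite mulr0 addr0 chain_moment0 -[(enorm a)^-1]powR_inv1 ?enorm_ge0// -powRrM mulN1r opprK.
have al1 : 0 < alpha + 1 by rewrite addr_gt0.
set y := (enorm a)^-1 + c alpha * alpha^-1 * n%:R.
have y0 : 0 < y by rewrite ltr_wpDr ?invr_gt0// mulr_ge0// ltW.
have -> : (enorm a)^-1 + c alpha * alpha^-1 * n.+1%:R = y + c alpha / alpha.
  by rewrite -natr1 mulrDr mulr1 addrA.
rewrite chain_momentS//.
have lya := chain_moment_lyapunov n al0.
have e0 : 0 <= chain_moment n alpha := chain_moment_ge0 n alpha.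
move: e0 IH lya; set e := chain_moment n alpha; set e' := chain_moment n (alpha + 1).
move=> + IH lya; rewrite le_eqVlt => /orP[/eqP e0|e0].
  rewrite -e0 (le_trans _ (powR_ge0 _ _))// sub0r oppr_le0 mulr_ge0//; first exact: ltW.
  exact: chain_moment_ge0.
pose z := e `^ (- alpha^-1); have z0 : 0 < z by exact: powR_gt0.
have ze : e = z `^ (- alpha) by rewrite /z -powRrM mulrNN mulVf ?gt_eqF// powRr1// ltW.
have yz : y <= z.
  rewrite /z powRN -[leLHS]invrK lef_pV2 ?posrE ?invr_gt0 ?powR_gt0//.
  have -> : y^-1 = (y `^ (- alpha)) `^ alpha^-1.
    by rewrite -powRrM mulNr divff ?gt_eqF// powR_inv1// ltW.
  rewrite ge0_ler_powR ?nnegrE ?powR_ge0//; last exact: ltW.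
  by rewrite invr_ge0 ltW.
have ze' : z `^ (- alpha) * z^-1 <= e'.
  apply: le_trans lya; rewrite ze -powRrM mulrA mulNr divff ?gt_eqF// mulN1r.
  rewrite opprD powRD; last by rewrite (gt_eqF z0) implybT.
  by rewrite powR_inv1// ltW.
apply: (@le_trans _ _ (z `^ (- alpha) * (1 - c alpha / z))).
  by rewrite mulrBr mulr1 -ze lerB// mulrCA ler_wpM2l ?(ltW c0)// ze.
apply: (@le_trans _ _ (z `^ (- alpha) * (1 + c alpha / z / alpha) `^ (- alpha))).
  by rewrite ler_wpM2l ?powR_ge0// sub_le_powR_add1// divr_ge0// ltW.
rewrite -powRM ?(ltW z0)//; last by rewrite addr_ge0// !divr_ge0// ltW.
rewrite mulrDr mulr1 (_ : z * (c alpha / z / alpha) = c alpha / alpha); last first.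
  by field; rewrite !gt_eqF.
have yc0 := addr_gt0 y0 cal0; have zc0 := addr_gt0 z0 cal0.
rewrite !powRN lef_pV2 ?posrE ?powR_gt0//.
by apply: ge0_ler_powR; rewrite ?nnegrE ?(ltW al0) ?(ltW yc0) ?(ltW zc0) ?lerD2r.
Qed.

Lemma expectation_inverse_le (d1 : (1 < d)%N) n (eps : R) : 0 < eps -> 0 < enorm a ->
  (\int[P]_w ((X n w + eps)^-1)%:E <=
   ((enorm a + eps)^-1 + n%:R * kernel_mean C u (fun s => (1 - s) * s^-1))%:E)%E.
Proof.
move=> eps0 a0; set ell := kernel_mean _ _ _.
have ell0 : 0 <= ell.
  apply: (kernel_mean_ge0 _ C_gt0) => s /andP[s0 s1].
  by rewrite mulr_ge0 ?invr_ge0// subr_ge0 ltW.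
have h0 (x : 'rV[R]_d) : (0 <= ((enorm x + eps)^-1)%:E)%E.
  by rewrite lee_fin invr_ge0 addr_ge0 ?enorm_ge0// ltW.
have me : measurable_fun setT (@enorm R d).
  by apply: measurable_fun_enorm; exact: measurable_id.
have mi : measurable_fun setT (fun x : 'rV[R]_d => (enorm x + eps)^-1).
  apply: measurable_fun_invr; first exact: measurable_funD.
  by move=> x; rewrite addr_ge0 ?enorm_ge0// ltW.
have mh : measurable_fun setT (fun x : 'rV[R]_d => ((enorm x + eps)^-1)%:E).
  exact/measurable_EFinP.
elim: n => [|n IH].
  rewrite mul0r addr0 [leLHS](_ : _ = ((enorm a + eps)^-1)%:E)//.
  exact: (integral_probability_cst P (enorm a + eps)^-1).
apply: (@le_trans _ _ (\int[P]_w (((X n w + eps)^-1)%:E + ell%:E))%E); last first.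
  rewrite ge0_integralD//; last by exact: (measurableT_comp mh (measurable_center_at a mZ n)).
  rewrite [X in (_ + X)%E](_ : _ = ell%:E); last exact: integral_probability_cst.
  by rewrite -natr1 mulrDl mul1r addrA EFinD leeD2r.
rewrite (expectation_center_step a mZ indepZ n mh h0).
apply: ge0_le_integral => //.
- by move=> w _; apply: integral_ge0.
- apply: (measurableT_comp (f := fun x => \int[law_at P mZ n]_p ((enorm (move x p) + eps)^-1)%:E)%E); last exact: measurable_center_at.
  apply: (measurable_fun_fubini_tonelli_F (m2 := law_at P mZ n) (fun q => ((enorm (move q.1 q.2) + eps)^-1)%:E)) => //.
  by apply: (measurableT_comp mh); exact: measurable_move.
- apply: emeasurable_funD => //.
  exact: (measurableT_comp mh (measurable_center_at a mZ n)).
move=> w _; under eq_integral do rewrite enorm_move.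
rewrite -EFinD.
exact: (integral_rho_inverse d_ge1 L_gt0 C_gt0 (lawZ n) u1 d1 eps0 (center_norm_leL n w)).
Qed.

(** Jensen's inequality for the inverse, through one tangent line. The bound b on E[1 / (X_n + eps)]
    does not involve eps, which can then be sent to 0. *)
Lemma expectation_center_norm_ge (d1 : (1 < d)%N) n : 0 < enorm a ->
  (((enorm a)^-1 + n%:R * kernel_mean C u (fun s => (1 - s) * s^-1))^-1%:E <=
   'E_P[X n])%E.
Proof.
move=> a0; set ell := kernel_mean _ _ _.
have ell0 : 0 <= ell.
  apply: (kernel_mean_ge0 _ C_gt0) => s /andP[s0 s1].
  by rewrite mulr_ge0 ?invr_ge0// subr_ge0 ltW.
set b := (enorm a)^-1 + n%:R * ell.
have b0 : 0 < b by rewrite ltr_wpDr ?invr_gt0// mulr_ge0.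
have iX : P.-integrable setT (EFin \o X n).
  by apply: (@bounded_center_integrable n id L) => // x /andP[x0 xL]; rewrite ger0_norm.
have EX : ('E_P[X n] = (\int[P]_w X n w)%:E)%E.
  by rewrite unlock fineK// integrable_fin_num.
rewrite EX lee_fin; apply/ler_addgt0Pr => eps eps0.
have mi : measurable_fun setT (fun x : R => (Num.max x 0 + eps)^-1).
  apply: measurable_fun_invr.
    by apply: measurable_funD => //; exact: measurable_maxr.
  by move=> x; rewrite addr_ge0 ?(ltW eps0)// le_max lexx orbT.
have ii : P.-integrable setT (EFin \o (fun w => (X n w + eps)^-1)).
  have := @bounded_center_integrable n (fun x : R => (Num.max x 0 + eps)^-1) eps^-1 mi.
  rewrite (_ : (fun w : T => (Num.max (X n w) 0 + eps)^-1) = (fun w => (X n w + eps)^-1)); last first.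
    by apply/funext => w; rewrite (max_idPl _)// enorm_ge0.
  apply => x /andP[x0 _]; rewrite (max_idPl _)// ger0_norm ?invr_ge0 ?addr_ge0 ?(ltW eps0)//.
  by rewrite lef_pV2 ?posrE ?lerDr// ltr_wpDl.
have hinv : \int[P]_w (X n w + eps)^-1 <= b.
  have := expectation_inverse_le d1 n eps0 a0; rewrite -/ell.
  rewrite -(@fineK _ (\int[P]_w ((X n w + eps)^-1)%:E)%E) ?integrable_fin_num// lee_fin.
  move=> h; apply: le_trans h _; rewrite lerD2r lef_pV2 ?posrE// ?lerDl ?ltW// addr_gt0//.
have ic (z : R) : P.-integrable setT (EFin \o cst z) by exact: finite_measure_integrable_cst.
have cE (z : R) : \int[P]_w cst z w = z.
  by rewrite /Rintegral [X in fine X](_ : _ = z%:E)//; exact: integral_probability_cst.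
have i1 : P.-integrable setT (EFin \o (fun w => cst (2 * b^-1) w - (X n w + eps)^-1 * (b^-1 ^+ 2))).
  exact: (integrableB measurableT (ic _) (integrableZr measurableT (b^-1 ^+ 2) ii)).
have i2 : P.-integrable setT (EFin \o (fun w => X n w + cst eps w)).
  exact: (integrableD measurableT iX (ic _)).
(* With t = 1 / (X_n + eps) this reads 1/t >= 2/b - t/b^2, the tangent of 1/t at t = b. *)
have tangent w : setT w -> cst (2 * b^-1) w - (X n w + eps)^-1 * (b^-1 ^+ 2) <= X n w + cst eps w.
  move=> _ /=; have Xe : 0 < X n w + eps by rewrite ltr_wpDl ?enorm_ge0.
  move: Xe; set q := X n w + eps => q0.
  rewrite -subr_ge0 (_ : _ - _ = (q - b^-1) ^+ 2 / q); first by rewrite divr_ge0 ?sqr_ge0// ltW.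
  by field; rewrite !gt_eqF.
have := le_Rintegral measurableT i1 i2 tangent.
rewrite RintegralB//; last exact: (integrableZr measurableT (b^-1 ^+ 2) ii).
rewrite cE (_ : \int[P]_w (X n w + cst eps w) = \int[P]_w X n w + eps); last first.
  by rewrite RintegralD// cE.
rewrite (_ : \int[P]_w ((X n w + eps)^-1 * b^-1 ^+ 2) =
  \int[P]_w (X n w + eps)^-1 * b^-1 ^+ 2); last by rewrite RintegralZr.
move=> h; apply: le_trans h.
rewrite lerBrDr -lerBrDl (_ : _ - _ = b^-1); last by lra.
rewrite expr2 mulrA ler_piMl ?invr_ge0 ?(ltW b0)//.
by rewrite ler_pdivrMr// mul1r.
Qed.

End chain_moments.

(** * Limits of the scaled moments *)
Section binomial_mean.
Context {R : realType}.
Implicit Types (f g : nat -> R) (q : R).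

(* The expectation of [f] under the binomial law with parameters m and q. *)
Fixpoint binomial_mean q (m : nat) f : R :=
  if m is m'.+1 then
    (1 - q) * binomial_mean q m' f + q * binomial_mean q m' (fun i => f i.+1)
  else f 0%N.

Lemma le_binomial_mean q m f g : 0 <= q <= 1 -> (forall i, f i <= g i) ->
  binomial_mean q m f <= binomial_mean q m g.
Proof.
move=> /andP[q0 q1]; elim: m f g => [|m IH] f g fg /=; first exact: fg.
by rewrite lerD// ler_wpM2l ?subr_ge0// IH.
Qed.

Lemma binomial_mean_affine q m (x y : R) :
  binomial_mean q m (fun i => x + y * i%:R) = x + y * (m%:R * q).
Proof.
elim: m x => [|m IH] x /=; first by rewrite mul0r.
rewrite IH (_ : (fun i => _) = (fun i => (x + y) + y * i%:R)).
  by rewrite IH -natr1; ring.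
by apply/funext => i; rewrite -natr1; ring.
Qed.

Lemma binomial_meanB q m (b : R) f g :
  binomial_mean q m (fun i => f i - b * g i) =
  binomial_mean q m f - b * binomial_mean q m g.
Proof. by elim: m f g => [//|m IH] f g /=; rewrite !IH; ring. Qed.

(** The supporting line of a convex sequence at n, with the slope to the right of n. The increments
    are nondecreasing, and summing them away from n in either direction gives the bound. *)
Lemma convex_support f : (forall i, f i.+1 - f i.+2 <= f i - f i.+1) ->
  forall n i, f n + (i%:R - n%:R) * (f n.+1 - f n) <= f i.
Proof.
move=> cvx n i.
have step k l : f (k + l).+1 - f (k + l).+2 <= f k - f k.+1 /\
                f (k + l)%N - f (k + l).+1 <= f k - f k.+1.
  elim: l => [|l [IH1 IH2]]; first by rewrite !addn0; split; [exact: cvx|].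
  by rewrite addnS; split => //; exact: le_trans (cvx _) IH1.
have [ni|ni] := leqP n i.
  rewrite -(subnKC ni); move: (i - n)%N => l {ni}.
  elim: l => [|l IH]; first by rewrite addn0 subrr mul0r addr0.
  have [_] := step n l; rewrite addnS -natr1; nra.
rewrite -(subnKC (ltnW ni)); move: (n - i)%N => l {ni n}.
elim: l => [|l IH]; first by rewrite addn0 subrr mul0r addr0.
have [h1 h2] := step i l; have h3 := cvx (i + l)%N.
rewrite addnS -natr1 natrD in IH *.
have l0 : 0 <= l%:R :> R by [].
nra.
Qed.

Lemma binomial_mean_jensen q m n f : 0 <= q <= 1 -> m%:R * q = n%:R ->
  (forall i, f i.+1 - f i.+2 <= f i - f i.+1) -> f n <= binomial_mean q m f.
Proof.
move=> q01 mq cvx; pose s := f n.+1 - f n.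
apply: (@le_trans _ _ (binomial_mean q m (fun i => (f n - n%:R * s) + s * i%:R))).
  by rewrite binomial_mean_affine mq; lra.
apply: le_binomial_mean => // i.
by have := convex_support cvx n i; rewrite -/s; lra.
Qed.

(** The thinning identity. Both sides obey the same recursion in m: a success of the additional
    trial replaces i by i + 1, which subtracts c_j times the moment of order j + 1. *)
Lemma binomial_mean_moment_poly c q m j (x : R) :
  q ^+ j * binomial_mean q m (fun i => moment_poly c i j x) =
  moment_poly c m j (q * x).
Proof.
elim: m j => [|m IH] j /=; first by rewrite exprMn.
rewrite binomial_meanB -!IH exprS; ring.
Qed.

End binomial_mean.

Section moment_limits.
Context {R : realType}.
Variables (c : nat -> R) (L : R).
Hypothesis L_gt0 : 0 < L.
Hypothesis c_gt0 : forall j, (0 < j)%N -> 0 < c j.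
Hypothesis p_ge0 : forall n j x, (0 < j)%N -> 0 <= x -> x <= L ->
  0 <= moment_poly c n j x.
Hypothesis p_mono : forall n j x y, (0 < j)%N -> 0 <= x -> x <= y -> y <= L ->
  moment_poly c n j x <= moment_poly c n j y.

Local Notation p := (moment_poly c).

(* Scaling x by q = n/m amounts to averaging over a binomial time of mean n, and the
   moments are convex in time. *)
Lemma moment_poly_compare n m j x y : (0 < j)%N -> (0 < n)%N -> (n <= m)%N ->
  0 <= x -> x <= L -> 0 <= y -> y <= L -> x * n%:R <= y * m%:R ->
  n%:R ^+ j * p n j x <= m%:R ^+ j * p m j y.
Proof.
move=> j0 n0 nm x0 xL y0 yL xy.
have m0 : 0 < m%:R :> R by rewrite ltr0n (leq_trans n0).
pose q : R := n%:R / m%:R.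
have q01 : 0 <= q <= 1.
  by rewrite divr_ge0//= ler_pdivrMr// mul1r ler_nat.
have mq : m%:R * q = n%:R by rewrite mulrCA divff ?mulr1// gt_eqF.
have qx : q * x <= y by rewrite mulrC mulrA ler_pdivrMr.
have -> : n%:R ^+ j = m%:R ^+ j * q ^+ j by rewrite -exprMn mq.
rewrite -mulrA ler_wpM2l ?exprn_ge0 ?(ltW m0)//.
have /andP[q0 q1] := q01.
apply: (@le_trans _ _ (p m j (q * x))); last by rewrite p_mono// mulr_ge0.
rewrite -binomial_mean_moment_poly ler_wpM2l ?exprn_ge0//.
apply: (binomial_mean_jensen q01 mq) => i /=.
(* Convexity in time: the second difference of the j-th moments is c_j c_(j+1) times the moment of
   order j + 2. *)
have := p_ge0 i (ltn0Sn j.+1) x0 xL; have := c_gt0 (ltn0Sn j); have := c_gt0 j0.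
move=> h1 h2 h3.
have : 0 <= c j * (c j.+1 * p i j.+2 x) by rewrite !mulr_ge0 ?(ltW h1) ?(ltW h2).
lra.
Qed.

Definition scaled_moment j x n : R := n%:R ^+ j * p n j x.

Lemma scaled_moment_nd j x : (0 < j)%N -> 0 <= x -> x <= L ->
  nondecreasing_seq (scaled_moment j x).
Proof.
move=> j0 x0 xL; apply/nondecreasing_seqP => n; rewrite /scaled_moment.
case: n => [|n].
  rewrite expr0n gtn_eqF// mul0r mulr_ge0 ?p_ge0//.
by apply: moment_poly_compare => //; rewrite ler_wpM2l ?ler_nat.
Qed.

Variable x0 : R.
Hypotheses (x0_gt0 : 0 < x0) (x0_le : x0 <= L).
Hypothesis p_bounded : forall j, (0 < j)%N ->
  exists M, forall n, scaled_moment j x0 n <= M.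

(** A longer time makes up for a smaller start: [moment_poly_compare] applies as soon as m is a
    multiple K n with x <= K y. Monotonicity in n then forces the same limit from every positive
    start. *)
Lemma scaled_moment_cofinal j x y : (0 < j)%N -> 0 <= x -> x <= L -> 0 < y -> y <= L ->
  forall n, exists m, scaled_moment j x n <= scaled_moment j y m.
Proof.
move=> j0 x0' xL y0 yL [|n].
  exists 0%N; rewrite /scaled_moment expr0n gtn_eqF// !mul0r//.
pose K := (Num.bound (x / y)).+1.
exists (K * n.+1)%N; rewrite /scaled_moment.
apply: moment_poly_compare => //; [by rewrite leq_pmull|exact: ltW|].
rewrite natrM mulrA ler_wpM2r// mulrC -ler_pdivrMr//.
apply: le_trans (ltW (archi_boundP _)) _; first by rewrite divr_ge0// ltW.
by rewrite ler_nat.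
Qed.

Lemma scaled_moment_bounded j x : (0 < j)%N -> 0 <= x -> x <= L ->
  exists M, forall n, scaled_moment j x n <= M.
Proof.
move=> j0 x0' xL; have [M HM] := p_bounded j0; exists M => n.
have [m hm] := scaled_moment_cofinal j0 x0' xL x0_gt0 x0_le n.
exact: le_trans hm (HM m).
Qed.

Lemma is_cvg_scaled_moment j x : (0 < j)%N -> 0 <= x -> x <= L ->
  cvgn (scaled_moment j x).
Proof.
move=> j0 x0' xL; apply: nondecreasing_is_cvgn; first exact: scaled_moment_nd.
by have [M HM] := scaled_moment_bounded j0 x0' xL; exists M => _ [n _ <-].
Qed.

(** The start L is a reference; it is also the one implicit in [alpha_seq]. *)
Definition moment_limit j : R := limn (scaled_moment j L).

Lemma scaled_moment_cvg j x : (0 < j)%N -> 0 < x -> x <= L ->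
  scaled_moment j x n @[n --> \oo] --> moment_limit j.
Proof.
move=> j0 x_gt0 xL; have x_ge0 := ltW x_gt0.
have cx := is_cvg_scaled_moment j0 x_ge0 xL.
have L0 := ltW L_gt0; have cL := is_cvg_scaled_moment j0 L0 (lexx L).
suff -> : moment_limit j = limn (scaled_moment j x) by [].
have le y z : 0 < y -> y <= L -> 0 < z -> z <= L ->
    limn (scaled_moment j y) <= limn (scaled_moment j z).
  move=> y0 yL z0 zL; apply: limr_le; first by apply: is_cvg_scaled_moment => //; exact: ltW.
  apply: nearW => n.
  have [m hm] := scaled_moment_cofinal j0 (ltW y0) yL z0 zL n.
  apply: le_trans hm _; apply: nondecreasing_cvgn_le.
    by apply: scaled_moment_nd => //; exact: ltW.
  by apply: is_cvg_scaled_moment => //; exact: ltW.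
by apply/eqP; rewrite eq_le !le.
Qed.

Lemma moment_limit_ge0 j : (0 < j)%N -> 0 <= moment_limit j.
Proof.
move=> j0; apply: limr_ge; first by apply: is_cvg_scaled_moment => //; exact: ltW.
by apply: nearW => n; rewrite mulr_ge0 ?exprn_ge0// p_ge0// ltW.
Qed.

Lemma ratio_power_cvg j :
  (n%:R * (1 - (n%:R / n.+1%:R) ^+ j) : R) @[n --> \oo] --> (j%:R : R).
Proof.
have t1 : (n%:R / n.+1%:R : R) @[n --> \oo] --> (1 : R).
  have -> : (fun n => n%:R / n.+1%:R : R) = (fun n => 1 - harmonic n).
    by apply/funext => n; rewrite /harmonic/= -natr1; field; rewrite natr1 pnatr_eq0.
  rewrite -[X in _ --> X]subr0; apply: cvgB; first exact: cvg_cst.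
  exact: cvg_harmonic.
have tX i : ((n%:R / n.+1%:R) ^+ i : R) @[n --> \oo] --> (1 : R).
  elim: i => [|i IH]; first by under eq_fun do rewrite expr0; exact: cvg_cst.
  have -> : (fun n => (n%:R / n.+1%:R) ^+ i.+1 : R) =
    (fun n => n%:R / n.+1%:R * (n%:R / n.+1%:R) ^+ i) by apply/funext => n; rewrite exprS.
  by rewrite -[X in _ --> X]mulr1; exact: cvgM.
have -> : (fun n => n%:R * (1 - (n%:R / n.+1%:R) ^+ j) : R) =
    (fun n => n%:R / n.+1%:R * \sum_(i < j) (n%:R / n.+1%:R) ^+ i).
  apply/funext => n; have n0 : n.+1%:R != 0 :> R by rewrite pnatr_eq0.
  have := subrX1 (n%:R / n.+1%:R : R) j; set t := n%:R / n.+1%:R => E.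
  have -> : 1 - t ^+ j = (1 - t) * \sum_(i < j) t ^+ i.
    by rewrite -opprB E -mulNr opprB.
  by rewrite mulrA; congr (_ * _); rewrite /t -natr1; field; rewrite natr1.
rewrite -[X in _ --> X]mul1r; apply: cvgM => //.
elim: j => [|j IH].
  have -> : (fun n => \sum_(i < 0) (n%:R / n.+1%:R) ^+ i) = (fun=> 0 : R).
    by apply/funext => n; rewrite big_ord0.
  exact: cvg_cst.
have -> : (fun n => \sum_(i < j.+1) (n%:R / n.+1%:R) ^+ i) =
    (fun n => \sum_(i < j) (n%:R / n.+1%:R) ^+ i + (n%:R / n.+1%:R) ^+ j : R).
  by apply/funext => n; rewrite big_ord_recr.
by rewrite -natr1; apply: cvgD.
Qed.

(* Otherwise the increments would dominate a harmonic series. *)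
Lemma nondecreasing_increment_limit (A : nat -> R) (l : R) :
  nondecreasing_seq A -> cvgn A ->
  n%:R * (A n.+1 - A n) @[n --> \oo] --> l -> l <= 0.
Proof.
move=> ndA cA nl; rewrite leNgt; apply/negP => l0.
have l2 : 0 < l / 2 by rewrite divr_gt0.
have [N _ HN] : \forall n \near \oo, l / 2 < n%:R * (A n.+1 - A n).
  by have /cvgr_gt := nl; apply; rewrite gtr_pMr// invf_lt1// ltr1n.
have inc n k : (N <= n)%N -> (0 < n)%N -> (k <= n)%N ->
    A n + k%:R * (l / 4 / n%:R) <= A (n + k)%N.
  move=> Nn n0; have nR : 0 < n%:R :> R by rewrite ltr0n.
  elim: k => [|k IH] kn; first by rewrite mul0r addr0 addn0.
  have := IH (ltnW kn); have := HN (n + k)%N; rewrite /= (leq_trans Nn) ?leq_addr// => /(_ isT).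
  rewrite addnS; set d := A (n + k).+1 - A (n + k)%N => h1 h2.
  have d0 : 0 <= d by rewrite subr_ge0 ndA.
  have : l / 4 / n%:R <= d.
    rewrite ler_pdivrMr//.
    have : (n + k)%:R * d <= 2 * n%:R * d.
      by rewrite ler_wpM2r// -natrM ler_nat mul2n -addnn leq_add2l ltnW.
    by rewrite mulrC; lra.
  by rewrite -(natr1 k) mulrDl mul1r /d; lra.
have c2 : A (n.+1 + n.+1)%N - A n.+1 @[n --> \oo] --> (0 : R).
  rewrite -[X in _ --> X](subrr (limn A)); apply: cvgB; last first.
    by have := cA; rewrite -(cvg_shiftS A).
  apply: (cvg_comp _ _ _ cA) => B [M _ HM]; exists M => // n /= Mn.
  by apply: HM => /=; rewrite (leq_trans Mn)// (leq_trans (leqnSn _))// leq_addr.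
have [M _ HM] : \forall n \near \oo, A (n.+1 + n.+1)%N - A n.+1 < l / 4.
  by have /cvgr_lt := c2; apply; rewrite divr_gt0.
have := HM (maxn M N); rewrite /= leq_maxl => /(_ isT).
have := inc (maxn M N).+1 (maxn M N).+1; rewrite leqnn.
rewrite (leq_trans (leq_maxr M N))// => /(_ isT isT isT).
rewrite mulrC divfK ?pnatr_eq0//; lra.
Qed.

(** With A the scaled moments of order j, n times the increment of A tends to l = j m_j - c_j
    m_(j+1): the first term is the relative growth of n^j, the second comes from the recursion.
    Monotonicity of A gives l >= 0, its convergence l <= 0. *)
Lemma moment_limitS j : (0 < j)%N ->
  c j * moment_limit j.+1 = j%:R * moment_limit j.
Proof.
move=> j0.
pose A := scaled_moment j L; have L0 := ltW L_gt0.
have cA := scaled_moment_cvg j0 L_gt0 (lexx L).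
have cB := scaled_moment_cvg (ltn0Sn j) L_gt0 (lexx L).
have ndA := scaled_moment_nd j0 L0 (lexx L).
pose l := j%:R * moment_limit j - c j * moment_limit j.+1.
have DE n : n%:R * (A n.+1 - A n) =
    n%:R * (1 - (n%:R / n.+1%:R) ^+ j) * A n.+1 - c j * scaled_moment j.+1 L n.
  have n0 : n.+1%:R != 0 :> R by rewrite pnatr_eq0.
  have -> : (n%:R * (1 - (n%:R / n.+1%:R) ^+ j) * A n.+1 =
     n%:R * A n.+1 - n%:R * (n%:R ^+ j * p n.+1 j L)).
    rewrite mulrBr mulrBl mulr1 /A /scaled_moment expr_div_n; field.
    by rewrite expf_neq0.
  by rewrite /A /scaled_moment /= exprS; ring.
have cD : n%:R * (A n.+1 - A n) @[n --> \oo] --> l.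
  under eq_fun do rewrite DE.
  apply: cvgB; last by apply: cvgM => //; exact: cvg_cst.
  apply: cvgM; first exact: ratio_power_cvg.
  by have := cA; rewrite -(cvg_shiftS A).
have l1 : l <= 0 by exact: nondecreasing_increment_limit cD.
have l2 : 0 <= l.
  rewrite -(cvg_lim _ cD)//; apply: limr_ge; first by apply/cvg_ex; exists l.
  by apply: nearW => n; rewrite mulr_ge0// subr_ge0 ndA.
by apply/esym/eqP; rewrite -subr_eq0; apply/eqP/le_anti; rewrite -/l l1 l2.
Qed.

Lemma moment_limitE j : (0 < j)%N ->
  moment_limit j = moment_limit 1 * (j.-1)`!%:R / \prod_(1 <= i < j) c i.
Proof.
case: j => // j _; elim: j => [|j IH]; first by rewrite big_geq// fact0 mulr1 divr1.
have cj := c_gt0 (ltn0Sn j).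
have -> : moment_limit j.+2 = j.+1%:R * moment_limit j.+1 / c j.+1.
  by rewrite -moment_limitS// mulrC mulKf// gt_eqF.
rewrite IH [in RHS]big_nat_recr//= factS natrM invfM; ring.
Qed.

Lemma moment_limit_le j : (0 < j)%N -> (forall i, (0 < i)%N -> c 1%N <= c i) ->
  moment_limit j <= moment_limit 1 * (j.-1)`!%:R / c 1%N ^+ j.-1.
Proof.
move=> j0 c1; rewrite moment_limitE//.
have c10 : 0 < c 1%N by exact: c_gt0.
have prod_ge : c 1%N ^+ j.-1 <= \prod_(1 <= i < j) c i.
  case: j j0 => // j _; elim: j => [|j IH]; first by rewrite big_geq// expr0.
  rewrite big_nat_recr//= exprSr ler_pM ?exprn_ge0 ?(ltW c10) ?c1//.
rewrite ler_wpM2l ?mulr_ge0 ?moment_limit_ge0// lef_pV2 ?posrE ?exprn_gt0//.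
by apply: lt_le_trans prod_ge; rewrite exprn_gt0.
Qed.

End moment_limits.

(** * Determinacy of laws by moments of factorial growth *)
Section expR_taylor.
Context {R : realType}.

(* [(-1) ^+ n] times the [n]-th Taylor remainder of [expR (- x)] *)
Fixpoint expRN_remainder (n : nat) (x : R) : R :=
  if n is n'.+1 then x ^+ n' / n'`!%:R - expRN_remainder n' x else expR (- x).

Lemma is_derive_expRN_remainder n (x : R) :
  is_derive x 1 (expRN_remainder n.+1) (expRN_remainder n x).
Proof.
elim: n x => [|n IH] x.
  have -> : expRN_remainder 1 = (cst 1 : R -> R) - (expR \o -%R).
    by apply/funext => y; rewrite /= !fctE expr0 fact0 divr1.
  apply: is_derive_eq.
  rewrite /= /GRing.scale/=; ring.
have -> : expRN_remainder n.+2 =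
    (n.+1`!%:R^-1 *: ((fun x : R => x) ^+ n.+1 : R -> R)) - expRN_remainder n.+1.
  by apply/funext => y; rewrite /= !fctE /GRing.scale/= mulrC.
have := IH x => IHx.
apply: is_derive_eq.
rewrite [RHS]/= /GRing.scale/= mulr1 -mulr_natl factS natrM; congr (_ - _).
by rewrite mulr1 invfM [n.+1%:R^-1 * _]mulrC -mulrA mulKf ?pnatr_eq0// mulrC.
Qed.

Lemma expRN_remainder0 n : expRN_remainder n.+1 0 = 0.
Proof.
elim: n => [|n IH]; first by rewrite /= expr0 fact0 divr1 oppr0 expR0 subrr.
by rewrite -[LHS]/(0 ^+ n.+1 / n.+1`!%:R - expRN_remainder n.+1 0) IH expr0n mul0r subr0.
Qed.

(** Each remainder vanishes at 0 and has the preceding one as derivative, so nonnegativity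
    propagates by the mean value theorem. *)
Lemma expRN_remainder_ge0 n (x : R) : 0 <= x -> 0 <= expRN_remainder n x.
Proof.
elim: n x => [|n IH] x; first by rewrite expR_ge0.
rewrite le_eqVlt => /orP[/eqP <-|x0]; first by rewrite expRN_remainder0.
have dF y := is_derive_expRN_remainder n y.
have [|c cI cE] := MVT x0 (fun y _ => dF y).
  apply: continuous_subspaceT => y; apply: differentiable_continuous.
  by apply/derivable1_diffP; apply: (@ex_derive _ _ _ _ _ _ _ (dF y)).
have c0 : 0 < c by move: cI; rewrite in_itv/= => /andP[].
move: cE; rewrite expRN_remainder0 !subr0 => ->.
by rewrite mulr_ge0 ?IH ?ltW.
Qed.

(** The n-th signed remainder is nonnegative, and it is at most its first omitted term because the
    next one is nonnegative too. *)
Lemma expR_taylor (x : R) n : 0 <= x ->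
  `|expR (- x) - \sum_(k < n) (- x) ^+ k / k`!%:R| <= x ^+ n / n`!%:R.
Proof.
move=> x0.
have -> : expR (- x) - \sum_(k < n) (- x) ^+ k / k`!%:R = (-1) ^+ n * expRN_remainder n x.
  elim: n => [|n IH]; first by rewrite big_ord0 subr0 expr0 mul1r.
  rewrite big_ord_recr/= opprD addrA IH -[in (- x) ^+ n]mulN1r exprMn exprS; ring.
rewrite normrM normrX normrN1 expr1n mul1r ger0_norm ?expRN_remainder_ge0//.
by have := expRN_remainder_ge0 n.+1 x0; rewrite /= subr_ge0.
Qed.

End expR_taylor.

Lemma measurable_le_cst (R : realType) d (T : measurableType d) (W : T -> R) (z : R) :
  measurable_fun setT W -> measurable [set t | W t <= z].
Proof.
move=> mW; rewrite -[X in measurable X]setTI.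
have := mW measurableT `]-oo, z]%classic (measurable_itv _).
by congr measurable; congr (_ `&` _); rewrite predeqE => t /=; rewrite in_itv.
Qed.

Section moment_determinacy.
Context {R : realType}.
Variable m : nat -> R.

Definition moments_close (N : nat) (delta : R) (d : measure_display)
    (T : measurableType d) (P : probability T R) (Z : T -> R) :=
  [/\ measurable_fun setT Z, forall t, 0 <= Z t &
      forall k, (k <= N)%N -> P.-integrable setT (EFin \o (fun t => Z t ^+ k)) /\
        `|\int[P]_t (Z t ^+ k) - m k| <= delta].

Lemma moments_closeW N N' delta delta' d (T : measurableType d) (P : probability T R) Z :
  (N <= N')%N -> delta' <= delta -> moments_close N' delta' P Z -> moments_close N delta P Z.
Proof.
move=> NN' dd [mZ Z0 H]; split => // k kN.
have [i1 i2] := H k (leq_trans kN NN').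
by split => //; exact: le_trans i2 dd.
Qed.

(* Quantified over all probability spaces, so that one can compare [n X_n] with
   [n' X_n'] before a limit variable is known to exist. *)
Definition determined (g : R -> R) :=
  forall eps : R, 0 < eps -> exists N, exists2 delta, 0 < delta &
    forall d (T : measurableType d) (P : probability T R) Z
           d' (T' : measurableType d') (P' : probability T' R) Z',
    moments_close N delta P Z -> moments_close N delta P' Z' ->
    [/\ P.-integrable setT (EFin \o (g \o Z)), P'.-integrable setT (EFin \o (g \o Z')) &
        `|\int[P]_t g (Z t) - \int[P']_t g (Z' t)| <= eps].

Lemma determined_exprn i : determined (fun x => x ^+ i).
Proof.
move=> eps eps0; exists i, (eps / 2); first by rewrite divr_gt0.
move=> d T P Z d' T' P' Z' [mZ _ H] [mZ' _ H'].
have [i1 h1] := H i (leqnn i); have [i2 h2] := H' i (leqnn i).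
split => //.
rewrite (_ : _ - _ = (\int[P]_t (Z t ^+ i) - m i) - (\int[P']_t (Z' t ^+ i) - m i)).
  by rewrite (le_trans (ler_normB _ _))//; lra.
by rewrite opprB addrA subrK.
Qed.

Lemma determined_lin (a b : R) g1 g2 : determined g1 -> determined g2 ->
  determined (fun x => a * g1 x + b * g2 x).
Proof.
move=> H1 H2 eps eps0.
have e1 : 0 < eps / 2 / (`|a| + 1) by rewrite !divr_gt0// ltr_wpDl.
have e2 : 0 < eps / 2 / (`|b| + 1) by rewrite !divr_gt0// ltr_wpDl.
have [N1 [d1 d10 h1]] := H1 _ e1; have [N2 [d2 d20 h2]] := H2 _ e2.
exists (maxn N1 N2), (Num.min d1 d2); first by rewrite lt_min d10 d20.
move=> d T P Z d' T' P' Z' C C'.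
have c1 := moments_closeW (leq_maxl N1 N2) (_ : Num.min d1 d2 <= d1) C.
have c1' := moments_closeW (leq_maxl N1 N2) (_ : Num.min d1 d2 <= d1) C'.
have c2 := moments_closeW (leq_maxr N1 N2) (_ : Num.min d1 d2 <= d2) C.
have c2' := moments_closeW (leq_maxr N1 N2) (_ : Num.min d1 d2 <= d2) C'.
have m1 : Num.min d1 d2 <= d1 by rewrite ge_min lexx.
have m2 : Num.min d1 d2 <= d2 by rewrite ge_min lexx orbT.
have [i1 i1' k1] := h1 _ _ _ _ _ _ _ _ (c1 m1) (c1' m1).
have [i2 i2' k2] := h2 _ _ _ _ _ _ _ _ (c2 m2) (c2' m2).
have lin d0 (T0 : measurableType d0) (P0 : probability T0 R) Z0 :
    P0.-integrable setT (EFin \o (g1 \o Z0)) -> P0.-integrable setT (EFin \o (g2 \o Z0)) ->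
    P0.-integrable setT (EFin \o ((fun x => a * g1 x + b * g2 x) \o Z0)) /\
    \int[P0]_t (a * g1 (Z0 t) + b * g2 (Z0 t)) =
    a * \int[P0]_t g1 (Z0 t) + b * \int[P0]_t g2 (Z0 t).
  move=> j1 j2.
  have j3 := integrableZl measurableT a j1; have j4 := integrableZl measurableT b j2.
  split; first exact: (integrableD measurableT j3 j4).
  rewrite RintegralD// RintegralZl// RintegralZl//.
have [j1 ->] := lin _ _ _ _ i1 i2; have [j2 ->] := lin _ _ _ _ i1' i2'.
split => //.
rewrite (_ : _ - _ = a * (\int[P]_t g1 (Z t) - \int[P']_t g1 (Z' t)) +
  b * (\int[P]_t g2 (Z t) - \int[P']_t g2 (Z' t))); last by ring.
have half (c e : R) : 0 < e -> `|c| * (e / 2 / (`|c| + 1)) <= e / 2.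
  move=> e0; rewrite mulrCA ler_piMr ?divr_ge0 ?(ltW e0)//.
  by rewrite ler_pdivrMr ?ltr_wpDl// mul1r lerDl.
rewrite (le_trans (ler_normD _ _))// !normrM.
have := half a _ eps0; have := half b _ eps0.
have : `|a| * `|\int[P]_t g1 (Z t) - \int[P']_t g1 (Z' t)| <= `|a| * (eps / 2 / (`|a| + 1)).
  by rewrite ler_wpM2l.
have : `|b| * `|\int[P]_t g2 (Z t) - \int[P']_t g2 (Z' t)| <= `|b| * (eps / 2 / (`|b| + 1)).
  by rewrite ler_wpM2l.
lra.
Qed.

Lemma determined_ext g1 g2 : (forall x, g1 x = g2 x) -> determined g1 -> determined g2.
Proof. by move=> /funext ->. Qed.

Lemma determined_sum (a : nat -> R) (g : nat -> R -> R) n :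
  (forall k, determined (g k)) -> determined (fun x => \sum_(k < n) a k * g k x).
Proof.
move=> H; elim: n => [|n IH].
  apply: (determined_ext _ (determined_lin 0 0 (H 0%N) (H 0%N))) => x.
  by rewrite big_ord0 !mul0r addr0.
apply: (determined_ext _ (determined_lin 1 (a n) IH (H n))) => x.
by rewrite big_ord_recr/= mul1r.
Qed.

(** Closure under approximation in mean. The error need not be uniformly small: a pointwise bound f
    suffices if its mean is small for every variable with close moments, which is how Taylor
    remainders enter. *)
Lemma determined_approx (g : R -> R) : measurable_fun setT g ->
  (forall eps : R, 0 < eps -> exists2 g' : R -> R, determined g' & exists N, exists2 delta, 0 < delta &
    forall d (T : measurableType d) (P : probability T R) Z, moments_close N delta P Z ->
      exists2 f : R -> R, (forall x : R, 0 <= x -> `|g x - g' x| <= f x) &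
        P.-integrable setT (EFin \o (f \o Z)) /\ \int[P]_t f (Z t) <= eps) ->
  determined g.
Proof.
move=> mg H eps eps0.
have e4 : 0 < eps / 4 by rewrite divr_gt0.
have [g' Dg' [N1 [d1 d10 H1]]] := H _ e4.
have e2 : 0 < eps / 2 by rewrite divr_gt0.
have [N2 [d2 d20 H2]] := Dg' _ e2.
exists (maxn N1 N2), (Num.min d1 d2); first by rewrite lt_min d10 d20.
have m1 : Num.min d1 d2 <= d1 by rewrite ge_min lexx.
have m2 : Num.min d1 d2 <= d2 by rewrite ge_min lexx orbT.
move=> d T P Z d' T' P' Z' C C'.
have c1 := moments_closeW (leq_maxl N1 N2) m1 C.
have c1' := moments_closeW (leq_maxl N1 N2) m1 C'.
have c2 := moments_closeW (leq_maxr N1 N2) m2 C.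
have c2' := moments_closeW (leq_maxr N1 N2) m2 C'.
have [i2 i2' k2] := H2 _ _ _ _ _ _ _ _ c2 c2'.
have diff d0 (T0 : measurableType d0) (P0 : probability T0 R) Z0 :
    moments_close N1 d1 P0 Z0 -> P0.-integrable setT (EFin \o (g' \o Z0)) ->
    P0.-integrable setT (EFin \o (g \o Z0)) /\
    `|\int[P0]_t g (Z0 t) - \int[P0]_t g' (Z0 t)| <= eps / 4.
  move=> C0 i'; have [mZ Z00 _] := C0; have [f fg [jf kf]] := H1 _ _ _ _ C0.
  have mgZ : measurable_fun setT (g \o Z0) by exact: measurableT_comp.
  have mg'Z : measurable_fun setT (g' \o Z0).
    by apply/measurable_EFinP; exact: measurable_int i'.
  have jd : P0.-integrable setT (EFin \o (fun t => g (Z0 t) - g' (Z0 t))).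
    apply: (@le_integrable _ _ _ P0 _ measurableT _ (EFin \o (f \o Z0))) => //; last first.
      by move=> t _; rewrite /= lee_fin (le_trans (fg _ (Z00 t)))// ler_norm.
    by apply/measurable_EFinP; exact: measurable_funB.
  have jg : P0.-integrable setT (EFin \o (g \o Z0)).
    have := integrableD measurableT jd i'.
    apply: eq_integrable => // t _ /=; by rewrite -EFinD subrK.
  split => //; rewrite -RintegralB//.
  rewrite (le_trans (le_normr_Rintegral _ jd))//.
  apply: le_trans kf; apply: le_Rintegral => //.
    exact: (integrable_norm jd).
  by move=> t _; exact: fg.
have [jg h] := diff _ _ _ _ c1 i2; have [jg' h'] := diff _ _ _ _ c1' i2'.
split => //.
move: h h' k2; rewrite !ler_norml => /andP[? ?] /andP[? ?] /andP[? ?]; apply/andP; split; lra.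
Qed.

Variable h : R.
Hypothesis h_gt0 : 0 < h.
Hypothesis m_growth : forall i, (h ^+ n / n`!%:R * (m (i + n)%N + 1)) @[n --> \oo] --> (0 : R).

(** One factor exp(-h x) at a time is replaced by its Taylor polynomial. The mean error is at most
    h^n / n! times the moment of order i + n, which [m_growth] makes small. With factorially growing
    moments this works for small h, so the exponent j h is reached in j steps. *)
Lemma determined_exprn_expR j i : determined (fun x => x ^+ i * expR (- (j%:R * h * x))).
Proof.
elim: j i => [|j IH] i.
  apply: (determined_ext _ (determined_exprn i)) => x.
  by rewrite !mul0r oppr0 expR0 mulr1.
apply: determined_approx.
  apply: measurable_funM; first exact: measurable_funX.
  apply: (measurableT_comp (@measurable_expR R)).
  by apply: measurable_funN; exact: measurable_funM.
move=> eps eps0.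
have [n _ /(_ n (leqnn n)) hn] : \forall n \near \oo, h ^+ n / n`!%:R * (m (i + n)%N + 1) < eps.
  by have /cvgr_lt := m_growth i; apply.
exists (fun x => \sum_(k < n) ((- h) ^+ k / k`!%:R) * (x ^+ (i + k) * expR (- (j%:R * h * x)))).
  by apply: (determined_sum (fun k => (- h) ^+ k / k`!%:R) (g := fun k x => x ^+ (i + k) * expR (- (j%:R * h * x)))).
exists (i + n)%N, 1 => // d T P Z [mZ Z0 C].
have [iN cN] := C _ (leqnn _).
exists (fun x => h ^+ n / n`!%:R * x ^+ (i + n)).
  move=> x x0.
  have hx : 0 <= h * x by rewrite mulr_ge0// ltW.
  have -> : x ^+ i * expR (- (j.+1%:R * h * x)) -
      \sum_(k < n) ((- h) ^+ k / k`!%:R) * (x ^+ (i + k) * expR (- (j%:R * h * x))) =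
    x ^+ i * expR (- (j%:R * h * x)) *
      (expR (- (h * x)) - \sum_(k < n) (- (h * x)) ^+ k / k`!%:R).
    rewrite mulrBr; congr (_ - _).
      by rewrite -[RHS]mulrA; congr (_ * _); rewrite -expRD; congr expR; rewrite -natr1; ring.
    rewrite mulr_sumr; apply: eq_bigr => k _; rewrite exprD -[- (h * x)]mulNr [(- h * x) ^+ k]exprMn; ring.
  rewrite normrM ger0_norm ?mulr_ge0 ?exprn_ge0 ?expR_ge0//.
  apply: (@le_trans _ _ (x ^+ i * ((h * x) ^+ n / n`!%:R))).
    rewrite ler_pM ?mulr_ge0 ?exprn_ge0 ?expR_ge0//; last exact: expR_taylor.
    rewrite ler_piMr ?exprn_ge0// -expR0 ler_expR oppr_le0 !mulr_ge0//; exact: ltW.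
  by rewrite exprMn exprD le_eqVlt; apply/orP; left; apply/eqP; ring.
have jN := integrableZl measurableT (h ^+ n / n`!%:R) iN.
split => //.
rewrite (_ : \int[P]_t _ = h ^+ n / n`!%:R * \int[P]_t (Z t ^+ (i + n))); last by rewrite RintegralZl.
apply: le_trans (ltW hn); rewrite ler_wpM2l ?divr_ge0 ?exprn_ge0 ?(ltW h_gt0)//.
move: cN; rewrite ler_norml => /andP[_]; lra.
Qed.

(** A Bernstein polynomial is a binomial mean, here in q = exp(-h x); each multiplication by q in
    its recursion raises a by one. *)
Lemma determined_bernstein n (f : nat -> R) a :
  determined (fun x => expR (- (a%:R * h * x)) * binomial_mean (expR (- (h * x))) n f).
Proof.
elim: n a f => [|n IH] a f /=.
  apply: (determined_ext _ (determined_lin (f 0%N) 0 (determined_exprn_expR a 0) (determined_exprn_expR a 0))) => x.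
  by rewrite expr0 mul1r mul0r addr0 mulrC.
have D1 := determined_lin 1 (- 1) (IH a f) (IH a.+1 f).
apply: (determined_ext _ (determined_lin 1 1 D1 (IH a.+1 (fun i => f i.+1)))) => x.
have -> : expR (- (a.+1%:R * h * x)) = expR (- (a%:R * h * x)) * expR (- (h * x)).
  by rewrite -expRD -natr1; congr expR; ring.
ring.
Qed.

Lemma binomial_mean_sqr q n (s : R) :
  binomial_mean q n (fun i => (i%:R - s) ^+ 2) = n%:R * q * (1 - q) + (n%:R * q - s) ^+ 2.
Proof.
elim: n s => [|n IH] s /=; first by ring.
rewrite (_ : (fun i => (i.+1%:R - s) ^+ 2) = (fun i => (i%:R - (s - 1)) ^+ 2)); last first.
  by apply/funext => i; rewrite -natr1; congr (_ ^+ 2); ring.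
by rewrite !IH -natr1; ring.
Qed.

Lemma binomial_mean_lin q n (a b : R) (f : nat -> R) :
  binomial_mean q n (fun i => a + b * f i) = a + b * binomial_mean q n f.
Proof. by elim: n f => [//|n IH] f /=; rewrite !IH; ring. Qed.

Lemma bernstein_lipschitz (phi : R -> R) (K eps q : R) n : 0 <= K -> 0 < eps -> (0 < n)%N ->
  (forall x y, 0 <= x <= 1 -> 0 <= y <= 1 -> `|phi x - phi y| <= K * `|x - y|) ->
  0 <= q <= 1 -> K ^+ 2 / eps <= n%:R * eps ->
  `|phi q - binomial_mean q n (fun i => phi (Num.min (i%:R / n%:R) 1))| <= eps.
Proof.
move=> K0 eps0 n0 lip q01 Kn.
have nR : 0 < n%:R :> R by rewrite ltr0n.
have /andP[q0 q1] := q01.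
(* From (eps - K w / n)^2 >= 0, with w = |i - n q|, the Lipschitz bound K w / n is at most eps / 2 +
   b w^2. The binomial mean of w^2 is the variance n q (1 - q), and n is large enough for b times it
   to be at most eps / 2. *)
pose b := K ^+ 2 / (2 * eps) / n%:R ^+ 2.
have b0 : 0 <= b by rewrite !divr_ge0 ?sqr_ge0// mulr_ge0// ltW.
have pt i : `|phi (Num.min (i%:R / n%:R) 1) - phi q| <= eps / 2 + b * (i%:R - n%:R * q) ^+ 2.
  have min01 : 0 <= Num.min (i%:R / n%:R) (1 : R) <= 1.
    by rewrite le_min divr_ge0//= ler01/= ge_min lexx orbT.
  apply: (le_trans (lip _ _ min01 q01)).
  apply: (@le_trans _ _ (K * `|i%:R / n%:R - q|)).
    rewrite ler_wpM2l//; have [_|le1] := leP (i%:R / n%:R) (1 : R).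
      by [].
    by rewrite ger0_norm ?subr_ge0// ger0_norm ?lerD2r ?subr_ge0 ?(ltW le1)// (le_trans q1)// ltW.
  have -> : i%:R / n%:R - q = (i%:R - n%:R * q) / n%:R :> R.
    by field; rewrite gt_eqF.
  rewrite normrM (ger0_norm (_ : 0 <= n%:R^-1)) ?invr_ge0//.
  rewrite -(real_normK (num_real (i%:R - n%:R * q))).
  set w := `|_ - _|; rewrite -subr_ge0.
  rewrite (_ : _ - _ = (eps - K * (w / n%:R)) ^+ 2 / (2 * eps)).
    by rewrite divr_ge0 ?sqr_ge0// mulr_ge0// ltW.
  by rewrite /b; field; rewrite !gt_eqF.
have bound : b * (n%:R * q * (1 - q)) <= eps / 2.
  have qq : q * (1 - q) <= 1.
    by rewrite -[leRHS]mulr1 ler_pM// ?subr_ge0// gerBl.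
  apply: (@le_trans _ _ (b * n%:R)).
    by rewrite ler_wpM2l// -mulrA ler_piMr.
  rewrite (_ : b * n%:R = K ^+ 2 / eps / (2 * n%:R)); last by rewrite /b; field; rewrite !gt_eqF.
  by rewrite ler_pdivrMr ?mulr_gt0//; lra.
have q01' := q01.
have up : binomial_mean q n (fun i => phi (Num.min (i%:R / n%:R) 1)) <=
    binomial_mean q n (fun i => (phi q + eps / 2) + b * (i%:R - n%:R * q) ^+ 2).
  apply: le_binomial_mean => // i; have := pt i; rewrite ler_norml => /andP[_]; lra.
have lo : binomial_mean q n (fun i => (phi q - eps / 2) + (- b) * (i%:R - n%:R * q) ^+ 2) <=
    binomial_mean q n (fun i => phi (Num.min (i%:R / n%:R) 1)).
  apply: le_binomial_mean => // i; have := pt i; rewrite ler_norml => /andP[+ _]; lra.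
move: up lo; rewrite !binomial_mean_lin binomial_mean_sqr subrr expr0n addr0 => up lo.
rewrite ler_norml; apply/andP; split; lra.
Qed.

Lemma determined_lipschitz (phi : R -> R) (K : R) : 0 <= K -> measurable_fun setT phi ->
  (forall x y, 0 <= x <= 1 -> 0 <= y <= 1 -> `|phi x - phi y| <= K * `|x - y|) ->
  determined (fun x => phi (expR (- (h * x)))).
Proof.
move=> K0 mphi lip; apply: determined_approx.
  apply: (measurableT_comp mphi); apply: (measurableT_comp (@measurable_expR R)).
  by apply: measurable_funN; exact: measurable_funM.
move=> eps eps0.
pose n := (Num.bound (K ^+ 2 / eps / eps)).+1.
have Kn : K ^+ 2 / eps <= n%:R * eps.
  rewrite -ler_pdivrMr//; apply: le_trans (ltW (archi_boundP _)) _.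
    by rewrite !divr_ge0 ?sqr_ge0 ?(ltW eps0).
  by rewrite ler_nat.
exists (fun x => binomial_mean (expR (- (h * x))) n (fun i => phi (Num.min (i%:R / n%:R) 1))).
  apply: (determined_ext _ (determined_bernstein n (fun i => phi (Num.min (i%:R / n%:R) 1)) 0)) => x.
  by rewrite !mul0r oppr0 expR0 mul1r.
exists 0%N, 1 => // d T P Z [mZ Z0 _].
exists (fun=> eps).
  move=> x x0; apply: (bernstein_lipschitz K0 eps0) => //.
  by rewrite expR_ge0/= -expR0 ler_expR oppr_le0 mulr_ge0// ltW.
split; first exact: finite_measure_integrable_cst.
by rewrite /Rintegral integral_probability_cst.
Qed.

Lemma moments_law_close (x y eps : R) : x < y -> 0 < eps ->
  exists N, exists2 delta, 0 < delta &
    forall d (T : measurableType d) (P : probability T R) Z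
           d' (T' : measurableType d') (P' : probability T' R) Z',
    moments_close N delta P Z -> moments_close N delta P' Z' ->
    fine (P [set t | Z t <= x]) <= fine (P' [set t | Z' t <= y]) + eps.
Proof.
move=> xy eps0.
pose A := expR (- (h * x)); pose B := expR (- (h * y)).
have AB : 0 < A - B by rewrite subr_gt0 ltr_expR ltrN2 ltr_pM2l.
(* A ramp from 0 at B = exp(-h y) to 1 at A = exp(-h x), so that phi(exp(-h z)) lies between the
   indicators of z <= x and z <= y. The gap x < y is what makes it Lipschitz. *)
pose phi (s : R) : R := Num.min 1 (Num.max 0 ((s - B) / (A - B))).
have mphi : measurable_fun setT phi.
  apply: measurable_minr => //; apply: measurable_maxr => //.
  by apply: measurable_funM => //; exact: measurable_funB.
have phi01 s : 0 <= phi s <= 1.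
  by rewrite /phi le_min ler01 le_max lexx/= ge_min lexx.
have phiA s : A <= s -> phi s = 1.
  move=> As; rewrite /phi (min_idPl _)// le_max ler_pdivlMr// mul1r lerD2r As.
  by rewrite orbT.
have phiB s : s < B -> phi s = 0.
  move=> sB; rewrite /phi (max_idPl _) ?(min_idPr _)//.
  by rewrite pmulr_lle0 ?invr_gt0// subr_le0 ltW.
have lip s t : 0 <= s <= 1 -> 0 <= t <= 1 -> `|phi s - phi t| <= (A - B)^-1 * `|s - t|.
  move=> _ _; rewrite -[in leRHS](ger0_norm (_ : 0 <= (A - B)^-1)) ?invr_ge0 ?(ltW AB)//.
  rewrite -normrM (_ : _ * (s - t) = (s - B) / (A - B) - (t - B) / (A - B)); last by ring.
  rewrite /phi; move: ((s - B) / _) ((t - B) / _) => a b.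
  have := ler_norm (a - b); have := ler_norm (b - a); rewrite (distrC b a).
  have clamp (c : R) : [\/ c <= 0 /\ Num.min 1 (Num.max 0 c) = 0,
      (0 <= c <= 1) /\ Num.min 1 (Num.max 0 c) = c | 1 <= c /\ Num.min 1 (Num.max 0 c) = 1].
    have [c0|c0] := leP c 0; first by apply: Or31; rewrite (min_idPr ler01).
    have [c1|c1] := leP 1 c; first exact: Or33.
    by apply: Or32; split => //; apply/andP; split; exact: ltW.
  rewrite ler_norml; case: (clamp a) => -[a0 ->]; case: (clamp b) => -[b0 ->] ? ?; apply/andP; split; lra.
have iAB : 0 <= (A - B)^-1 by rewrite invr_ge0 ltW.
have [N [delta delta0 H]] := determined_lipschitz iAB mphi lip eps0.
exists N, delta => // d T P Z d' T' P' Z' C C'.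
have [i1 i2 k] := H _ _ _ _ _ _ _ _ C C'.
have [mZ _ _] := C; have [mZ' _ _] := C'.
have lo : fine (P [set t | Z t <= x]) <= \int[P]_t phi (expR (- (h * Z t))).
  have mS := measurable_le_cst x mZ.
  rewrite (_ : P _ = \int[P]_t (\1_[set t | Z t <= x] t)%:E)%E; last first.
    by rewrite integral_indic// setIT.
  apply: le_Rintegral => //.
    by apply: integrable_indic => //; rewrite (le_lt_trans (probability_le1 _ _))// ltry.
  move=> t _; rewrite indicE; case: (boolP (t \in _)); rewrite ?notin_setE ?inE/=; last first.
    by have /andP[] := phi01 (expR (- (h * Z t))).
  by move=> Ztx; rewrite phiA// ler_expR lerN2 ler_pM2l.
have up : \int[P']_t phi (expR (- (h * Z' t))) <= fine (P' [set t | Z' t <= y]).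
  have mS := measurable_le_cst y mZ'.
  rewrite (_ : P' _ = \int[P']_t (\1_[set t | Z' t <= y] t)%:E)%E; last first.
    by rewrite integral_indic// setIT.
  apply: le_Rintegral => //.
    by apply: integrable_indic => //; rewrite (le_lt_trans (probability_le1 _ _))// ltry.
  move=> t _; rewrite indicE; case: (boolP (t \in _)); rewrite ?notin_setE ?inE/=.
    by have /andP[] := phi01 (expR (- (h * Z' t))).
  by move/negP; rewrite -ltNge => yZ; rewrite phiB// ltr_expR ltrN2 ltr_pM2l.
move: k; rewrite ler_norml => /andP[_]; lra.
Qed.

End moment_determinacy.

(** * Equality of laws, and a convergence criterion *)

Lemma eq_law_rays (R : realType) d (T : measurableType d) (P : probability T R)
    d' (T' : measurableType d') (P' : probability T' R) (X : T -> R) (X' : T' -> R) :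
  measurable_fun setT X -> measurable_fun setT X' ->
  (forall x, P [set t | X t <= x] = P' [set t | X' t <= x]) ->
  forall B, measurable B -> P (X @^-1` B) = P' (X' @^-1` B).
Proof.
move=> mX mX' H B mB.
apply: (@measure_unique _ R _ (@RGenOInfty.G R)
  (fun k : nat => `](- (k%:R : R)), +oo[%classic) _ _ _ _
  (measure_function_pushforward__canonical__measure_function_Measure P mX)
  (measure_function_pushforward__canonical__measure_function_Measure P' mX')) => //.
- exact: RGenOInfty.measurableE.
- move=> _ _ [x ->] [y ->]; exists (Num.max x y).
  by rewrite predeqE => t /=; rewrite !in_itv/= !andbT gt_max; split => [[-> ->]|/andP[]].
- by move=> k; exists (- k%:R).
- rewrite predeqE => t; split => // _; exists (Num.bound `|t|) => //=.
  by rewrite in_itv/= andbT ltrNl (le_lt_trans _ (archi_boundP (normr_ge0 t)))// -normrN ler_norm.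
- move=> _ [x ->]; rewrite /= /pushforward.
  have e S (f : S -> R) : f @^-1` `]x, +oo[%classic = ~` [set s | f s <= x].
    rewrite predeqE => s /=; rewrite in_itv/= andbT ltNge; by split => /negP.
  rewrite !e; apply: etrans (probability_setC P (measurable_le_cst x mX)) _.
  by rewrite H; apply/esym/probability_setC/measurable_le_cst.
- by move=> k; rewrite (le_lt_trans (probability_le1 P _)) ?ltry//; exact: measurable_preimage.
Qed.

Lemma eq_law_integral (R : realType) d (T : measurableType d) (P : probability T R)
    d' (T' : measurableType d') (P' : probability T' R)
    d2 (U : measurableType d2) (X : T -> U) (X' : T' -> U)
    (mX : measurable_fun setT X) (mX' : measurable_fun setT X') (f : U -> \bar R) :
  measurable_fun setT f ->
  (forall B, measurable B -> P (X @^-1` B) = P' (X' @^-1` B)) ->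
  (\int[P]_t f (X t) = \int[P']_t f (X' t))%E.
Proof.
move=> mf H.
have pos (g : U -> \bar R) : measurable_fun setT g -> (forall u, 0 <= g u)%E ->
    (\int[P]_t g (X t) = \int[P']_t g (X' t))%E.
  move=> mg g0.
  have := ge0_integral_pushforward mX P measurableT mg (fun u _ => g0 u).
  rewrite preimage_setT => <-.
  have := ge0_integral_pushforward mX' P' measurableT mg (fun u _ => g0 u).
  rewrite preimage_setT => <-.
  by apply: (@eq_measure_integral _ _ _ setT
    (measure_function_pushforward__canonical__measure_function_Measure P' mX')
    (measure_function_pushforward__canonical__measure_function_Measure P mX)) => A mA _; exact: H.
rewrite [LHS]integralE [RHS]integralE; congr (_ - _)%E.
  have e V (W : V -> U) : ((fun t => f (W t))^\+ = (fun t => f^\+ (W t)))%E.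
    by apply/funext => t; rewrite !funeposE.
  by rewrite (e _ X) (e _ X'); apply: (pos (f^\+)%E) => //; exact: measurable_funepos.
have e V (W : V -> U) : ((fun t => f (W t))^\- = (fun t => f^\- (W t)))%E.
  by apply/funext => t; rewrite !funenegE.
by rewrite (e _ X) (e _ X'); apply: (pos (f^\-)%E) => //; exact: measurable_funeneg.
Qed.

(** The limit is the infimum of the eventual upper bounds. A number below it is no eventual upper
    bound, so the alternative makes every smaller number an eventual lower bound. *)
Lemma cvg_dichotomy (R : realType) (u : nat -> R) (K : R) :
  (forall n, 0 <= u n) -> (\forall n \near \oo, u n <= K) ->
  (forall x y, x < y -> (\forall n \near \oo, u n <= y) \/ (\forall n \near \oo, x <= u n)) ->
  cvgn u.
Proof.
move=> u0 uK H.
pose S := [set x | \forall n \near \oo, u n <= x].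
have S0 : S !=set0 by exists K.
have lS x : S x -> 0 <= x.
  by move=> [N _ /(_ N (leqnn N))/= ux]; exact: le_trans (u0 N) ux.
have hS : has_inf S by split => //; exists 0 => x; exact: lS.
apply/cvg_ex; exists (inf S); apply/cvgrPdist_le => e e0.
have [y Sy yl] := inf_adherent (divr_gt0 e0 (ltr0Sn R 1)) hS.
have up : \forall n \near \oo, u n <= inf S + e.
  apply: filterS Sy => n /le_trans; apply; rewrite (le_trans (ltW yl))// lerD2l.
  by rewrite ler_pdivrMr// ler_peMr ?(ltW e0)// ler1n.
have e2 : inf S - e < inf S - e / 2 by lra.
case: (H _ _ e2) => [Sl|lo].
  have : inf S <= inf S - e / 2 by apply: ge_inf => //; case: hS.
  lra.
near=> n; rewrite ler_distlC; apply/andP; split.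
  by near: n; exact: lo.
by near: n; exact: up.
Unshelve. all: by end_near. Qed.

(** * Quantile coupling *)
Section quantile_coupling.
Context {R : realType} {disp : measure_display} {T : measurableType disp}.
Variables (P : probability T R) (Z : nat -> T -> R).
Hypothesis mZ : forall n, measurable_fun setT (Z n).
Hypothesis Z_ge0 : forall n t, 0 <= Z n t.
Hypothesis Z_close : forall x y eps : R, x < y -> 0 < eps -> exists N, forall n n',
  (N <= n)%N -> (N <= n')%N ->
  fine (P [set t | Z n t <= x]) <= fine (P [set t | Z n' t <= y]) + eps.

Hypothesis Z_tight : forall v : R, v < 1 -> exists x,
  \forall n \near \oo, v <= fine (P [set t | Z n t <= x]).

Definition cdf_seq n (x : R) : R := fine (P [set t | Z n t <= x]).

Let RVZ n : {RV P >-> R} := mfun_Sub (mem_set (mZ n)).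

Let measurable_le n x : measurable [set t | Z n t <= x].
Proof. exact: measurable_le_cst. Qed.

Let cdf_seqE n x : (cdf_seq n x)%:E = P [set t | Z n t <= x].
Proof. by rewrite fineK// fin_num_measure. Qed.

Let cdf_cdf n x : cdf (RVZ n) x = (cdf_seq n x)%:E.
Proof.
rewrite cdf_seqE /cdf /distribution /pushforward.
by apply: congr1; rewrite predeqE => t /=; rewrite in_itv.
Qed.

Lemma cdf_seq_nd n x y : x <= y -> cdf_seq n x <= cdf_seq n y.
Proof.
move=> xy; rewrite -lee_fin !cdf_seqE; apply: le_measure; rewrite ?inE//.
by move=> t /= /le_trans; apply.
Qed.

Lemma cdf_seq_lt0 n x : x < 0 -> cdf_seq n x = 0.
Proof.
move=> x0; rewrite /cdf_seq (_ : [set _ | _] = set0) ?measure0//.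
by rewrite predeqE => t /=; split => // /(le_trans (Z_ge0 n t)); rewrite leNgt x0.
Qed.

Lemma cdf_seq_ge0 n x : 0 <= cdf_seq n x.
Proof. by rewrite -lee_fin cdf_seqE. Qed.

Lemma cdf_seq_le1 n x : cdf_seq n x <= 1.
Proof. by rewrite -lee_fin cdf_seqE probability_le1. Qed.

Lemma cdf_seq_exceeds n (v : R) : v < 1 -> exists x, v <= cdf_seq n x.
Proof.
move=> v1.
have F1 : cdf_seq n x @[x --> +oo%R] --> (1 : R).
  apply: fine_cvg; have := @cvg_cdfy1 _ _ _ P (RVZ n); apply: cvg_trans.
  by apply: near_eq_cvg; near=> x; rewrite cdf_cdf.
have /cvgr_gt/(_ _ v1)/filter_ex[x] := F1.
by exists x; exact: ltW.
Unshelve. all: by end_near. Qed.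

Definition quantile n (v : R) : R := inf [set x | v <= cdf_seq n x].

Lemma has_inf_quantile n (v : R) : 0 < v -> v < 1 -> has_inf [set x | v <= cdf_seq n x].
Proof.
move=> v0 v1; split; first exact: cdf_seq_exceeds.
exists 0 => x /= vx; rewrite leNgt; apply/negP => /(cdf_seq_lt0 n) F0.
by move: vx; rewrite F0 leNgt v0.
Qed.

(** Right continuity of the distribution function makes the infimum attained, whence the Galois
    connection. *)
Lemma quantile_le n (v x : R) : 0 < v -> v < 1 -> (quantile n v <= x) = (v <= cdf_seq n x).
Proof.
move=> v0 v1; have hS := has_inf_quantile n v0 v1.
apply/idP/idP => [qx|vx]; last by apply: ge_inf => //; case: hS.
apply: le_trans (cdf_seq_nd n qx).
rewrite leNgt; apply/negP => Fq.
have rc : cdf_seq n y @[y --> (quantile n v)^'+] --> cdf_seq n (quantile n v).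
  apply: fine_cvg; have := @cdf_right_continuous _ _ _ P (RVZ n) (quantile n v).
  rewrite cdf_cdf; apply: cvg_trans.
  by apply: near_eq_cvg; near=> y; rewrite cdf_cdf.
have [y [qy Fy]] : exists y, quantile n v < y /\ cdf_seq n y < v.
  near (quantile n v)^'+ => y; exists y; split; near: y; first exact: nbhs_right_gt.
  exact: cvgr_lt rc _ Fq.
have yq : 0 < y - quantile n v by rewrite subr_gt0.
have [s /= vs sy] := inf_adherent yq hS.
move: sy; rewrite -/(quantile n v) addrC subrK => /ltW/(cdf_seq_nd n).
by move=> /(le_trans vs); rewrite leNgt Fy.
Unshelve. all: by end_near. Qed.

Lemma quantile_ge0 n (v : R) : 0 < v -> v < 1 -> 0 <= quantile n v.
Proof.
move=> v0 v1; rewrite leNgt; apply/negP => q0.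
have := quantile_le n (quantile n v) v0 v1.
by rewrite lexx (cdf_seq_lt0 n q0) leNgt v0.
Qed.

(* The levels at which the limiting distribution function may be constant on an
   interval, so that the quantiles need not converge there. *)
Definition flat_levels : set R :=
  [set limn (fun n => cdf_seq n (ratr z)) | z in [set: rat]].

Lemma countable_flat_levels : countable flat_levels.
Proof. exact: sub_countable (card_image_le _ _) (countableP _). Qed.

(** If the quantiles at level v kept returning to both sides of ]x, y[, then by [Z_close] the
    distribution functions at a rational z in between would converge to v, making v a flat level. *)
Lemma quantile_cvg (v : R) : 0 < v -> v < 1 -> ~ flat_levels v -> cvgn (quantile ^~ v).
Proof.
move=> v0 v1 nv.
have freq (A : nat -> Prop) N : ~ (\forall n \near \oo, A n) -> exists2 n, (N <= n)%N & ~ A n.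
  move=> nA; apply: contrapT => H; apply: nA; exists N => // n Nn.
  by apply: contrapT => An; apply: H; exists n.
have [K KE] : exists K, \forall n \near \oo, quantile n v <= K.
  have [K KE] := Z_tight v1; exists K; apply: filterS KE => n; by rewrite quantile_le.
apply: (cvg_dichotomy _ KE) => [n|x y xy]; first exact: quantile_ge0.
apply: contrapT => /not_orP[ny nx]; apply: nv.
have [z] := rat_in_itvoo xy; rewrite in_itv/= => /andP[xz zy].
exists z => //; apply: cvg_lim => //; apply/cvgrPdist_le => e e0.
have [N1 H1] := Z_close xz e0; have [N2 H2] := Z_close zy e0.
have [n1 N1n /negP] := freq _ N1 nx; rewrite -ltNge => /ltW; rewrite quantile_le// => F1.
have [n2 N2n /negP] := freq _ N2 ny; rewrite quantile_le// -ltNge => F2.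
near=> n.
have h1 : cdf_seq n1 x <= cdf_seq n (ratr z) + e.
  by apply: H1 => //; near: n; exact: nbhs_infty_ge.
have h2 : cdf_seq n (ratr z) <= cdf_seq n2 y + e.
  by apply: H2 => //; near: n; exact: nbhs_infty_ge.
rewrite ler_distl; apply/andP; split; lra.
Unshelve. all: by end_near. Qed.

Let G : set R := `]0, 1[%classic `\` flat_levels.

(** The value 0 off a set of full measure makes the convergence hold everywhere, so the limit is
    measurable as a pointwise limit. *)
Definition coupled n (v : R) : R := if v \in G then quantile n v else 0.

Let unifP : probability (measurableTypeR R) R := uniform_prob (@ltr01 R).

Let measurable_flat_levels : measurable (flat_levels : set (measurableTypeR R)).
Proof. exact: countable_measurable countable_flat_levels. Qed.

Let GP v : G v -> [/\ 0 < v, v < 1 & ~ flat_levels v].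
Proof. by move=> [/=]; rewrite in_itv/= => /andP[]. Qed.

Lemma coupled_ge0 n v : 0 <= coupled n v.
Proof.
rewrite /coupled; case: ifPn => //; rewrite inE => /GP[v0 v1 _]; exact: quantile_ge0.
Qed.

Lemma coupled_cvg v : coupled n v @[n --> \oo] --> limn (coupled ^~ v).
Proof.
have [Gv|nGv] := boolP (v \in G).
  rewrite (_ : coupled ^~ v = quantile ^~ v); last first.
    by apply/funext => n; rewrite /coupled Gv.
  by move: Gv; rewrite inE => /GP[v0 v1 nv]; exact: quantile_cvg.
rewrite (_ : coupled ^~ v = fun=> 0); first exact: is_cvg_cst.
by apply/funext => n; rewrite /coupled (negbTE nGv).
Qed.

Let coupled_le n x : [set v | coupled n v <= x] =
  (G `&` [set v | v <= cdf_seq n x]) `|` (~` G `&` [set _ | 0 <= x]).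
Proof.
rewrite predeqE => v /=; rewrite /coupled; case: (boolP (v \in G)).
  rewrite inE => Gv; have [v0 v1 _] := GP Gv; rewrite quantile_le//.
  by split => [|[[]|[]]//]; left.
rewrite notin_setE => Gv; split => [|[[]|[]]//]; by right.
Qed.

Let measurable_coupled_le n x : measurable [set v : measurableTypeR R | coupled n v <= x].
Proof.
have mG : measurable (G : set (measurableTypeR R)).
  by apply: measurableD => //; exact: measurable_itv.
rewrite coupled_le; apply: measurableU.
  apply: measurableI => //.
  rewrite (_ : [set v | _] = `]-oo, cdf_seq n x]%classic); first exact: measurable_itv.
  by rewrite predeqE => v /=; rewrite in_itv.
apply: measurableI; first exact: measurableC.
have [x0|x0] := leP 0 x.
  by rewrite (_ : [set _ | _] = setT)// predeqE.
by rewrite (_ : [set _ | _] = set0)// predeqE.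
Qed.

Lemma measurable_coupled n : measurable_fun setT (coupled n : measurableTypeR R -> R).
Proof.
apply: (@measurability _ _ (measurableTypeR R) R setT (coupled n) (@RGenOInfty.G R)).
  exact: RGenOInfty.measurableE.
move=> _ [_ [x ->] <-].
rewrite (_ : _ `&` _ = ~` [set v | coupled n v <= x]).
  by apply: measurableC; exact: measurable_coupled_le.
rewrite predeqE => v /=; rewrite in_itv/= andbT ltNge.
by split => [[_ /negP]|/negP].
Qed.

Let unifE (A : set (measurableTypeR R)) : measurable A ->
  unifP A = lebesgue_measure (A `&` `[0, 1]%classic).
Proof.
move=> mA; rewrite /unifP/= /uniform_prob integral_uniform_pdf.
rewrite (eq_integral (fun=> 1%E)) => [|v]; last first.
  by rewrite inE => -[_ /=]; rewrite in_itv/= /uniform_pdf => ->; rewrite subr0 invr1.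
by rewrite integral_cst ?mul1e//; apply: measurableI => //; exact: measurable_itv.
Qed.

(** Within [0, 1] and up to the null set of flat levels and 1, the event [coupled n v <= x] is v <=
    F, with F the distribution function at x. It is squeezed between ]0, F[ and [0, F] modulo that
    null set. *)
Lemma coupled_law n (B : set R) : measurable B ->
  unifP (coupled n @^-1` B) = P (Z n @^-1` B).
Proof.
apply: eq_law_rays (measurable_coupled n) (mZ n) _ B => x.
rewrite -cdf_seqE; apply: etrans (unifE (measurable_coupled_le n x)) _.
have mA : measurable ([set v : measurableTypeR R | coupled n v <= x] `&` `[0, 1]%classic).
  by apply: measurableI; [exact: measurable_coupled_le|exact: measurable_itv].
set F := cdf_seq n x.
have F0 : 0 <= F by exact: cdf_seq_ge0.
have F1 : F <= 1 by exact: cdf_seq_le1.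
have c0 : lebesgue_measure (flat_levels `|` [set 1]) = 0%E.
  apply/eqP; rewrite eq_le measure_ge0 andbT.
  apply: (le_trans (measureU2 _ _ _)) => //.
  have f0 := countable_lebesgue_measure0 countable_flat_levels.
  by rewrite [X in (X + _)%E](_ : _ = 0%E)// [X in (_ + X)%E](_ : _ = 0%E) ?adde0//; exact: lebesgue_measure_set1.
have mC : measurable (flat_levels `|` [set 1] : set (measurableTypeR R)).
  by apply: measurableU => //.
apply/eqP; rewrite eq_le; apply/andP; split.
  apply: (@le_trans _ _ (lebesgue_measure (`[0, F]%classic `|` (flat_levels `|` [set 1])))).
    apply: le_measure; rewrite ?inE//.
      by apply: measurableU => //; exact: measurable_itv.
    move=> v [/= qv]; rewrite in_itv/= => /andP[v0 v1].
    have [Gv|nGv] := pselect (G v).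
      left; rewrite /= in_itv/= v0/=; have [v0' v1' _] := GP Gv.
      by move: qv; rewrite /coupled mem_set// quantile_le.
    have [v00|v00] := eqVneq v 0; first by left; rewrite /= in_itv/= v00 lexx.
    right; have [v10|v10] := eqVneq v 1; first by right.
    left; apply: contrapT => nf; apply: nGv; split => //.
    by rewrite /= in_itv/= !lt_neqAle v0 v1 v10 eq_sym v00.
  have m0F : measurable (`[0, F]%classic : set (measurableTypeR R)) by exact: measurable_itv.
  have := measureU2 (@lebesgue_measure R) m0F mC; move=> /le_trans; apply.
  rewrite [X in (_ + X)%E](_ : _ = 0%E)// adde0 [leLHS](_ : _ = F%:E)//.
  apply: etrans (lebesgue_measure_itv _) _; rewrite /= lte_fin.
  by have [_|F0'] := ltP 0 F; [rewrite sube0|congr EFin; apply: le_anti; rewrite F0].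
apply: (@le_trans _ _ (lebesgue_measure (`]0, F[%classic `\` (flat_levels `|` [set 1])))).
  have moF : lebesgue_measure (`]0, F[%classic : set R) = F%:E.
    apply: etrans (lebesgue_measure_itv _) _; rewrite /= lte_fin.
    by have [_|F0'] := ltP 0 F; [rewrite sube0|congr EFin; apply: le_anti; rewrite F0].
  have m0F : measurable (`]0, F[%classic : set (measurableTypeR R)) by exact: measurable_itv.
  rewrite [leRHS](_ : _ = F%:E)//.
  apply: etrans (measureD m0F mC _) _; first by rewrite [X in (X < _)%E](_ : _ = F%:E)// ltry.
  rewrite [X in (_ - X)%E](_ : _ = 0%E) ?sube0//.
  apply/eqP; rewrite eq_le measure_ge0 andbT -[X in (_ <= X)%E]c0.
  by apply: le_measure; rewrite ?inE//; first [exact: measurableI|exact: subIsetr].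
apply: le_measure; rewrite ?inE//.
  by apply: measurableD => //; exact: measurable_itv.
move=> v [/=]; rewrite in_itv/= => /andP[v0 vF] nv.
have v1 : v < 1 by exact: lt_le_trans vF F1.
split; last by rewrite /= in_itv/= !ltW.
have Gv : G v.
  split; first by rewrite /= in_itv/= v0.
  by move=> fv; apply: nv; left.
by rewrite /= /coupled mem_set// quantile_le// ltW.
Qed.

Lemma skorokhod_coupling : exists (q : nat -> R -> R) (Y : R -> R),
  [/\ forall n, measurable_fun setT (q n), measurable_fun setT Y, forall n v, 0 <= q n v,
    forall v, q n v @[n --> \oo] --> Y v &
    forall n (B : set R), measurable B ->
      uniform_prob (@ltr01 R) (q n @^-1` B) = P (Z n @^-1` B)].
Proof.
exists coupled, (fun v => limn (coupled ^~ v)); split.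
- exact: measurable_coupled.
- apply: (@measurable_fun_cvg _ _ _ _ coupled) => [n|v _]; first exact: measurable_coupled.
  exact: coupled_cvg.
- exact: coupled_ge0.
- exact: coupled_cvg.
- exact: coupled_law.
Qed.

End quantile_coupling.

(** * From the coupling to convergence in distribution and of moments *)

Section coupling.
Context {R : realType} {disp disp' : measure_display}.
Context {T : measurableType disp} {S : measurableType disp'}.
Variables (P : probability T R) (Q : probability S R).
Variables (Z : nat -> T -> R) (q : nat -> S -> R) (psi : nat -> R -> R) (W : S -> R).
Hypothesis mZ : forall n, measurable_fun setT (Z n).
Hypothesis mq : forall n, measurable_fun setT (q n).
Hypothesis mpsi : forall n, measurable_fun setT (psi n).
Hypothesis mW : measurable_fun setT W.
Hypothesis law : forall n (B : set R), measurable B -> Q (q n @^-1` B) = P (Z n @^-1` B).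
Hypothesis psi_cvg : forall s, psi n (q n s) @[n --> \oo] --> W s.

(** Equality of laws moves the integrals to Q, where dominated convergence applies. The functions
    psi n let one coupling serve twice: they are the identity for n X_n and the scaled measure of a
    lune for (vii). *)
Lemma coupling_integral_cvg (f : R -> R) : continuous f ->
  (exists M, forall x, `|f x| <= M) ->
  (\int[P]_w (f (psi n (Z n w)))%:E @[n --> \oo] --> \int[Q]_s (f (W s))%:E)%E.
Proof.
move=> cf [M fM].
have mf : measurable_fun setT f by exact: continuous_measurable_fun.
rewrite (_ : (fun n => \int[P]_w _)%E = (fun n => \int[Q]_s (f (psi n (q n s)))%:E)%E); last first.
  apply/funext => n; apply: (eq_law_integral (mZ n) (mq n) (f := fun x => (f (psi n x))%:E)).
    by apply/measurable_EFinP; apply: measurableT_comp => //; exact: mpsi.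
  by move=> B mB; rewrite law.
have [] := @dominated_convergence _ _ _ Q setT measurableT
  (fun n s => (f (psi n (q n s)))%:E) (fun s => (f (W s))%:E) (cst M%:E).
- move=> n; apply/measurable_EFinP; apply: measurableT_comp => //.
  exact: (measurableT_comp (mpsi n) (mq n)).
- by apply/measurable_EFinP; exact: measurableT_comp.
- apply: aeW => s _; apply: cvg_EFin; first by near=> n.
  by apply: (cvg_comp _ _ (@psi_cvg s)); exact: cf.
- exact: finite_measure_integrable_cst.
- by apply: aeW => s n _; rewrite lee_fin.
by move=> _ _.
Unshelve. all: by end_near. Qed.

Lemma coupling_cvg_in_distribution :
  cvg_in_distribution P (fun n w => psi n (Z n w)) (pushforward Q W).
Proof.
split => [n|f cf bf]; first exact: (measurableT_comp (mpsi n) (mZ n)).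
have mf : measurable_fun setT f by exact: continuous_measurable_fun.
have ifW : Q.-integrable setT ((EFin \o f) \o W).
  have [M fM] := bf.
  by apply: (@bounded_integrable _ _ _ Q (f \o W) M) => [|s]; [exact: measurableT_comp|exact: fM].
have := integral_pushforward mW (proj2 (measurable_EFinP _ _) mf) ifW measurableT.
rewrite preimage_setT => ->; exact: coupling_integral_cvg.
Qed.

End coupling.

Lemma cvg_minr_cst (R : realType) (u : nat -> R) (l c : R) :
  u n @[n --> \oo] --> l -> Num.min (u n) c @[n --> \oo] --> Num.min l c.
Proof.
move=> /cvgrPdist_le ul; apply/cvgrPdist_le => e e0; apply: filterS (ul _ e0) => n.
apply: le_trans; have := ler_norm (l - u n); have := ler_norm (u n - l); rewrite distrC.
move: (u n) => b; rewrite ler_norml.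
by case: (leP l c) => ?; case: (leP b c) => ? ? ?; apply/andP; split; lra.
Qed.

Section moment_convergence.
Context {R : realType} {disp : measure_display} {T : measurableType disp}.
Variables (P : probability T R) (Z : nat -> T -> R) (M : nat -> nat -> R) (m : nat -> R) (h : R).
Hypothesis mZ : forall n, measurable_fun setT (Z n).
Hypothesis Z_ge0 : forall n t, 0 <= Z n t.
Hypothesis Z_moment : forall n k, (\int[P]_t (Z n t ^+ k)%:E = (M n k)%:E)%E.
Hypothesis M_cvg : forall k, M n k @[n --> \oo] --> m k.
Hypothesis h_gt0 : 0 < h.
Hypothesis m_growth : forall i, (h ^+ n / n`!%:R * (m (i + n)%N + 1)) @[n --> \oo] --> (0 : R).

Let mX n k : measurable_fun setT (fun t => Z n t ^+ k).
Proof. exact: measurable_funX. Qed.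

Lemma integrable_moment n k : P.-integrable setT (EFin \o (fun t => Z n t ^+ k)).
Proof.
apply/integrableP; split; first exact/measurable_EFinP.
rewrite (eq_integral (fun t => (Z n t ^+ k)%:E)) ?Z_moment ?ltry// => t _ /=.
by rewrite ger0_norm ?exprn_ge0.
Qed.

Lemma moments_close_near N (delta : R) : 0 < delta ->
  \forall n \near \oo, moments_close m N delta P (Z n).
Proof.
move=> d0.
have : \forall n \near \oo, forall k, (k <= N)%N -> `|M n k - m k| <= delta.
  elim: N => [|N IH].
    move/cvgrPdist_le: (@M_cvg 0%N) => /(_ delta d0); apply: filterS => n H k.
    by rewrite leqn0 => /eqP ->; rewrite distrC.
  move/cvgrPdist_le: (@M_cvg N.+1) => /(_ delta d0); move: IH; apply: filterS2 => n H1 H2 k.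
  by rewrite leq_eqVlt => /predU1P[->|]; [rewrite distrC|exact: H1].
apply: filterS => n H; split => // k kN; split; first exact: integrable_moment.
by rewrite /Rintegral Z_moment; exact: H.
Qed.

Lemma law_close_near (x y eps : R) : x < y -> 0 < eps -> exists N, forall n n',
  (N <= n)%N -> (N <= n')%N ->
  fine (P [set t | Z n t <= x]) <= fine (P [set t | Z n' t <= y]) + eps.
Proof.
move=> xy e0; have [N [delta d0 H]] := moments_law_close h_gt0 m_growth xy e0.
have [N' _ H'] := moments_close_near N d0.
by exists N' => n n' nN n'N; apply: H; exact: H'.
Qed.

Lemma law_tight (v : R) : v < 1 -> exists x, \forall n \near \oo, v <= fine (P [set t | Z n t <= x]).
Proof.
(* Markov's inequality: eventually E[Z_n] <= |m 1| + 1, so that P(Z_n > x) <= 1 - v. *)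
move=> v1; pose x := (`|m 1%N| + 1) / (1 - v).
have x0 : 0 < x by rewrite divr_gt0 ?subr_gt0// ltr_wpDl.
exists x; move/cvgrPdist_le: (@M_cvg 1%N) => /(_ 1 ltr01); apply: filterS => n.
rewrite ler_distlC => /andP[_ M1].
have mS := measurable_le_cst x (mZ n).
have i1 := integrable_moment n 1%N.
rewrite (_ : P _ = \int[P]_t (\1_[set t | Z n t <= x] t)%:E)%E; last first.
  by rewrite integral_indic// setIT.
apply: (@le_trans _ _ (\int[P]_t (1 - x^-1 * Z n t ^+ 1))).
  rewrite RintegralB//; last 2 first.
  - exact: finite_measure_integrable_cst.
  - exact: (integrableZl measurableT x^-1 i1).
  rewrite RintegralZl// (_ : \int[P]_t (Z n t ^+ 1) = M n 1%N); last by rewrite /Rintegral Z_moment.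
  rewrite [X in _ <= X - _](_ : _ = 1); last by rewrite /Rintegral (integral_probability_cst P 1).
  suff : x^-1 * M n 1%N <= 1 - v by lra.
  rewrite mulrC ler_pdivrMr//.
  have -> : (1 - v) * x = `|m 1%N| + 1 by rewrite /x; field; rewrite gt_eqF// subr_gt0.
  by rewrite (le_trans M1)// lerD2r ler_norm.
apply: le_Rintegral => //.
- have j1 := integrableZl measurableT x^-1 i1.
  have j0 : P.-integrable setT (EFin \o cst 1) by exact: finite_measure_integrable_cst.
  exact: (integrableB measurableT j0 j1).
- by apply: integrable_indic => //; rewrite (le_lt_trans (probability_le1 _ _))// ltry.
move=> t _; rewrite indicE expr1; case: (boolP (t \in _)); rewrite ?notin_setE ?inE/=.
  by move=> _; rewrite gerBl mulr_ge0// invr_ge0 ltW.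
by move/negP; rewrite -ltNge => xZ; rewrite subr_le0 mulrC ler_pdivlMr// mul1r ltW.
Qed.

(** Uniform integrability from the moments of order 2k: truncated powers converge by domination,
    truncation at K costs at most m_(2k) / K in the limit, and monotone convergence removes the
    truncation. *)
Lemma integral_limit_moment disp' (S : measurableType disp') (Q : probability S R)
    (q : nat -> S -> R) (Y : S -> R) :
  (forall n, measurable_fun setT (q n)) -> measurable_fun setT Y -> (forall n s, 0 <= q n s) ->
  (forall s, q n s @[n --> \oo] --> Y s) ->
  (forall n (B : set R), measurable B -> Q (q n @^-1` B) = P (Z n @^-1` B)) ->
  forall k, (\int[Q]_s (Y s ^+ k)%:E = (m k)%:E)%E.
Proof.
move=> mq mY q0 qY law k.
have Y0 s : 0 <= Y s by apply: ler_cvg_to (cvg_cst 0) (qY s) _; near=> n.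
have mqk n j : measurable_fun setT (fun s => q n s ^+ j) by exact: measurable_funX.
have mYk : measurable_fun setT (fun s => Y s ^+ k) by exact: measurable_funX.
have qM n j : (\int[Q]_s (q n s ^+ j)%:E = (M n j)%:E)%E.
  rewrite -Z_moment; apply: (eq_law_integral (mq n) (mZ n) (f := fun x => (x ^+ j)%:E)).
    by apply/measurable_EFinP; exact: measurable_funX.
  exact: law.
have iq n j : Q.-integrable setT (EFin \o (fun s => q n s ^+ j)).
  apply/integrableP; split; first exact/measurable_EFinP.
  rewrite (eq_integral (fun t => (q n t ^+ j)%:E)) ?qM ?ltry// => t _ /=.
  by rewrite ger0_norm ?exprn_ge0.
pose tr (f : S -> R) (K : nat) s := Num.min (f s) K%:R.
have mtr f K : measurable_fun setT f -> measurable_fun setT (tr f K).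
  by move=> mf; exact: measurable_minr.
have itr (f : S -> R) K : measurable_fun setT f -> (forall s, 0 <= f s) ->
    Q.-integrable setT (EFin \o (tr f K)).
  move=> mf f0; apply: (@bounded_integrable _ _ _ Q (tr f K) K%:R) => [|s]; first exact: mtr.
  by rewrite ger0_norm ?le_min ?f0//= /tr ge_min lexx orbT.
have trlim K : \int[Q]_s tr (fun s => q n s ^+ k) K s @[n --> \oo] --> \int[Q]_s tr (fun s => Y s ^+ k) K s.
  apply: fine_cvg; rewrite fineK; last first.
    by apply: integrable_fin_num => //; apply: itr => // s; rewrite exprn_ge0.
  have [] := @dominated_convergence _ _ _ Q setT measurableT
    (fun n s => (tr (fun s => q n s ^+ k) K s)%:E) (fun s => (tr (fun s => Y s ^+ k) K s)%:E) (cst K%:R%:E).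
  - by move=> n; apply/measurable_EFinP; exact: mtr.
  - by apply/measurable_EFinP; exact: mtr.
  - apply: aeW => s _; apply: cvg_EFin; first by near=> n.
    by apply: cvg_minr_cst; exact: (cvg_comp _ _ (qY s) (@exprn_continuous R k (Y s))).
  - exact: finite_measure_integrable_cst.
  - apply: aeW => s n _; rewrite lee_fin ger0_norm ?le_min ?exprn_ge0 ?ler0n//.
    by rewrite /tr ge_min lexx orbT.
  by move=> _ _.
have tr_hi K : \int[Q]_s tr (fun s => Y s ^+ k) K s <= m k.
  apply: ler_cvg_to (trlim K) (@M_cvg k) _; near=> n.
  rewrite (_ : M n k = \int[Q]_s (q n s ^+ k)); last by rewrite /Rintegral qM.
  apply: le_Rintegral => //.
    by apply: itr => // s; rewrite exprn_ge0.
  by move=> s _; rewrite /tr ge_min lexx.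
(* From x - x^2 / c <= min(x, c) for x >= 0 and c > 0; the index [K.+1] keeps c positive. *)
have tr_lo K : m k - K.+1%:R^-1 * m (2 * k)%N <= \int[Q]_s tr (fun s => Y s ^+ k) K.+1 s.
  have lim1 : M n k - K.+1%:R^-1 * M n (2 * k)%N @[n --> \oo] --> m k - K.+1%:R^-1 * m (2 * k)%N.
    by apply: cvgB => //; apply: cvgM => //; exact: cvg_cst.
  apply: ler_cvg_to lim1 (trlim K.+1) _; near=> n.
  rewrite (_ : M n k - _ = \int[Q]_s (q n s ^+ k - K.+1%:R^-1 * q n s ^+ (2 * k))); last first.
    rewrite RintegralB//; last exact: (integrableZl measurableT K.+1%:R^-1 (iq n (2 * k)%N)).
    by rewrite RintegralZl// /Rintegral !qM.
  apply: le_Rintegral => //.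
  - have j1 := integrableZl measurableT K.+1%:R^-1 (iq n (2 * k)%N).
    exact: (integrableB measurableT (iq n k) j1).
  - by apply: itr => // s; rewrite exprn_ge0.
  move=> s _; have x0 : 0 <= q n s ^+ k by rewrite exprn_ge0.
  rewrite /tr mulnC exprM; move: (q n s ^+ k) x0 => x x0; rewrite le_min.
  have c0 : 0 < K.+1%:R :> R by rewrite ltr0n.
  apply/andP; split; first by rewrite gerBl mulr_ge0 ?sqr_ge0// invr_ge0 ltW.
  move: (K.+1%:R : R) c0 => c c0.
  have : 0 <= c^-1 * (x - c) ^+ 2 by rewrite mulr_ge0 ?sqr_ge0// invr_ge0 ltW.
  rewrite (_ : c^-1 * (x - c) ^+ 2 = c^-1 * x ^+ 2 - 2 * x + c); last by field; rewrite gt_eqF.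
  by move: (c^-1 * _) => w; lra.
have tr_lim : (\int[Q]_s (tr (fun s => Y s ^+ k) K s)%:E @[K --> \oo] --> \int[Q]_s (Y s ^+ k)%:E)%E.
  have := @cvg_monotone_convergence _ _ _ Q setT measurableT
    (fun K s => (tr (fun s => Y s ^+ k) K s)%:E).
  rewrite (eq_integral (fun s => (Y s ^+ k)%:E)) => [|s _]; last first.
    apply: lim_near_cst => //.
    exists (Num.bound (Y s ^+ k)) => // K /= bK; rewrite /tr (min_idPl _)//.
    rewrite (le_trans (ltW (archi_boundP _)))// ?ler_nat// exprn_ge0//.
  apply.
  - by move=> K; apply/measurable_EFinP; exact: mtr.
  - by move=> K s _; rewrite lee_fin le_min exprn_ge0/=.
  - move=> s _ i j ij; rewrite lee_fin /tr le_min ge_min lexx/= ge_min.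
    by rewrite ler_nat ij orbT.
rewrite -(cvg_shiftS (fun K => \int[Q]_s _)%E) /= in tr_lim.
apply: cvg_unique tr_lim _ => //.
rewrite (_ : (fun K => \int[Q]_s _)%E =
    (fun K => (\int[Q]_s tr (fun s => Y s ^+ k) K.+1 s)%:E)); last first.
  apply/funext => K; rewrite fineK//.
  by apply: integrable_fin_num => //; apply: itr => // s; rewrite exprn_ge0.
apply: cvg_EFin; first by near=> K.
apply: squeeze_cvgr (_ : m k - K.+1%:R^-1 * m (2 * k)%N @[K --> \oo] --> m k) (cvg_cst (m k)).
  by near=> K; rewrite tr_lo tr_hi.
rewrite -[X in _ --> X]subr0 -[X in _ --> _ - X](mul0r (m (2 * k)%N)).
apply: cvgB; first exact: cvg_cst.
by apply: cvgM; [exact: cvg_harmonic|exact: cvg_cst].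
Unshelve. all: by end_near. Qed.

Lemma moment_coupling : exists (q : nat -> R -> R) (Y : R -> R),
  [/\ forall n, measurable_fun setT (q n), measurable_fun setT Y,
    (forall n v, 0 <= q n v) /\ (forall v, q n v @[n --> \oo] --> Y v),
    forall n (B : set R), measurable B ->
      uniform_prob (@ltr01 R) (q n @^-1` B) = P (Z n @^-1` B) &
    forall k, (\int[uniform_prob (@ltr01 R)]_v (Y v ^+ k)%:E = (m k)%:E)%E].
Proof.
have [q [Y [mq mY q0 qY law]]] := skorokhod_coupling mZ Z_ge0 law_close_near law_tight.
exists q, Y; split => //.
exact: (@integral_limit_moment _ _ (uniform_prob (@ltr01 R)) q Y).
Qed.

End moment_convergence.

(** * The symmetric difference of two balls *)
Section lune.
Context {R : realType}.
Local Notation leb := (@lebesgue_measure R).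

Lemma lebesgue_rVS_integral n (A : set 'rV[R]_n.+1) : measurable A ->
  lebesgue_rV n.+1 A = (\int[lebesgue_rV n]_v leb [set t | A (rV_cons (t, v))])%E.
Proof.
move=> mA; rewrite lebesgue_rVS_E.
have mcA : measurable (@rV_cons R n @^-1` A).
  by apply: measurable_preimage => //; exact: measurable_rV_cons.
rewrite (product_measure_unique (m' := (leb \x^ lebesgue_rV n)%E) _ mcA); last first.
  by move=> B C mB mC; exact: product_measure2E.
rewrite /product_measure2; apply: eq_integral => v _ /=; congr (leb _).
by apply/seteqP; split => t; rewrite /ysection/= inE.
Qed.

Lemma measurable_lebesgue_section n (A : set 'rV[R]_n.+1) : measurable A ->
  measurable_fun setT (fun v : 'rV[R]_n => leb [set t | A (rV_cons (t, v))]).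
Proof.
move=> mA.
have mcA : measurable (@rV_cons R n @^-1` A).
  by apply: measurable_preimage => //; exact: measurable_rV_cons.
have := measurable_fun_ysection leb mcA; apply: eq_measurable_fun => v _ /=; congr (leb _).
by apply/seteqP; split => t; rewrite /ysection/= inE.
Qed.

Lemma integral_scaled_indic d (T : measurableType d) (mu : {measure set T -> \bar R})
    (a : R) (B : set T) : 0 <= a -> measurable B ->
  (\int[mu]_v (a * \1_B v)%:E = a%:E * mu B)%E.
Proof.
move=> a0 mB.
have mi : measurable_fun setT (fun v => (\1_B v : R)%:E).
  by apply/measurable_EFinP; exact: measurable_indic.
rewrite -[in RHS](setIT B) -integral_indic// -ge0_integralZl//.
Qed.

Lemma rV_consB n (p q : R * 'rV[R]_n) : rV_cons p - rV_cons q = rV_cons (p.1 - q.1, p.2 - q.2).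
Proof. by apply/rowP => i; rewrite !mxE; case: unlift => [j|] //=; rewrite !mxE. Qed.

Lemma enorm_axis n (x : R) : 0 <= x -> enorm (rV_cons (x, 0 : 'rV[R]_n)) = x.
Proof.
move=> x0; apply/eqP; rewrite -(@eqrXn2 _ 2) ?enorm_ge0//.
by rewrite enorm_cons_sqr/= enorm0 expr0n addr0.
Qed.

Lemma eball_cons n (x t r : R) (v : 'rV[R]_n) : 0 < r ->
  eball (rV_cons (x, 0)) r (rV_cons (t, v)) <-> (t - x) ^+ 2 < r ^+ 2 - enorm v ^+ 2.
Proof.
move=> r0; rewrite /eball/= rV_consB subr0 ltrBrDr.
by rewrite -(@ltr_pXn2r _ 2) ?nnegrE ?enorm_ge0 ?(ltW r0)// enorm_cons_sqr.
Qed.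

Variables (n : nat) (r : R).
Hypothesis r_gt0 : 0 < r.

(** Here n is d - 1. The centre is put on the first axis, so that slicing along that axis reduces
    everything to intervals. *)
Definition lune_measure (x : R) : R :=
  fine (lebesgue_rV n.+1 (eball (rV_cons (x, 0)) r `+` eball 0 r)).

Lemma measurable_lune (c : 'rV[R]_n.+1) : measurable (eball c r `+` eball 0 r).
Proof. by apply: measurableU; apply: measurableD; exact: measurable_eball. Qed.

Lemma lebesgue_lune_lty (c : 'rV[R]_n.+1) :
  (lebesgue_rV n.+1 (eball c r `+` eball 0 r) < +oo)%E.
Proof.
apply: (@le_lt_trans _ _ (lebesgue_rV n.+1 (eball c r `|` eball 0 r))).
  apply: le_measure; rewrite ?inE.
  - exact: measurable_lune.
  - by apply: measurableU; exact: measurable_eball.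
  - by move=> v [[? _]|[? _]]; [left|right].
apply: (le_lt_trans (measureU2 _ (measurable_eball _ _) (measurable_eball _ _))).
by rewrite [X in (X + _)%E](lebesgue_rV_eballE c r_gt0) [X in (_ + X)%E](lebesgue_rV_eballE 0 r_gt0) ltry.
Qed.

(** The reflection exchanging c with the point of the first axis at the same distance fixes the
    origin and preserves the measure. *)
Lemma lune_measureE (c : 'rV[R]_n.+1) :
  lebesgue_rV n.+1 (eball c r `+` eball 0 r) = (lune_measure (enorm c))%:E.
Proof.
pose e := rV_cons (enorm c, 0 : 'rV[R]_n).
rewrite /lune_measure fineK; last by rewrite ge0_fin_numE// lebesgue_lune_lty.
rewrite -(lebesgue_rV_reflect (c - e) (measurable_lune _)); congr (lebesgue_rV _ _).
have ec : reflect (c - e) 0 c = e by rewrite reflect_swap// enorm_axis// enorm_ge0.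
have r0 : reflect (c - e) 0 0 = 0.
  by have := reflect0Z (c - e) 0 0; rewrite !scale0r.
have H b v : eball (reflect (c - e) 0 b) r (reflect (c - e) 0 v) = eball b r v.
  by rewrite /eball/= -reflect0B enorm_reflect0.
have ce : reflect (c - e) 0 e = c by rewrite -{2}ec reflect0K.
have H1 : reflect (c - e) 0 @^-1` eball c r = eball e r.
  by apply/funext => v; rewrite /preimage/= -[RHS]H ce.
have H0 : reflect (c - e) 0 @^-1` eball 0 r = eball 0 r.
  by apply/funext => v; rewrite /preimage/= -[RHS]H r0.
have D (A B : set 'rV[R]_n.+1) : reflect (c - e) 0 @^-1` (A `\` B) =
    (reflect (c - e) 0 @^-1` A) `\` (reflect (c - e) 0 @^-1` B) by [].
by rewrite /setY preimage_setU !D H1 H0.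
Qed.

Lemma measurable_lune_measure : measurable_fun setT lune_measure.
Proof.
pose A : set (R * 'rV[R]_n.+1) := [set p | (eball (rV_cons (p.1, 0)) r `+` eball 0 r) p.2].
have mA : measurable A.
  have mE (f : R * 'rV[R]_n.+1 -> 'rV[R]_n.+1) : measurable_fun setT f ->
      measurable [set p | eball (f p) r p.2].
    move=> mf; have := measurable_fun_enorm (measurable_fun_subv (@measurable_snd _ _ R 'rV[R]_n.+1) mf).
    move=> /(_ measurableT `]-oo, r[%classic (measurable_itv _)); rewrite setTI.
    by congr measurable; rewrite predeqE => p /=; rewrite in_itv.
  have m1 := mE (fun p => rV_cons (p.1, 0)); have m2 := mE (fun=> 0).
  apply: measurableU; apply: measurableD.
  - apply: m1; apply: (measurableT_comp (@measurable_rV_cons _ _)).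
    by apply/measurable_fun_pairP; split => /=; [exact: measurable_fst|exact: measurable_cst].
  - by apply: m2.
  - by apply: m2.
  - apply: m1; apply: (measurableT_comp (@measurable_rV_cons _ _)).
    by apply/measurable_fun_pairP; split => /=; [exact: measurable_fst|exact: measurable_cst].
have := measurable_fun_xsection (lebesgue_rV n.+1) mA.
move=> h; have := measurableT_comp (fine_measurable measurableT) h.
apply: eq_measurable_fun => x _ /=; rewrite /lune_measure; congr (fine (lebesgue_rV _ _)).
by rewrite predeqE => v; rewrite /xsection/= inE.
Qed.

Lemma sqr_lt_itv (y s : R) : 0 <= s -> (y ^+ 2 < s ^+ 2) = (- s < y < s).
Proof.
move=> s0; rewrite -ltr_norml -(real_normK (num_real y)) ltr_pXn2r ?nnegrE//.
Qed.

Let s (v : 'rV[R]_n) : R := Num.sqrt (r ^+ 2 - enorm v ^+ 2).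

Let s_sqr v : enorm v < r -> s v ^+ 2 = r ^+ 2 - enorm v ^+ 2.
Proof.
move=> vr; apply: sqr_sqrtr.
by rewrite subr_ge0 ler_pXn2r ?nnegrE ?enorm_ge0 ?(ltW vr) ?(ltW r_gt0).
Qed.

Let section_cons (x t : R) (v : 'rV[R]_n) : enorm v < r ->
  eball (rV_cons (x, 0)) r (rV_cons (t, v)) <-> - s v < t - x < s v.
Proof.
by move=> vr; rewrite eball_cons// -sqr_lt_itv ?sqrtr_ge0// s_sqr.
Qed.

Let origin_cons : (0 : 'rV[R]_n.+1) = rV_cons (0, 0).
Proof. by apply/rowP => i; rewrite !mxE; case: unlift => [j|] //=; rewrite !mxE. Qed.

Let leb_itv (b1 b2 : bool) (x y : R) : x <= y ->
  leb [set` Interval (BSide b1 x) (BSide b2 y)] = (y - x)%:E.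
Proof.
move=> xy; apply: etrans (lebesgue_measure_itv _) _; rewrite /= lte_fin.
by move: xy; rewrite le_eqVlt => /predU1P[->|->]; rewrite ?ltxx ?subrr.
Qed.

(** The line over v meets the two balls in chords of equal length, shifted by x. Their symmetric
    difference has length at most 2x, and it is empty unless |v| < r. *)
Lemma lune_measure_le (x : R) : 0 <= x ->
  lune_measure x <= 2 * x * (r ^+ n * ball_volume n).
Proof.
move=> x0; rewrite -lee_fin /lune_measure fineK; last first.
  by rewrite ge0_fin_numE// lebesgue_lune_lty.
rewrite lebesgue_rVS_integral; last exact: measurable_lune.
have mB : measurable (eball (0 : 'rV[R]_n) r) by exact: measurable_eball.
have x20 : 0 <= 2 * x by rewrite mulr_ge0.
rewrite EFinM -(lebesgue_rV_eballE 0 r_gt0) -integral_scaled_indic//.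
apply: ge0_le_integral => //.
- by apply: measurable_lebesgue_section; exact: measurable_lune.
- by apply/measurable_EFinP; apply: measurable_funM => //; exact: measurable_indic.
move=> v _; rewrite indicE origin_cons.
case: (boolP (v \in _)); rewrite ?notin_setE ?inE => vr'; last first.
  have vr : ~ enorm v < r by move: vr'; rewrite /eball/= subr0.
  rewrite [X in (leb X <= _)%E](_ : _ = set0) ?measure0 ?mulr0//.
  rewrite predeqE => t; split => //; rewrite /setY /setU /setD /= !(eball_cons _ _ _ r_gt0).
  have : r ^+ 2 - enorm v ^+ 2 <= 0.
    by rewrite subr_le0 ler_pXn2r ?nnegrE ?enorm_ge0 ?(ltW r_gt0)// leNgt; exact/negP.
  have := sqr_ge0 (t - x); have := sqr_ge0 (t - 0).
  by move=> ? ? ? [] [] ? _; lra.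
have vr : enorm v < r by move: vr'; rewrite /eball/= subr0.
have s0 : 0 <= s v by exact: sqrtr_ge0.
rewrite mulr1.
have sub : [set t | (eball (rV_cons (x, 0)) r `+` eball (rV_cons (0, 0)) r) (rV_cons (t, v))] `<=`
    `](- s v)%R, (x - s v)%R]%classic `|` `[s v, (x + s v)%R[%classic.
  move=> t; rewrite /setY /setU /setD /= !(section_cons _ _ vr) !in_itv/= subr0.
  move=> [[/andP[h1 h2] h3]|[/andP[h1 h2] h3]].
    right; apply/andP; split; last lra.
    by rewrite leNgt; apply/negP => h4; apply: h3; apply/andP; split; lra.
  left; apply/andP; split; first lra.
  by rewrite leNgt; apply/negP => h4; apply: h3; apply/andP; split; lra.
have m1 : measurable (`](- s v)%R, (x - s v)%R]%classic : set R) by exact: measurable_itv.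
have m2 : measurable (`[s v, (x + s v)%R[%classic : set R) by exact: measurable_itv.
apply: (@le_trans _ _ (leb (`](- s v)%R, (x - s v)%R]%classic `|` `[s v, (x + s v)%R[%classic))).
  apply: le_measure => //; rewrite inE; last exact: measurableU.
  rewrite (_ : [set t | _] = (fun t => rV_cons (t, v)) @^-1`
    (eball (rV_cons (x, 0)) r `+` eball (rV_cons (0, 0)) r))//.
  rewrite -origin_cons; apply: measurable_preimage (measurable_lune _).
  apply: (measurableT_comp (@measurable_rV_cons _ _)).
  by apply/measurable_fun_pairP; split => /=; [exact: measurable_id|exact: measurable_cst].
apply: (le_trans (measureU2 leb m1 m2)).
rewrite [X in (X + _)%E](leb_itv _ _ (_ : - s v <= x - s v)); last lra.
by rewrite [X in (_ + X)%E](leb_itv _ _ (_ : s v <= x + s v)) ?lee_fin; lra.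
Qed.

(** The two spheres meet over the sphere |v| = sqrt(r^2 - (x/2)^2). Inside it the half-chord is at
    least x/2, so that the shifted chords leave two disjoint pieces of length x. *)
Lemma lune_measure_ge (x : R) : 0 <= x -> x < 2 * r ->
  2 * x * (Num.sqrt (r ^+ 2 - (x / 2) ^+ 2) ^+ n * ball_volume n) <= lune_measure x.
Proof.
move=> x0 xr; rewrite -lee_fin /lune_measure fineK; last first.
  by rewrite ge0_fin_numE// lebesgue_lune_lty.
rewrite lebesgue_rVS_integral; last exact: measurable_lune.
set rho := Num.sqrt _.
have pos : 0 < r ^+ 2 - (x / 2) ^+ 2.
  rewrite subr_gt0 ltr_pXn2r ?nnegrE ?divr_ge0 ?(ltW r_gt0)//.
  by rewrite ltr_pdivrMr// mulrC.
have rho0 : 0 < rho by rewrite sqrtr_gt0.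
have mB : measurable (eball (0 : 'rV[R]_n) rho) by exact: measurable_eball.
have x20 : 0 <= 2 * x by rewrite mulr_ge0.
rewrite EFinM -(lebesgue_rV_eballE 0 rho0) -integral_scaled_indic//.
apply: ge0_le_integral => //.
- by move=> v _; rewrite lee_fin mulr_ge0.
- by apply/measurable_EFinP; apply: measurable_funM => //; exact: measurable_indic.
- by apply: measurable_lebesgue_section; exact: measurable_lune.
move=> v _; rewrite indicE origin_cons.
case: (boolP (v \in _)); rewrite ?notin_setE ?inE => vr'; last by rewrite mulr0.
have vrho : enorm v < rho by move: vr'; rewrite /eball/= subr0.
have v2 : enorm v ^+ 2 < r ^+ 2 - (x / 2) ^+ 2.
  by rewrite -[ltRHS](sqr_sqrtr (ltW pos)) ltr_pXn2r ?nnegrE ?enorm_ge0 ?(ltW rho0).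
have vr : enorm v < r.
  rewrite -(@ltr_pXn2r _ 2) ?nnegrE ?enorm_ge0 ?(ltW r_gt0)//.
  by rewrite (lt_le_trans v2)// gerBl sqr_ge0.
have s0 : 0 <= s v by exact: sqrtr_ge0.
have xs : x / 2 <= s v.
  rewrite -(@ler_pXn2r _ 2) ?nnegrE ?divr_ge0// s_sqr//; lra.
rewrite mulr1.
have m1 : measurable (`](- s v)%R, (x - s v)%R[%classic : set R) by exact: measurable_itv.
have m2 : measurable (`](s v), (x + s v)%R[%classic : set R) by exact: measurable_itv.
have -> : ((2 * x)%:E = leb (`](- s v)%R, (x - s v)%R[%classic `|` `](s v), (x + s v)%R[%classic))%E.
  rewrite measureU//; last first.
    rewrite predeqE => t; split => //=; rewrite !in_itv/= => -[/andP[_ h1] /andP[h2 _]]; lra.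
  rewrite [X in (X + _)%E](leb_itv _ _ (_ : - s v <= x - s v)); last lra.
  rewrite [X in (_ + X)%E](leb_itv _ _ (_ : s v <= x + s v)); last lra.
  by congr EFin; ring.
apply: le_measure; rewrite ?inE; first exact: measurableU.
  rewrite (_ : [set t | _] = (fun t => rV_cons (t, v)) @^-1`
    (eball (rV_cons (x, 0)) r `+` eball (rV_cons (0, 0)) r))//.
  rewrite -origin_cons; apply: measurable_preimage (measurable_lune _).
  apply: (measurableT_comp (@measurable_rV_cons _ _)).
  by apply/measurable_fun_pairP; split => /=; [exact: measurable_id|exact: measurable_cst].
move=> t; rewrite /setY /setU /setD /= !(section_cons _ _ vr) !in_itv/= subr0.
move=> [/andP[h1 h2]|/andP[h1 h2]].
  by right; split; [apply/andP; split; lra|move=> /andP[h3 h4]; lra].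
by left; split; [apply/andP; split; lra|move=> /andP[h3 h4]; lra].
Qed.

Lemma lune_measure_cvg (q : nat -> R) (y : R) : (forall m, 0 <= q m) ->
  q m @[m --> \oo] --> y ->
  m%:R * lune_measure (q m / m%:R) @[m --> \oo] --> 2 * ball_volume n * r ^+ n * y.
Proof.
move=> q0 qy.
have qm0 : q m / m%:R @[m --> \oo] --> (0 : R).
  rewrite -(mulr0 y); apply: cvgM => //.
  rewrite -(cvg_shiftS (fun m => m%:R^-1 : R)) /=; exact: cvg_harmonic.
have rho_r : Num.sqrt (r ^+ 2 - (q m / m%:R / 2) ^+ 2) ^+ n @[m --> \oo] --> r ^+ n.
  have : Num.sqrt (r ^+ 2 - (q m / m%:R / 2) ^+ 2) @[m --> \oo] --> r.
    rewrite -[X in _ --> X](gtr0_norm r_gt0) -sqrtr_sqr.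
    have h0 : q m / m%:R / 2 @[m --> \oo] --> (0 : R).
      by rewrite -[X in _ --> X](mul0r 2^-1); apply: cvgM => //; exact: cvg_cst.
    have h1 : (q m / m%:R / 2) ^+ 2 @[m --> \oo] --> (0 : R).
      by rewrite -[X in _ --> X](expr0n _ 2); exact: (cvg_comp _ _ h0 (@exprn_continuous R 2 0)).
    have h2 : r ^+ 2 - (q m / m%:R / 2) ^+ 2 @[m --> \oo] --> r ^+ 2.
      by rewrite -[X in _ --> X]subr0; apply: cvgB => //; exact: cvg_cst.
    exact: (cvg_comp _ _ h2 (@sqrt_continuous R (r ^+ 2))).
  by move=> h; exact: (cvg_comp _ _ h (@exprn_continuous R n r)).
have lo : 2 * q m * (Num.sqrt (r ^+ 2 - (q m / m%:R / 2) ^+ 2) ^+ n * ball_volume n)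
    @[m --> \oo] --> 2 * ball_volume n * r ^+ n * y.
  rewrite (_ : 2 * _ * _ * y = 2 * y * (r ^+ n * ball_volume n)); last by ring.
  by apply: cvgM; apply: cvgM => //; exact: cvg_cst.
have hi : 2 * q m * (r ^+ n * ball_volume n) @[m --> \oo] --> 2 * ball_volume n * r ^+ n * y.
  rewrite (_ : 2 * _ * _ * y = 2 * y * (r ^+ n * ball_volume n)); last by ring.
  by apply: cvgM; [apply: cvgM => //; exact: cvg_cst|exact: cvg_cst].
apply: squeeze_cvgr lo hi; near=> m.
have m0 : 0 < m%:R :> R by rewrite ltr0n; near: m; exists 1%N.
have x0 : 0 <= q m / m%:R by rewrite divr_ge0.
have x2r : q m / m%:R < 2 * r.
  near: m; apply: (cvgr_lt _ qm0); by rewrite mulr_gt0.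
have mq : m%:R * (2 * (q m / m%:R)) = 2 * q m by field; rewrite gt_eqF.
apply/andP; split.
  have := lune_measure_ge x0 x2r; rewrite -(ler_pM2l m0) => /(le_trans _); apply.
  by rewrite [_ * (2 * _ * _)]mulrA mq.
have := lune_measure_le x0; rewrite -(ler_pM2l m0) => /le_trans; apply.
by rewrite [_ * (2 * _ * _)]mulrA mq.
Unshelve. all: by end_near. Qed.

End lune.

(** * The one-dimensional case *)
Section real_integrals.
Context {R : realType}.
Local Notation leb := (@lebesgue_measure R).

Lemma is_derive_continuous (f : R -> R) (df : R -> R) :
  (forall x : R, is_derive x 1 f (df x)) -> continuous f.
Proof.
move=> dF x; apply: differentiable_continuous; apply/derivable1_diffP.
by apply: (@ex_derive _ _ _ _ _ _ _ (dF x)).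
Qed.

Lemma integral_is_derive (f F : R -> R) (a b : R) : a <= b -> continuous f ->
  (forall x : R, is_derive x 1 F (f x)) ->
  (\int[leb]_(t in `[a, b]) (f t)%:E = (F b - F a)%:E)%E.
Proof.
move=> ab cf dF; have cF := is_derive_continuous dF.
have [->|nab] := eqVneq a b.
  by rewrite set_itv1 integral_set1 subrr.
have ab' : a < b by rewrite lt_neqAle nab.
rewrite EFinB; apply: continuous_FTC2 => //.
- exact: continuous_subspaceT.
- split.
  + by move=> x _; apply: (@ex_derive _ _ _ _ _ _ _ (dF x)).
  + exact/cvg_at_right_filter/cF.
  + exact/cvg_at_left_filter/cF.
- by move=> x _; rewrite derive1E; apply: (@derive_val _ _ _ _ _ _ _ (dF x)).
Qed.

Lemma is_derive_pow n (x : R) :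
  is_derive x 1 (fun t : R => t ^+ n.+1 / n.+1%:R) (x ^+ n).
Proof.
have -> : (fun t : R => t ^+ n.+1 / n.+1%:R) = n.+1%:R^-1 *: ((fun t : R => t) ^+ n.+1 : R -> R).
  by apply/funext => y; rewrite !fctE /GRing.scale/= mulrC.
apply: is_derive_eq; rewrite /GRing.scale/= mulr1 -mulr_natl mulKf// pnatr_eq0.
Qed.

Lemma integral_pow n (s : R) : 0 <= s ->
  \int[leb]_(t in `[0, s]) (t ^+ n) = s ^+ n.+1 / n.+1%:R.
Proof.
move=> s0; rewrite /Rintegral.
rewrite (integral_is_derive s0 (@exprn_continuous R n) (is_derive_pow n))/=.
by rewrite expr0n/= mul0r subr0.
Qed.

Lemma integral_onem_pow n (s : R) : 0 <= s ->
  \int[leb]_(t in `[0, s]) ((1 - t) ^+ n) = (1 - (1 - s) ^+ n.+1) / n.+1%:R.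
Proof.
move=> s0; rewrite /Rintegral.
have d (x : R) : is_derive x 1 (fun t : R => - ((1 - t) ^+ n.+1 / n.+1%:R)) ((1 - x) ^+ n).
  have h : is_derive x 1 (fun t : R => 1 - t) (- 1).
    rewrite (_ : (fun t : R => 1 - t) = (cst 1 : R -> R) - id)//.
    by apply: is_derive_eq; rewrite sub0r.
  have := @is_derive1_comp R (fun t : R => t ^+ n.+1 / n.+1%:R) (fun t => 1 - t) x _ _
    (is_derive_pow n (1 - x)) h.
  move=> h2; have := @is_deriveN _ _ _ _ _ _ _ h2.
  by move=> h3; apply: is_derive_eq; rewrite mulrN1 opprK.
rewrite (integral_is_derive s0 _ d)/=; last first.
  move=> x; apply: (@continuous_comp _ _ _ (fun t : R => 1 - t) (fun t => t ^+ n)).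
    by apply: continuousB => //; exact: cst_continuous.
  exact: exprn_continuous.
by rewrite subr0 expr1n; field; rewrite addrC natr1 pnatr_eq0.
Qed.

(** The primitive of x^k exp(-x / theta) / theta obtained by repeated integration by parts,
    normalised to vanish at infinity. *)
Fixpoint exp_primitive (theta : R) (k : nat) (x : R) : R :=
  if k is k'.+1 then k'.+1%:R * theta * exp_primitive theta k' x - x ^+ k'.+1 * expR (- theta^-1 * x)
  else - expR (- theta^-1 * x).

Lemma is_derive_exp_primitive (theta : R) k (x : R) : theta != 0 ->
  is_derive x 1 (exp_primitive theta k) (x ^+ k * (theta^-1 * expR (- theta^-1 * x))).
Proof.
move=> t0.
have h0 (y : R) : is_derive y 1 (fun x : R => expR (- theta^-1 * x)) (- theta^-1 * expR (- theta^-1 * y)).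
  have h1 : is_derive y 1 (fun x : R => - theta^-1 * x) (- theta^-1).
    by apply: is_derive_eq; rewrite /GRing.scale/= mulr1.
  have := @is_derive1_comp R expR (fun x : R => - theta^-1 * x) y _ _ (is_derive_expR _) h1.
  by move=> h2; apply: is_derive_eq; rewrite mulrC.
elim: k x => [|k IH] x.
  have := @is_deriveN _ _ _ _ _ _ _ (h0 x); move=> h; apply: is_derive_eq.
  by rewrite mulNr opprK expr0 mul1r.
have -> : exp_primitive theta k.+1 = (k.+1%:R * theta) *: exp_primitive theta k -
    ((fun t : R => t) ^+ k.+1 : R -> R) * (fun x => expR (- theta^-1 * x)).
  by apply/funext => y; rewrite !fctE.
have h1 := h0 x; have h2 := IH x.
apply: is_derive_eq; rewrite !fctE /GRing.scale/= mulr1 -mulr_natl exprS.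
by field.
Qed.

Lemma exp_primitive0 (theta : R) k : exp_primitive theta k 0 = - (k`!%:R * theta ^+ k).
Proof.
elim: k => [|k IH]; first by rewrite /= mulr0 expR0 fact0 expr0 mulr1.
rewrite -[LHS]/(k.+1%:R * theta * exp_primitive theta k 0 - 0 ^+ k.+1 * expR (- theta^-1 * 0)).
by rewrite IH expr0n mul0r subr0 factS natrM exprS; ring.
Qed.

Lemma pow_expRN_cvg0 (a : R) k : 0 < a -> x ^+ k * expR (- a * x) @[x --> +oo%R] --> (0 : R).
Proof.
move=> a0; apply/cvgrPdist_le => e e0; near=> x.
have x0 : 0 < x by near: x; exact: nbhs_pinfty_gt.
rewrite sub0r normrN ger0_norm ?mulr_ge0 ?exprn_ge0 ?expR_ge0 ?(ltW x0)//.
have ax0 : 0 <= a * x by rewrite mulr_ge0 ?ltW.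
have f0 : 0 < k.+1`!%:R :> R by rewrite ltr0n fact_gt0.
have h1 : (a * x) ^+ k.+1 / k.+1`!%:R <= expR (a * x).
  by apply: le_trans (expR_ge1Dxn k ax0); rewrite lerDr.
have ak : 0 < a ^+ k.+1 by rewrite exprn_gt0.
rewrite mulNr expRN ler_pdivrMr ?expR_gt0//.
apply: (@le_trans _ _ (e * ((a * x) ^+ k.+1 / k.+1`!%:R))); last by rewrite ler_wpM2l// ltW.
have xe : k.+1`!%:R / (a ^+ k.+1 * e) <= x by near: x; apply: nbhs_pinfty_ge; exact: num_real.
have : x ^+ k * (k.+1`!%:R / (a ^+ k.+1 * e)) <= x ^+ k * x by rewrite ler_wpM2l// exprn_ge0// ltW.
rewrite -(ler_pM2l (_ : 0 < a ^+ k.+1 * e / k.+1`!%:R)); last by rewrite divr_gt0// mulr_gt0.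
rewrite (_ : a ^+ k.+1 * e / _ * (x ^+ k * (_ / _)) = x ^+ k); last first.
  by field; rewrite !gt_eqF.
move=> /le_trans; apply; rewrite exprMn (exprS x k) le_eqVlt; apply/orP; left; apply/eqP; ring.
Unshelve. all: by end_near. Qed.

Lemma exp_primitive_cvg0 (theta : R) k : 0 < theta ->
  exp_primitive theta k x @[x --> +oo%R] --> (0 : R).
Proof.
move=> t0; have ti : 0 < theta^-1 by rewrite invr_gt0.
have h j := pow_expRN_cvg0 j ti.
elim: k => [|k IH].
  rewrite (_ : exp_primitive theta 0 = fun x => - (x ^+ 0 * expR (- theta^-1 * x))).
    by rewrite -oppr0; exact: cvgN (h 0%N).
  by apply/funext => x; rewrite /= expr0 mul1r.
rewrite -[X in _ --> X]subr0 -[X in _ --> X - _](mulr0 (k.+1%:R * theta)).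
by apply: cvgB; [apply: cvgM => //; exact: cvg_cst|exact: h].
Unshelve. all: by end_near. Qed.

Lemma integral_exp_moment (theta : R) k : 0 < theta ->
  (\int[leb]_(x in `[0%R, +oo[) (x ^+ k * (theta^-1 * expR (- theta^-1 * x)))%:E =
   (k`!%:R * theta ^+ k)%:E)%E.
Proof.
move=> t0; have tn : theta != 0 by rewrite gt_eqF.
have dF x := is_derive_exp_primitive k x tn.
have cF := is_derive_continuous dF.
rewrite (@ge0_continuous_FTC2y R _ (exp_primitive theta k) 0 0).
- by rewrite exp_primitive0 -EFinB sub0r opprK.
- by move=> x x0; rewrite !mulr_ge0 ?exprn_ge0 ?expR_ge0 ?invr_ge0 ?(ltW t0).
- apply: continuous_subspaceT => x; apply: cvgM; first exact: exprn_continuous.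
  apply: cvgM; first exact: cvg_cst.
  apply: (@continuous_comp _ _ _ (fun x : R => - theta^-1 * x) expR); last exact: continuous_expR.
  by apply: cvgM; [exact: cvg_cst|exact: cvg_id].
- exact: exp_primitive_cvg0.
- by move=> x _; apply: (@ex_derive _ _ _ _ _ _ _ (dF x)).
- exact/cvg_at_right_filter/cF.
- by move=> x _; rewrite derive1E; apply: (@derive_val _ _ _ _ _ _ _ (dF x)).
Qed.

End real_integrals.

(** * The exponential law and its moments *)

Section exponential_law.
Context {R : realType}.
Variable theta : R.
Hypothesis theta_gt0 : 0 < theta.
Let rate_gt0 : 0 < theta^-1. Proof. by rewrite invr_gt0. Qed.

Definition exponential_law : probability (measurableTypeR R) R :=
  exponential_distribution_exponential_prob__canonical__probability_measure_Probability rate_gt0.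

(** The absolute value gives a variable that is nonnegative everywhere, as [moments_determine_law]
    asks; by [exponential_law_normr] it has the same law as the identity. *)
Lemma exponential_law_moment k :
  (\int[exponential_law]_x (`|x| ^+ k)%:E = (k`!%:R * theta ^+ k)%:E)%E.
Proof.
have mk : measurable_fun setT (fun x : R => (`|x| ^+ k)%:E).
  by apply/measurable_EFinP; apply: measurable_funX; exact: normr_measurable.
rewrite (@ge0_integral_density _ _ _ (@lebesgue_measure R) exponential_law
  (exponential_pdf theta^-1) _ _ _ (fun x : measurableTypeR R => (`|x| ^+ k)%:E) mk) //.
- rewrite -(integral_exp_moment k theta_gt0) [RHS]integral_mkcond/=.
  apply: eq_integral => x _; rewrite patchE; case: ifPn.
    rewrite inE/= in_itv/= andbT => x0.
    by rewrite ger0_norm// exponential_pdfE// -EFinM.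
  rewrite notin_setE/= in_itv/= andbT => /negP; rewrite -ltNge => x0.
  by rewrite lt0_exponential_pdf// mule0.
- exact: measurable_exponential_pdf.
- by move=> x; apply: exponential_pdf_ge0; exact: ltW.
Qed.

Lemma exponential_law_normr (B : set R) : measurable B ->
  exponential_law (id @^-1` B) = exponential_law (Num.norm @^-1` B).
Proof.
move=> mB; rewrite /exponential_law/= /exponential_prob preimage_id.
rewrite [LHS]integral_mkcond [RHS]integral_mkcond; apply: eq_integral => x _.
rewrite !patchE; have [x0|x0] := leP 0 x.
  rewrite (_ : (x \in Num.norm @^-1` B) = (x \in B))//.
  by apply/idP/idP; rewrite !inE /preimage/= ger0_norm.
by rewrite lt0_exponential_pdf//; case: ifP; case: ifP.
Qed.

End exponential_law.

(** A single variable is a constant sequence, so [moments_law_close] compares the distribution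
    functions at x and at any y > x up to any eps. Right continuity lets y decrease to x. *)
Lemma moments_determine_law (R : realType) (m : nat -> R) (h : R)
    d (T : measurableType d) (P : probability T R) (X : T -> R)
    d' (T' : measurableType d') (P' : probability T' R) (X' : T' -> R) :
  0 < h ->
  (forall i, (h ^+ n / n`!%:R * (m (i + n)%N + 1)) @[n --> \oo] --> (0 : R)) ->
  measurable_fun setT X -> measurable_fun setT X' ->
  (forall t, 0 <= X t) -> (forall t, 0 <= X' t) ->
  (forall k, \int[P]_t (X t ^+ k)%:E = (m k)%:E)%E ->
  (forall k, \int[P']_t (X' t ^+ k)%:E = (m k)%:E)%E ->
  forall B, measurable B -> P (X @^-1` B) = P' (X' @^-1` B).
Proof.
move=> h0 mg mX mX' X0 X0' EX EX'.
have close N (delta : R) d0 (T0 : measurableType d0) (P0 : probability T0 R) (X1 : T0 -> R) :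
    0 < delta -> measurable_fun setT X1 -> (forall t, 0 <= X1 t) ->
    (forall k, \int[P0]_t (X1 t ^+ k)%:E = (m k)%:E)%E -> moments_close m N delta P0 X1.
  move=> d0' mX1 X10 EX1; apply: (@moments_closeW _ _ N N delta delta) => //.
  have [N' _ /(_ N' (leqnn _))] := @moments_close_near _ _ _ P0 (fun=> X1) (fun=> m) m
    (fun=> mX1) (fun=> X10) (fun=> EX1) (fun k => cvg_cst (m k)) N delta d0'.
  exact.
have dist d0 (T0 : measurableType d0) (P0 : probability T0 R) (X1 : T0 -> R)
    d1 (T1 : measurableType d1) (P1 : probability T1 R) (X2 : T1 -> R) :
    measurable_fun setT X1 -> (forall t, 0 <= X1 t) ->
    (forall k, \int[P0]_t (X1 t ^+ k)%:E = (m k)%:E)%E ->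
    measurable_fun setT X2 -> (forall t, 0 <= X2 t) ->
    (forall k, \int[P1]_t (X2 t ^+ k)%:E = (m k)%:E)%E ->
    forall x : R, fine (P0 [set t | X1 t <= x]) <= fine (P1 [set t | X2 t <= x]).
  move=> mX1 X10 EX1 mX2 X20 EX2 x.
  pose W : {RV P1 >-> R} := mfun_Sub (mem_set mX2).
  have cdfE y : cdf W y = (fine (P1 [set t | X2 t <= y]))%:E.
    rewrite fineK; last by rewrite fin_num_measure//; exact: measurable_le_cst.
    rewrite /cdf /distribution /pushforward; apply: congr1.
    by rewrite predeqE => t /=; rewrite in_itv.
  have rc : fine (P1 [set t | X2 t <= y]) @[y --> x^'+] --> fine (P1 [set t | X2 t <= x]).
    apply: fine_cvg; have := @cdf_right_continuous _ _ _ P1 W x.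
    rewrite cdfE; apply: cvg_trans.
    apply: near_eq_cvg; near=> y; rewrite cdfE fineK// fin_num_measure//.
    exact: measurable_le_cst.
  apply: ler_cvg_to (cvg_cst _) rc _; near=> y.
  have xy : x < y by near: y; exact: nbhs_right_gt.
  apply/ler_addgt0Pr => e e0.
  have [N [delta d0' H]] := moments_law_close h0 mg xy e0.
  by apply: H; apply: close.
apply: eq_law_rays => // x.
rewrite -[LHS]fineK; last by rewrite fin_num_measure//; exact: measurable_le_cst.
rewrite -[RHS]fineK; last by rewrite fin_num_measure//; exact: measurable_le_cst.
by congr EFin; apply/eqP; rewrite eq_le !dist.
Unshelve. all: by end_near. Qed.

Section dimension_one.
Context {R : realType}.
Local Notation leb := (@lebesgue_measure R).

Let axis (t : R) : 'rV[R]_1 := rV_cons (t, 0).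

Let measurable_axis : measurable_fun setT axis.
Proof.
apply: (measurableT_comp (@measurable_rV_cons _ _)).
by apply/measurable_fun_pairP; split => /=; [exact: measurable_id|exact: measurable_cst].
Qed.

Lemma lebesgue_rV1 (A : set 'rV[R]_1) : measurable A ->
  lebesgue_rV 1 A = leb (axis @^-1` A).
Proof.
move=> mA; rewrite lebesgue_rVS_integral//= integral_dirac//; last first.
  exact: measurable_lebesgue_section.
by rewrite diracT mul1e.
Qed.

Lemma enorm_rV1 t : enorm (axis t) = `|t|.
Proof.
apply/eqP; rewrite -(@eqrXn2 _ 2) ?enorm_ge0// enorm_cons_sqr/= enorm0 expr0n addr0.
by rewrite -normrX ger0_norm ?sqr_ge0.
Qed.

Let preimage_ball : axis @^-1` eball 0 1 = `]-1, 1[%classic.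
Proof.
by rewrite predeqE => t; rewrite /preimage /eball/= subr0 enorm_rV1 ltr_norml in_itv.
Qed.

Lemma ball_volume1 : @ball_volume R 1 = 2.
Proof.
rewrite /ball_volume lebesgue_rV1; last exact: measurable_eball.
rewrite preimage_ball; rewrite [leb _](_ : _ = 2%:E)//.
apply: etrans (lebesgue_measure_itv _) _; rewrite /= lte_fin ifT; last lra.
by rewrite -EFinB opprK; congr EFin; ring.
Qed.

Lemma integral_rV1_ball (j : nat) : (0 < j)%N ->
  \int[@lebesgue_rV R 1]_(y in eball 0 1) (1 - enorm y ^+ j) = 2 * (j%:R / j.+1%:R).
Proof.
move=> j0.
(* The positive part of z = 1 - |t|^j, written (z + |z|) / 2 to be visibly continuous. It extends
   the integrand by 0 to the whole line, where evenness can be used. *)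
pose f (t : R) : R := (1 - `|t| ^+ j + `|1 - `|t| ^+ j|) / 2.
have fE t : f t = Num.max 0 (1 - `|t| ^+ j).
  rewrite /f; move: (1 - _) => z; have [z0|z0] := leP 0 z.
    by rewrite ger0_norm//; field.
  by rewrite ltr0_norm// subrr mul0r.
have f0 t : 0 <= f t by rewrite fE le_max lexx.
have cf : continuous f.
  have cz : continuous (fun t : R => 1 - `|t| ^+ j).
    move=> t; apply: cvgB; first exact: cvg_cst.
    apply: (@continuous_comp _ _ _ (fun t : R => `|t|) (fun t => t ^+ j)); first exact: norm_continuous.
    exact: exprn_continuous.
  move=> t; apply: cvgM; last exact: cvg_cst.
  apply: cvgD; first exact: cz.
  by apply: (@continuous_comp _ _ _ (fun t : R => 1 - `|t| ^+ j) (fun t => `|t|)); [exact: cz|exact: norm_continuous].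
have mE : measurable_fun setT (fun y : 'rV[R]_1 => Num.max 0 (1 - enorm y ^+ j)).
  apply: measurable_maxr => //; apply: measurable_funB => //; apply: measurable_funX.
  exact: measurable_fun_enorm.
have mB : measurable (eball (0 : 'rV[R]_1) 1) by exact: measurable_eball.
have powlt1 (s : R) : 0 <= s -> s < 1 -> s ^+ j <= 1.
  by move=> s0 s1; rewrite exprn_ile1// ltW.
rewrite /Rintegral.
rewrite (_ : \int[lebesgue_rV 1]_(y in eball 0 1) _ =
    \int[lebesgue_rV 1]_y (Num.max 0 (1 - enorm y ^+ j))%:E)%E; last first.
  rewrite [LHS]integral_mkcond; apply: eq_integral => y _; rewrite patchE.
  case: ifPn; rewrite ?notin_setE ?inE /eball/= subr0 => y1; congr EFin.
    by rewrite (max_idPr _)// subr_ge0 powlt1// enorm_ge0.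
  rewrite (max_idPl _)// subr_le0 exprn_ege1// leNgt; exact/negP.
rewrite (eq_measure_integral
  (measure_function_pushforward__canonical__measure_function_Measure leb measurable_axis)); last first.
  by move=> A mA _; exact: lebesgue_rV1.
rewrite (@ge0_integral_pushforward _ _ (measurableTypeR R) _ R axis measurable_axis leb setT _ measurableT); last 2 first.
- exact/measurable_EFinP.
- by move=> y _; rewrite lee_fin le_max lexx.
rewrite (_ : \int[leb]_(x in _) _ = \int[leb]_t (f t)%:E)%E; last first.
  by rewrite preimage_setT; apply: eq_integral => t _ /=; rewrite enorm_rV1 fE.
rewrite ge0_symfun_integralT//; last by move=> t; rewrite /f/= normrN.
rewrite (_ : \int[leb]_(x in _) _ = \int[leb]_(x in `[0%R, 1%R]) (1 - x ^+ j)%:E)%E; last first.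
  rewrite [LHS]integral_mkcond [RHS]integral_mkcond; apply: eq_integral => x _; rewrite !patchE.
  have [x0|x0] := leP 0 x; last first.
    rewrite !ifF//; apply/negbTE; rewrite notin_setE/= ?in_itv/=; first by rewrite leNgt x0.
    by rewrite leNgt x0.
  rewrite mem_set//; have [x1|x1] := leP x 1.
    rewrite ifT; last by rewrite inE/= in_itv/= x0.
    by rewrite fE ger0_norm// (max_idPr _)// subr_ge0 exprn_ile1.
  rewrite ifF; last by apply/negbTE; rewrite notin_setE/= in_itv/= x0/= leNgt x1.
  by rewrite fE ger0_norm// (max_idPl _)// subr_le0 exprn_ege1// ltW.
have d (x : R) : is_derive x 1 (id - (fun t : R => t ^+ j.+1 / j.+1%:R)) (1 - x ^+ j).
  have h := is_derive_pow j x.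
  exact: is_deriveB.
rewrite (integral_is_derive ler01 _ d); last first.
  by move=> x; apply: cvgB; [exact: cvg_cst|exact: exprn_continuous].
rewrite -EFinM/= !fctE expr1n expr0n/= mul0r !subr0; congr (2 * _).
by field; rewrite addrC natr1 pnatr_eq0.
Qed.

Lemma integral_rV1_decrement (L : R) (u : 'rV[R]_1) (j : nat) : 0 < L -> (0 < j)%N ->
  decrement (2 * L * sphere_area 1)^-1 u j%:R = j%:R / (j.+1%:R * (2 * L)).
Proof.
move=> L0 j0; rewrite /decrement /kernel_mean.
rewrite (_ : \int[_]_(y in _) _ = \int[@lebesgue_rV R 1]_(y in eball 0 1) (1 - enorm y ^+ j)).
  rewrite integral_rV1_ball// /sphere_area mul1r ball_volume1.
  by field; rewrite addrC natr1 pnatr_eq0 gt_eqF.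
by apply: eq_Rintegral => y _; rewrite expr0 invr1 mulr1 powR_mulrn// enorm_ge0.
Qed.

End dimension_one.

Section uniform_case.
Context {R : realType}.
Local Notation leb := (@lebesgue_measure R).
Variables (c : nat -> R) (theta : R).
Hypothesis theta_gt0 : 0 < theta.
Hypothesis cE : forall j, (0 < j)%N -> c j = j%:R / (j.+1%:R * theta).

Let integrable_poly j n (s : R) :
  leb.-integrable `[0, s] (EFin \o (fun t : R => t ^+ j * (1 - t) ^+ n)).
Proof.
apply: continuous_compact_integrable; first exact: segment_compact.
apply: continuous_subspaceT => t; apply: cvgM; first exact: exprn_continuous.
apply: (@continuous_comp _ _ _ (fun t : R => 1 - t) (fun t => t ^+ n)).
  by apply: cvgB; [exact: cvg_cst|exact: cvg_id].
exact: exprn_continuous.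
Qed.

(** On the line, X_n is distributed as the minimum of X_0 and n independent uniform variables on ]0,
    theta[, whose tail at theta t is (1 - t)^n for t < X_0 / theta. The recursion is matched by
    splitting one factor 1 - t. *)
Lemma moment_poly_uniform n j (x : R) : (0 < j)%N -> 0 <= x ->
  moment_poly c n j x =
  j%:R * theta ^+ j * \int[leb]_(t in `[0, x / theta]) (t ^+ j.-1 * (1 - t) ^+ n).
Proof.
move=> j0 x0; have s0 : 0 <= x / theta by rewrite divr_ge0// ltW.
elim: n j j0 => [|n IH] j j0 /=.
  rewrite (_ : \int[leb]_(t in _) _ = \int[leb]_(t in `[0, x / theta]) (t ^+ j.-1)); last first.
    by apply: eq_Rintegral => t _; rewrite expr0 mulr1.
  rewrite integral_pow// prednK// expr_div_n; field.
  by rewrite pnatr_eq0 -lt0n j0 expf_neq0// gt_eqF.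
rewrite !IH//= cE//.
have -> : \int[leb]_(t in `[0, x / theta]) (t ^+ j.-1 * (1 - t) ^+ n.+1) =
    \int[leb]_(t in `[0, x / theta]) (t ^+ j.-1 * (1 - t) ^+ n) -
    \int[leb]_(t in `[0, x / theta]) (t ^+ j * (1 - t) ^+ n).
  rewrite -RintegralB//; try exact: integrable_poly; try exact: measurable_itv.
  apply: eq_Rintegral => t _; rewrite -[in X in _ = _ - X](prednK j0) !exprS; ring.
rewrite exprS; field.
by rewrite addrC natr1 pnatr_eq0 gt_eqF.
Qed.

Lemma moment_poly_uniform1 n (x : R) : 0 <= x ->
  moment_poly c n 1 x = theta * \int[leb]_(t in `[0, x / theta]) ((1 - t) ^+ n).
Proof.
move=> x0; rewrite moment_poly_uniform// mul1r expr1; congr (_ * _).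
by apply: eq_Rintegral => t _; rewrite expr0 mul1r.
Qed.

Lemma scaled_moment_uniform_cvg (x : R) : 0 < x -> x < theta ->
  scaled_moment c 1 x n @[n --> \oo] --> theta.
Proof.
move=> x0 xt; pose s := 1 - x / theta.
have s0 : 0 <= x / theta by rewrite divr_ge0// ltW.
have s1 : `|s| < 1.
  have : 0 < x / theta < 1 by rewrite divr_gt0//= ltr_pdivrMr// mul1r.
  by rewrite ltr_norml /s => /andP[? ?]; apply/andP; split; lra.
have h1 : s ^+ n.+1 @[n --> \oo] --> (0 : R).
  by rewrite (cvg_shiftS (fun n => s ^+ n)); exact: cvg_expr.
have h2 : n.+1%:R^-1 @[n --> \oo] --> (0 : R) by exact: cvg_harmonic.
have -> : scaled_moment c 1 x = fun n => (1 - n.+1%:R^-1) * (theta * (1 - s ^+ n.+1)).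
  apply/funext => n; rewrite /scaled_moment moment_poly_uniform1 ?(ltW x0)//.
  rewrite integral_onem_pow// -/s expr1 -[in n%:R](addrK 1 n%:R) natr1.
  have nn : n.+1%:R != 0 :> R by rewrite pnatr_eq0.
  by move: (n.+1%:R : R) nn => z z0; field.
suff : (1 - n.+1%:R^-1) * (theta * (1 - s ^+ n.+1)) @[n --> \oo] --> (1 - 0) * (theta * (1 - 0)).
  by rewrite !subr0 mul1r mulr1.
by apply: cvgM; [apply: cvgB => //; exact: cvg_cst|apply: cvgM; [exact: cvg_cst|apply: cvgB => //; exact: cvg_cst]].
Qed.

Lemma prod_uniform k : (0 < k)%N -> \prod_(1 <= i < k) c i = (k%:R * theta ^+ k.-1)^-1.
Proof.
elim: k => // -[|k] IH _; first by rewrite big_geq// mul1r expr0 invr1.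
rewrite big_nat_recr//= IH// cE// exprS; field.
by rewrite expf_neq0 ?gt_eqF//= addrC natr1 pnatr_eq0/= (addrC 1) natr1 pnatr_eq0.
Qed.

End uniform_case.

Lemma bin_le_exp2 n k : ('C(n, k) <= 2 ^ n)%N.
Proof.
elim: n k => [|n IH] [|k] //; first by rewrite bin0 expn_gt0.
by rewrite binS expnS mul2n -addnn leq_add.
Qed.

(** Since (i + n)! <= 2^(i + n) i! n!, the choice h = 1 / (4 D) leaves a multiple of 2^n D^n / (4
    D)^n = 2^-n. *)
Lemma factorial_growth (R : realType) (m : nat -> R) (B D : R) : 0 <= B -> 0 < D ->
  (forall k, 0 <= m k) -> (forall k, m k + 1 <= B * k`!%:R * D ^+ k) ->
  forall i, ((4 * D)^-1 ^+ n / n`!%:R * (m (i + n)%N + 1)) @[n --> \oo] --> (0 : R).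
Proof.
move=> B0 D0 m0 mB i.
have D4 : 0 < (4 * D)^-1 by rewrite invr_gt0 mulr_gt0.
have f0 n : 0 < n`!%:R :> R by rewrite ltr0n fact_gt0.
pose K := B * i`!%:R * (2 * D) ^+ i.
have lim : K * 2^-1 ^+ n @[n --> \oo] --> (0 : R).
  rewrite -[X in _ --> X](mulr0 K); apply: cvgM; first exact: cvg_cst.
  apply: cvg_expr; rewrite ger0_norm; lra.
apply: squeeze_cvgr (cvg_cst 0) lim; near=> n; apply/andP; split.
  by rewrite mulr_ge0 ?divr_ge0 ?exprn_ge0 ?(ltW D4) ?addr_ge0.
apply: (@le_trans _ _ ((4 * D)^-1 ^+ n / n`!%:R * (B * (i + n)`!%:R * D ^+ (i + n)))).
  by rewrite ler_wpM2l// divr_ge0 ?exprn_ge0// ltW.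
have fE : (i + n)`!%:R = ('C(i + n, i) * (i`! * n`!))%:R :> R.
  by have := bin_fact (leq_addr n i); rewrite addKn => ->.
rewrite fE !natrM.
have bin : 'C(i + n, i)%:R <= 2 ^+ (i + n) :> R by rewrite -natrX ler_nat bin_le_exp2.
have -> : (4 * D)^-1 ^+ n / n`!%:R * (B * ('C(i + n, i)%:R * (i`!%:R * n`!%:R)) * D ^+ (i + n)) =
    'C(i + n, i)%:R * ((4 * D)^-1 ^+ n * B * i`!%:R * D ^+ (i + n)).
  by field; rewrite gt_eqF.
have -> : K * 2^-1 ^+ n = 2 ^+ (i + n) * ((4 * D)^-1 ^+ n * B * i`!%:R * D ^+ (i + n)).
  rewrite /K !exprD !exprMn !exprVn exprMn (_ : 4 = 2 * 2 :> R) ?exprMn; last by rewrite -natrM.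
  by field; rewrite !expf_neq0// gt_eqF.
apply: ler_wpM2r => //.
by rewrite !mulr_ge0 ?exprn_ge0 ?(ltW D4) ?(ltW D0).
Unshelve. all: by end_near. Qed.

(** * The polarized balls: constants, limit moments and coupling of n X_n *)

Section polarized_ball_chain.
Context {R : realType} {d : nat} {L : R}.
Context {disp : measure_display} {T : measurableType disp} {P : probability T R}.
Variables (sigma : nat -> T -> reflection R d) (r : R) (u : 'rV[R]_d).
Hypotheses (d_ge1 : (1 <= d)%N) (L_gt0 : 0 < L) (r_gt0 : 0 < r) (u1 : enorm u = 1).
Hypothesis sigma_iid : iid_reflections P L sigma.

Let Z i w := sigma i w 0.
Let C := (2 * L * sphere_area d)^-1.
Let c (j : nat) := decrement C u j%:R.

Lemma sphere_area_gt0 : 0 < @sphere_area R d.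
Proof. by rewrite mulr_gt0 ?ltr0n// ball_volume_gt0. Qed.

Let C_gt0 : 0 < C.
Proof. by rewrite invr_gt0 mulr_gt0 ?sphere_area_gt0// mulr_gt0. Qed.

Let mZ i : measurable_fun setT (Z i).
Proof. by case: sigma_iid => H _ _; exact: H. Qed.
Let indepZ : mutually_independent P Z. Proof. by case: sigma_iid. Qed.
Let lawZ i (B : set 'rV[R]_d) : measurable B ->
  law_at P mZ i B = (C%:E * \int[lebesgue_rV d]_(x in B `&` eball 0 (2 * L)%R)
             (radial_density x)%:E)%E.
Proof. by case: sigma_iid => _ H _; exact: H. Qed.

Let c_gt0 j : (0 < j)%N -> 0 < c j.
Proof.
by move=> j0; apply: (decrement_gt0 d_ge1 L_gt0 C_gt0 (lawZ 0) u1); rewrite ltr0n.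
Qed.

Lemma cst_cE alpha : 0 < alpha -> cst_c u L alpha = decrement C u alpha.
Proof. by move=> a0; rewrite /cst_c gt_eqF. Qed.

Lemma cst_c_nat j : (0 < j)%N -> cst_c u L j%:R = c j.
Proof. by move=> j0; rewrite cst_cE// ltr0n. Qed.

Lemma cst_ellE : cst_ell u L = kernel_mean C u (fun s => (1 - s) * s^-1).
Proof. by []. Qed.

Lemma cst_cbarE j : (0 < j)%N -> cst_cbar u j = 2 * L * c j.
Proof.
move=> j0; rewrite /cst_cbar /c /decrement /kernel_mean gtn_eqF//.
rewrite (_ : \int[_]_(y in _) ((1 - enorm y ^+ j) * _) =
  \int[lebesgue_rV d]_(y in eball 0 1) ((1 - enorm y `^ j%:R) * enorm (u - y) ^- d.-1)); last first.
  by apply: eq_Rintegral => y _; rewrite powR_mulrn// enorm_ge0.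
have s0 := sphere_area_gt0; rewrite /C; field.
by rewrite !gt_eqF.
Qed.

Lemma prod_cst_cbar k :
  \prod_(1 <= i < k.+1) cst_cbar u i = (2 * L) ^+ k * \prod_(1 <= i < k.+1) c i.
Proof.
elim: k => [|k IH]; first by rewrite !big_geq// expr0 mul1r.
have recr (f : nat -> R) :
    \prod_(1 <= i < k.+2) f i = \prod_(1 <= i < k.+1) f i * f k.+1.
  by rewrite big_nat_recr.
by rewrite !recr IH cst_cbarE// exprS; ring.
Qed.

(** This is n E[X_n] / (2L) for X_0 = L. As [cst_cbar] is 2L times c_i, L^(k+1) divided by
    (2L)^(k+1) becomes 2^-(k+1). *)
Lemma alpha_seqE n : alpha_seq u n = scaled_moment c 1 L n / (2 * L).
Proof.
rewrite /alpha_seq /scaled_moment moment_polyE expr1 -mulrA; congr (_ * _).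
rewrite mulr_suml; apply: eq_bigr => k _.
rewrite big_nat_recl//= -[in X in X * \prod_(_ <= _ < _) _]/(cst_cbar u 0).
rewrite -[X in _ * (_ * X)](big_add1 _ _ 0 k.+1 xpredT (cst_cbar u)) prod_cst_cbar.
rewrite (_ : cst_cbar u 0 = 1) ?mul1r; last by rewrite /cst_cbar eqxx.
rewrite (eq_big_nat _ _ (F1 := fun i => c (i + 1 - 1)%N) (F2 := c)); last first.
  by move=> i _; rewrite addnK.
move: (\prod_(1 <= i < k.+1) c i) => p; rewrite addn1 !exprS exprMn; field.
by rewrite expf_neq0 ?gt_eqF.
Qed.

Lemma moment_poly_center_lt n j x y : (0 < j)%N -> 0 <= x -> x < y -> y <= L ->
  moment_poly c n j x < moment_poly c n j y.
Proof. exact: (moment_poly_lt d_ge1 L_gt0 C_gt0 (lawZ 0) u1). Qed.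

Variable a : 'rV[R]_d.
Hypothesis a_sub : eball a r `<=` eball 0 L.

Lemma eball_sub_center : enorm a <= L.
Proof.
by have := a_sub (_ : eball a r a); rewrite /eball/= subrr enorm0 subr0 => /(_ r_gt0)/ltW.
Qed.
Let aL := eball_sub_center.

Lemma polarizedE n w : polarized sigma (eball a r) n w = eball (center_at Z a n w) r.
Proof. exact: polarize_iter_eball. Qed.

Lemma center_distE n w : center_dist sigma (eball a r) n w = enorm (center_at Z a n w).
Proof. by rewrite /center_dist polarizedE ball_center_eball. Qed.

Let X := center_dist sigma (eball a r).

Let XE n : X n = fun w => enorm (center_at Z a n w).
Proof. by apply/funext => w; rewrite /X center_distE. Qed.

Lemma measurable_center_dist n : measurable_fun setT (X n).
Proof. by rewrite XE; exact: (measurable_center_norm a mZ n). Qed.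

Lemma expectation_center_dist_exp n j : (0 < j)%N ->
  ('E_P[fun w => (X n w ^+ j)%R] = (moment_poly c n j (enorm a))%:E)%E.
Proof.
move=> j0; rewrite XE; exact: (expectation_center_norm_exp d_ge1 L_gt0 C_gt0 indepZ lawZ u1 aL).
Qed.

Lemma expectation_center_dist_powR n alpha : 0 < alpha -> 0 < enorm a ->
  ('E_P[fun w => (X n w `^ alpha)%R] <=
    (((enorm a)^-1 + cst_c u L alpha * alpha^-1 * n%:R) `^ (- alpha))%:E)%E.
Proof.
move=> al0 a0; rewrite XE cst_cE// unlock.
rewrite (chain_momentE P mZ aL)// lee_fin.
exact: (chain_moment_upper d_ge1 L_gt0 C_gt0 indepZ lawZ u1 aL).
Qed.

Lemma expectation_center_dist_ge n : (1 < d)%N -> 0 < enorm a ->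
  ((((enorm a)^-1 + cst_ell u L * n%:R)^-1)%:E <= 'E_P[X n])%E.
Proof.
move=> d1 a0; rewrite XE cst_ellE mulrC.
exact: (expectation_center_norm_ge d_ge1 L_gt0 C_gt0 indepZ lawZ u1 aL).
Qed.

Hypothesis a_gt0 : 0 < enorm a.

Let p_ge0 n j x : (0 < j)%N -> 0 <= x -> x <= L -> 0 <= moment_poly c n j x.
Proof. exact: (moment_poly_ge0 d_ge1 L_gt0 C_gt0 (lawZ 0) u1). Qed.

Let p_mono n j x y : (0 < j)%N -> 0 <= x -> x <= y -> y <= L ->
  moment_poly c n j x <= moment_poly c n j y.
Proof.
move=> j0 x0; rewrite le_eqVlt => /predU1P[->//|xy] yL; apply: ltW.
exact: moment_poly_center_lt.
Qed.

Let p_bounded j : (0 < j)%N -> exists M, forall n, scaled_moment c j (enorm a) n <= M.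
Proof.
move=> j0; have j0' : 0 < j%:R :> R by rewrite ltr0n.
have cj := c_gt0 j0.
(* Dropping X_0^-1 from the bound of (iv) gives n^j E[X_n^j] <= (j / c_j)^j for n >= 1. *)
exists (Num.max 0 ((j%:R / c j) ^+ j)) => -[|n].
  by rewrite /scaled_moment expr0n gtn_eqF// mul0r le_max lexx.
have := chain_moment_upper d_ge1 L_gt0 C_gt0 indepZ lawZ u1 aL n.+1 j0' a_gt0.
rewrite (chain_moment_poly d_ge1 L_gt0 C_gt0 indepZ lawZ u1 aL)// -/(c j) => H.
have n0 : 0 < n.+1%:R :> R by rewrite ltr0n.
have b0 : 0 < c j * j%:R^-1 * n.+1%:R by rewrite mulr_gt0// divr_gt0.
have b1 : 0 < (enorm a)^-1 + c j * j%:R^-1 * n.+1%:R by rewrite addr_gt0// invr_gt0.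
have H2 : moment_poly c n.+1 j (enorm a) <= (c j * j%:R^-1 * n.+1%:R) ^- j.
  apply: (le_trans H); rewrite powRN powR_mulrn ?(ltW b1)//.
  by rewrite lef_pV2 ?posrE ?exprn_gt0// ler_pXn2r ?nnegrE ?(ltW b0) ?(ltW b1)// lerDr invr_ge0 ltW.
rewrite le_max; apply/orP; right; rewrite /scaled_moment.
apply: (le_trans (ler_wpM2l (_ : 0 <= n.+1%:R ^+ j) H2)); first by rewrite exprn_ge0.
rewrite -exprVn -exprMn le_eqVlt; apply/orP; left; apply/eqP; congr (_ ^+ _).
by field; rewrite !gt_eqF.
Qed.

Let m1 := moment_limit c L 1.
Definition limit_moment (k : nat) : R := if k is 0 then 1 else moment_limit c L k.

Lemma cvg_alpha_seq : alpha_seq u n @[n --> \oo] --> m1 / (2 * L).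
Proof.
rewrite (_ : alpha_seq u = fun n => scaled_moment c 1 L n / (2 * L)).
  apply: cvgM; last exact: cvg_cst.
  exact: (scaled_moment_cvg L_gt0 c_gt0 p_ge0 p_mono a_gt0 aL p_bounded).
by apply/funext => n; exact: alpha_seqE.
Qed.

Lemma cst_alphaE : cst_alpha u = m1 / (2 * L).
Proof. by apply: cvg_lim => //; exact: cvg_alpha_seq. Qed.

Lemma limit_momentE k : (0 < k)%N -> limit_moment k =
  cst_alpha u * (2 * L) ^+ k * (k.-1)`!%:R / \prod_(1 <= i < k) cst_cbar u i.
Proof.
case: k => // k _; rewrite /limit_moment.
rewrite (moment_limitE L_gt0 c_gt0 p_ge0 p_mono a_gt0 aL p_bounded)// -/m1 cst_alphaE.
rewrite prod_cst_cbar exprS.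
have P0 : 0 < \prod_(1 <= i < k.+1) c i.
  by rewrite big_nat; apply: prodr_gt0 => i /andP[i0 _]; exact: c_gt0.
move: (\prod_(1 <= i < k.+1) c i) P0 => p p0 /=; field.
by rewrite ?expf_neq0 ?mulf_neq0 ?expf_neq0 ?gt_eqF.
Qed.

Let D := Num.max 1 (c 1%N)^-1.

(** By [moment_limit_le] the moment of order k + 1 is at most m1 k! / c_1^k, so D = max(1, 1 / c_1)
    serves as geometric rate. The constant m1 + 2 absorbs the added 1 and the value 1 at order 0. *)
Lemma limit_moment_growth i :
  ((4 * D)^-1 ^+ n / n`!%:R * (limit_moment (i + n)%N + 1)) @[n --> \oo] --> (0 : R).
Proof.
have D1 : 1 <= D by rewrite le_max lexx.
have m10 : 0 <= m1.
  exact: (moment_limit_ge0 L_gt0 c_gt0 p_ge0 p_mono a_gt0 aL p_bounded).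
apply: (@factorial_growth _ limit_moment (m1 + 2)).
- by rewrite addr_ge0.
- exact: lt_le_trans D1.
- case=> [|k]; first exact: ler01.
  exact: (moment_limit_ge0 L_gt0 c_gt0 p_ge0 p_mono a_gt0 aL p_bounded).
case=> [|k]; first by rewrite fact0 expr0 !mulr1 /limit_moment; lra.
have := moment_limit_le L_gt0 c_gt0 p_ge0 p_mono a_gt0 aL p_bounded (ltn0Sn k).
have cm j : (0 < j)%N -> c 1%N <= c j.
  by move=> j0; exact: (decrement_nat_mono d_ge1 L_gt0 C_gt0 (lawZ 0) u1).
move=> /(_ cm); rewrite -/m1 /= => H.
have Dk : 1 <= D ^+ k.+1 by rewrite exprn_ege1.
have f1 : 1 <= k.+1`!%:R :> R by rewrite ler1n fact_gt0.
have fk : k`!%:R <= k.+1`!%:R :> R by rewrite ler_nat factS leq_pmull.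
have H2 : m1 * k`!%:R / c 1%N ^+ k <= m1 * k.+1`!%:R * D ^+ k.+1.
  rewrite -exprVn; apply: ler_pM; rewrite ?mulr_ge0 ?exprn_ge0 ?invr_ge0 ?(ltW (c_gt0 _))//.
    by rewrite ler_wpM2l.
  apply: (@le_trans _ _ (D ^+ k)); last by rewrite exprS ler_peMl ?exprn_ge0 ?(le_trans ler01).
  by rewrite lerXn2r ?nnegrE ?invr_ge0 ?(ltW (c_gt0 _))// ?(le_trans ler01)// le_max lexx orbT.
have H3 : 1 <= k.+1`!%:R * D ^+ k.+1 by rewrite -[leLHS]mulr1 ler_pM.
by rewrite /limit_moment -mulrA mulrDl; rewrite -mulrA in H2; lra.
Qed.

Lemma center_dist_coupling : exists (q : nat -> R -> R) (Y : R -> R),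
  [/\ forall n, measurable_fun setT (q n), measurable_fun setT Y,
    (forall n v, 0 <= q n v) /\ (forall v, q n v @[n --> \oo] --> Y v),
    forall n (B : set R), measurable B ->
      uniform_prob (@ltr01 R) (q n @^-1` B) = P ((fun w => n%:R * X n w) @^-1` B) &
    forall k, (\int[uniform_prob (@ltr01 R)]_v (Y v ^+ k)%:E = (limit_moment k)%:E)%E].
Proof.
have D0 : 0 < D by rewrite lt_max ltr01.
have h0 : 0 < (4 * D)^-1 by rewrite invr_gt0 mulr_gt0.
pose M n k := if k is 0 then 1 else scaled_moment c k (enorm a) n.
apply: (@moment_coupling _ _ _ P (fun n w => n%:R * X n w) M limit_moment _ _ _ _ _ h0 limit_moment_growth).
- by move=> n; apply: measurable_funM => //; exact: measurable_center_dist.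
- by move=> n w; rewrite mulr_ge0// /X center_distE enorm_ge0.
- move=> n [|k]; first by rewrite /M; under eq_integral do rewrite expr0; exact: integral_probability_cst.
  rewrite /M /scaled_moment EFinM -expectation_center_dist_exp// unlock -ge0_integralZl//=.
  + by apply: eq_integral => w _; rewrite -EFinM exprMn.
  + apply/measurable_EFinP; apply: measurable_funX; exact: measurable_center_dist.
  + by move=> w _; rewrite lee_fin exprn_ge0// /X center_distE enorm_ge0.
- case=> [|k]; first exact: cvg_cst.
  exact: (scaled_moment_cvg L_gt0 c_gt0 p_ge0 p_mono a_gt0 aL p_bounded).
Qed.

End polarized_ball_chain.

Lemma symmetric_difference_measure (R : realType) d (c : 'rV[R]_d) (r : R) :
  (0 < d)%N -> 0 < r ->
  lebesgue_rV d (eball c r `+` eball 0 r) = (lune_measure d.-1 r (enorm c))%:E.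
Proof. by case: d c => // n c _ r0; exact: lune_measureE. Qed.

Lemma measurable_scaled_lune_measure (R : realType) n (r a b : R) :
  measurable_fun setT (fun z : R => a * lune_measure n r (z / b)).
Proof.
have mz : measurable_fun setT (fun z : R => z / b) by exact: measurable_funM.
exact: (measurable_funM (measurable_cst a) (measurableT_comp (@measurable_lune_measure R n r) mz)).
Qed.

Lemma ball_rearrangement_eball (R : realType) d (a : 'rV[R]_d) (r : R) (S : set 'rV[R]_d) :
  (0 < d)%N -> 0 < r -> is_ball_rearrangement (eball a r) S -> S = eball 0 r.
Proof.
move=> d0 r0 [rho [-> E]]; congr eball.
have := lebesgue_rV_eballE a r0; rewrite -E => {}E.
have rho0 : 0 < rho.
  rewrite ltNge; apply/negP => rho0.
  move: E; rewrite (_ : eball 0 rho = set0) ?measure0; last first.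
    rewrite predeqE => x; split => //; rewrite /eball/= => /lt_le_trans/(_ rho0).
    by rewrite ltNge enorm_ge0.
  move=> /(congr1 fine)/esym/eqP; rewrite /= mulf_eq0 expf_eq0 d0/= !gt_eqF//.
  exact: ball_volume_gt0.
move: E; rewrite [LHS](lebesgue_rV_eballE 0 rho0) => -[] /mulIf.
move=> /(_ (lt0r_neq0 (ball_volume_gt0 d))) /eqP.
by rewrite eqrXn2 ?(ltW rho0) ?(ltW r0)// => /eqP.
Qed.

(** * The chain on the line and its exponential limit *)

Section one_dimensional_chain.
Context {R : realType} {L : R}.
Context {disp : measure_display} {T : measurableType disp} {P : probability T R}.
Variables (sigma : nat -> T -> reflection R 1) (r : R) (u a : 'rV[R]_1).
Hypotheses (L_gt0 : 0 < L) (r_gt0 : 0 < r) (u1 : enorm u = 1).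
Hypothesis sigma_iid : iid_reflections P L sigma.
Hypothesis a_sub : eball a r `<=` eball 0 L.
Hypothesis a_gt0 : 0 < enorm a.

Let C := (2 * L * @sphere_area R 1)^-1.
Let c (j : nat) := decrement C u j%:R.
Let theta_gt0 : 0 < 2 * L. Proof. by rewrite mulr_gt0. Qed.
Let cE j : (0 < j)%N -> c j = j%:R / (j.+1%:R * (2 * L)).
Proof. exact: integral_rV1_decrement. Qed.

Lemma expectation_center_dist1 n : ('E_P[center_dist sigma (eball a r) n])%E =
  (2 * L * \int[lebesgue_measure]_(t in `[0, enorm a / (2 * L)]) ((1 - t) ^+ n))%:E.
Proof.
rewrite -(moment_poly_uniform1 theta_gt0 cE n (ltW a_gt0)).
rewrite -(expectation_center_dist_exp (ltnSn 0) L_gt0 r_gt0 u1 sigma_iid a_sub n (ltnSn 0)).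
by congr expectation.
Qed.

Lemma limit_moment1 k : limit_moment (L := L) u k = k`!%:R * (2 * L) ^+ k.
Proof.
case: k => [|k]; first by rewrite fact0 expr0 mulr1.
have aL := eball_sub_center r_gt0 a_sub.
(* The start L lies below theta = 2L, so (1 - L / (2L))^n tends to 0 in the explicit formula for n
   E[X_n]. *)
have m1E : moment_limit c L 1 = 2 * L.
  apply: cvg_lim => //; apply: (scaled_moment_uniform_cvg theta_gt0 cE) => //.
  by rewrite mulr_natl mulr2n ltrDl.
rewrite (limit_momentE (ltnSn 0) L_gt0 r_gt0 u1 sigma_iid a_sub a_gt0)//.
rewrite (cst_alphaE (ltnSn 0) L_gt0 r_gt0 u1 sigma_iid a_sub a_gt0) m1E.
rewrite (prod_cst_cbar _ (ltnSn 0) L_gt0) (prod_uniform theta_gt0 cE)//= factS natrM exprS.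
field.
by rewrite expf_neq0 ?gt_eqF//= addrC natr1 pnatr_eq0.
Qed.

(** The limit Y of the general coupling has the moments k! (2L)^k of the exponential law, and these
    determine it. *)
Lemma cvg_in_distribution_exponential :
  cvg_in_distribution P (fun n w => n%:R * center_dist sigma (eball a r) n w)
    (exponential_prob (2 * L)^-1).
Proof.
have [q [Y [mq mY [q0 qY] law EY]]] :=
  center_dist_coupling (ltnSn 0) L_gt0 r_gt0 u1 sigma_iid a_sub a_gt0.
have Y0 v : 0 <= Y v by apply: ler_cvg_to (cvg_cst 0) (qY v) _; near=> n.
have mX n : measurable_fun setT (fun w => n%:R * center_dist sigma (eball a r) n w).
  by apply: measurable_funM => //; exact: (measurable_center_dist r_gt0 sigma_iid).
split => // f cf bf.
have mf : measurable_fun setT f by exact: continuous_measurable_fun.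
have mn : measurable_fun setT (Num.norm : measurableTypeR R -> R) by exact: normr_measurable.
rewrite [X in _ --> X](_ : _ = \int[uniform_prob (@ltr01 R)]_v (f (Y v))%:E)%E.
  exact: (@coupling_integral_cvg _ _ _ _ _ P (uniform_prob (@ltr01 R)) _ q (fun=> id) Y
    mX mq (fun=> @measurable_id _ _ setT) mY law qY).
(* [exponential_prob] lives on [measurableTypeR R], whose measurable structure is
   not convertible to the default one of [R], hence the transport along [id]. *)
have mid : @measurable_fun _ _ (measurableTypeR R) R setT id by exact: measurable_id.
pose idRV : {RV exponential_law theta_gt0 >-> R} :=
  @mfun_Sub _ _ (measurableTypeR R) R id (mem_set mid).
suff law' (B : set R) : measurable B ->
    exponential_law theta_gt0 (id @^-1` B) = uniform_prob (@ltr01 R) (Y @^-1` B).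
  have E := @eq_law_integral R _ R (distribution (exponential_law theta_gt0) idRV)
    _ _ (uniform_prob (@ltr01 R)) _ R id Y (@measurable_id _ R setT) mY (fun x : R => (f x)%:E)
    (proj2 (measurable_EFinP _ _) mf) law'.
  exact: E.
move=> mB; rewrite (exponential_law_normr theta_gt0 mB).
apply: (@moments_determine_law _ (limit_moment (L := L) u) _ _ _ (exponential_law theta_gt0) Num.norm
  _ _ (uniform_prob (@ltr01 R)) Y _
  (limit_moment_growth (ltnSn 0) L_gt0 r_gt0 u1 sigma_iid a_sub a_gt0)) => //.
- by rewrite invr_gt0 mulr_gt0// lt_max ltr01.
- by move=> k; rewrite (exponential_law_moment theta_gt0) limit_moment1.
Unshelve. all: by end_near. Qed.

End one_dimensional_chain.

(** In (i) the product starts at i = 1, as the value X_0^j at n = 0 demands; for j = 1 a factor of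
    index 0 would be c_0 = 1. In (vii) the constant 2 kappa_(d-1) r^(d-1) is the slope of the
    measure of the lune at distance 0. *)
Theorem theorem2 (R : realType) (d : nat) (L : R)
    (disp : measure_display) (T : measurableType disp) (P : probability T R)
    (sigma : nat -> T -> reflection R d)
    (a : 'rV[R]_d) (r : R) (u : 'rV[R]_d)
    (d_ge1 : (1 <= d)%N) (L_gt0 : 0 < L)
    (sigma_iid : iid_reflections P L sigma)
    (r_gt0 : 0 < r) (A_sub_BL : eball a r `<=` eball 0 L)
    (X0_gt0 : 0 < enorm a) (u_unit : enorm u = 1) :
  let A := polarized sigma (eball a r) in
  let X := center_dist sigma (eball a r) in
  let X0 := enorm a in
  (* A_n is again a ball of radius r, and X_n is a random variable *)
  (forall n, (forall w, exists c, A n w = eball c r) /\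
             measurable_fun setT (X n)) /\
  (* (i) *)
  (forall n j, (1 <= j)%N ->
     ('E_P[fun w => (X n w ^+ j)%R])%E =
     (\sum_(0 <= k < n.+1) 'C(n, k)%:R * (-1) ^+ k * X0 ^+ (k + j) *
        \prod_(1 <= i < k.+1) cst_c u L (i + j - 1)%N%:R)%:E) /\
  (* (ii) *)
  (forall b : 'rV[R]_d, eball b r `<=` eball 0 L -> X0 < enorm b ->
     forall n k, (1 <= k)%N ->
       ('E_P[fun w => (X n w ^+ k)%R] <
        'E_P[fun w => (center_dist sigma (eball b r) n w ^+ k)%R])%E) /\
  (* (iii) *)
  (d = 1%N ->
     (forall n, ('E_P[X n])%E =
        (2 * L * \int[lebesgue_measure]_(t in `[0, X0 / (2 * L)])
                   ((1 - t) ^+ n))%:E) /\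
     cvg_in_distribution P (fun n w => n%:R * X n w)
       (exponential_prob (2 * L)^-1)) /\
  (* (iv) *)
  (forall (alpha : R) n, 1 <= alpha ->
     ('E_P[fun w => (X n w `^ alpha)%R] <=
      ((X0^-1 + cst_c u L alpha * alpha^-1 * n%:R) `^ (- alpha))%:E)%E) /\
  (* (v) *)
  ((1 < d)%N -> forall n,
     ((X0^-1 + cst_ell u L * n%:R)^-1%R%:E <= 'E_P[X n])%E) /\
  (* (vi) and (vii) *)
  cvgn (alpha_seq u) /\
  (exists (disp' : measure_display) (S : measurableType disp')
          (Q : probability S R) (Y : {RV Q >-> R}),
     [/\ cvg_in_distribution P (fun n w => n%:R * X n w) (distribution Q Y),
         forall k, (1 <= k)%N ->
           ('E_Q[fun s => (Y s ^+ k)%R])%E =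
           (cst_alpha u * (2 * L) ^+ k * (k.-1)`!%:R /
            \prod_(1 <= i < k) cst_cbar u i)%:E
       & forall Astar, is_ball_rearrangement (eball a r) Astar ->
           cvg_in_distribution P
             (fun n w => n%:R * fine (lebesgue_rV d (A n w `+` Astar)))
             (pushforward Q
               (fun s => 2 * ball_volume d.-1 * r ^+ d.-1 * Y s))]).
Proof.
move=> A X X0.
have aL : enorm a <= L by exact: (eball_sub_center r_gt0 A_sub_BL).
have XE n w : X n w = enorm (center_at (fun i w => sigma i w 0) a n w).
  exact: center_distE.
have EX n j : (0 < j)%N -> _ := expectation_center_dist_exp d_ge1 L_gt0 r_gt0 u_unit sigma_iid A_sub_BL n (j := j).
split; [|split; [|split; [|split; [|split; [|split; [|split]]]]]].
- move=> n; split; last exact: (measurable_center_dist r_gt0 sigma_iid).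
  by move=> w; eexists; exact: polarizedE.
- move=> n j j1; rewrite EX// moment_polyE; congr EFin; apply: eq_bigr => k _; congr (_ * _).
  apply: eq_big_nat => i /andP[i1 _]; apply/esym/cst_c_nat.
  by rewrite -addnBA// addn_gt0 i1.
- move=> b b_sub ab n k k1.
  have := moment_poly_center_lt d_ge1 L_gt0 u_unit sigma_iid n k1 (ltW X0_gt0) ab
    (eball_sub_center r_gt0 b_sub).
  rewrite -lte_fin -(EX n k k1).
  by rewrite -(expectation_center_dist_exp d_ge1 L_gt0 r_gt0 u_unit sigma_iid b_sub n k1).
- move=> d1; subst d; split; first by move=> n; exact: (expectation_center_dist1 L_gt0 r_gt0 u_unit sigma_iid).
  exact: (cvg_in_distribution_exponential L_gt0 r_gt0 u_unit sigma_iid).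
- move=> alpha n alpha1.
  exact: (expectation_center_dist_powR d_ge1 L_gt0 r_gt0 u_unit sigma_iid A_sub_BL n (lt_le_trans ltr01 alpha1)).
- move=> d1 n; exact: (expectation_center_dist_ge d_ge1 L_gt0 r_gt0 u_unit sigma_iid A_sub_BL n d1).
- by have := cvg_alpha_seq d_ge1 L_gt0 r_gt0 u_unit sigma_iid A_sub_BL X0_gt0; exact: cvgP.
have [q [Y [mq mY [q0 qY] law EY]]] :=
  center_dist_coupling d_ge1 L_gt0 r_gt0 u_unit sigma_iid A_sub_BL X0_gt0.
have mX n : measurable_fun setT (fun w => n%:R * X n w).
  by apply: measurable_funM => //; exact: (measurable_center_dist r_gt0 sigma_iid).
have Y0 v : 0 <= Y v by apply: ler_cvg_to (cvg_cst 0) (qY v) _; near=> n.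
pose Q : probability (measurableTypeR R) R := uniform_prob (@ltr01 R).
pose RVY : {RV Q >-> R} := @mfun_Sub _ _ (measurableTypeR R) R Y (mem_set mY).
exists _, (measurableTypeR R), Q, RVY; split.
- exact: (@coupling_cvg_in_distribution _ _ _ _ _ P Q _ q (fun=> id) Y
    mX mq (fun=> @measurable_id _ _ setT) mY law qY).
- move=> k k1; rewrite unlock; apply: etrans (EY k) _; congr EFin.
  exact: (limit_momentE d_ge1 L_gt0 r_gt0 u_unit sigma_iid A_sub_BL X0_gt0).
move=> S /(ball_rearrangement_eball d_ge1 r_gt0) ->.
(* The symmetric difference depends on A_n only through X_n as far as its measure is concerned, so n
   times this measure is a function of n X_n and the same coupling applies. *)
pose psi (n : nat) (z : R) := n%:R * lune_measure d.-1 r (z / n%:R).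
have mpsi n : measurable_fun setT (psi n) by exact: measurable_scaled_lune_measure.
have psi_cvg v : psi n (q n v) @[n --> \oo] --> 2 * ball_volume d.-1 * r ^+ d.-1 * Y v.
  exact: lune_measure_cvg.
have mW : measurable_fun setT (fun v => 2 * ball_volume d.-1 * r ^+ d.-1 * Y v).
  exact: measurable_funM.
rewrite (_ : (fun n w => _) = (fun n w => psi n (n%:R * X n w))).
  exact: (@coupling_cvg_in_distribution _ _ _ _ _ P Q _ q psi _ mX mq mpsi mW law psi_cvg).
apply/funext => n; apply/funext => w.
have AE : A n w = eball (center_at (fun i w => sigma i w 0) a n w) r by exact: polarizedE.
have E : fine (lebesgue_rV d (A n w `+` eball 0 r)) = lune_measure d.-1 r (X n w).
  by rewrite AE XE (symmetric_difference_measure _ d_ge1 r_gt0).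
(* At n = 0 the distance X_n cannot be recovered from n X_n, but the prefactor n annihilates both
   sides. *)
have [n0|n0] := eqVneq (n%:R : R) 0; first by rewrite /psi n0 !mul0r.
have qX : n%:R * X n w / n%:R = X n w by rewrite mulrC mulKf.
by rewrite /psi qX -E.
Unshelve. all: by end_near. Qed.
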